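(* Let $\Bbbk$ be an algebraically closed field and let $\mathcal{C}$ be a hereditary finite pointed ($\Bbbk$-linear abelian) monoidal category with a fiber functor. Then $\mathcal{C}$, together with its fiber functor, is equivalent to $(\operatorname{Rep}Q,\mathcal{F})$ for some finite acyclic quiver $Q$, where $\operatorname{Rep}Q$ is the category of finite-dimensional representations of $Q$ (equipped with a suitable monoidal structure) and $\mathcal{F}$ is the forgetful functor from $\operatorname{Rep}Q$ to the category $\operatorname{Vec}_\Bbbk$ of vector spaces.
   Context: All monoidal categories are $\Bbbk$-linear abelian. Finite: a monoidal category is finite if its underlying category is equivalent to the category of finite-dimensional comodules over a finite-dimensional coalgebra over $\Bbbk$. Pointed: a $\Bbbk$-linear monoidal category is pointed if the isomorphism classes of its simple objects form a monoid under the tensor product (in particular the tensor product of two simple objects is simple and the unit object is simple). Hereditary: an abelian category is hereditary if $\operatorname{Ext}^n(-,-)=0$ for all $n\ge2$. Fiber functor: a $\Bbbk$-linear exact faithful (strong) monoidal functor to the category of finite-dimensional $\Bbbk$-vector spaces. A quiver $Q=(Q_0,Q_1,s,t)$ consists of a set $Q_0$ of vertices, a set $Q_1$ of arrows, and source and target maps $s,t:Q_1\to Q_0$; it is finite if $Q_0$ and $Q_1$ are finite, and acyclic if it has no nontrivial path whose starting and ending vertices coincide. A representation $V=(V_g,V_a)_{g\in Q_0,a\in Q_1}$ of $Q$ consists of a vector space $V_g$ for each vertex $g$ and a linear map $V_a:V_{s(a)}\to V_{t(a)}$ for each arrow $a$; a morphism $\phi:V\to W$ is a family of linear maps $\phi_g:V_g\to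 W_g$ with $W_a\phi_{s(a)}=\phi_{t(a)}V_a$ for every arrow $a$. The forgetful functor $\mathcal{F}$ sends $V$ to its underlying vector space $\bigoplus_{g\in Q_0}V_g$. ''$\mathcal{C}$ with fiber functor $\omega$ is equivalent to $(\operatorname{Rep}Q,\mathcal{F})$'' means: there is a monoidal structure on $\operatorname{Rep}Q$ for which $\mathcal{F}$ is a fiber functor, and a $\Bbbk$-linear monoidal equivalence $E:\mathcal{C}\to\operatorname{Rep}Q$ such that $\mathcal{F}\circ E\cong\omega$ as monoidal functors. *)

(* Defs.v *)
From HB Require Import structures.
From mathcomp Require Import all_boot all_order all_algebra.
From Stdlib Require Import Relation_Operators.
Set Implicit Arguments.
Unset Strict Implicit.
Unset Printing Implicit Defensive.
Import GRing.Theory.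
Local Open Scope ring_scope.

Declare Scope cat_scope.
Delimit Scope cat_scope with cat.
Local Open Scope cat_scope.

Record klin_cat (k : fieldType) := KLinCat {
  obj :> Type;
  hom : obj -> obj -> lmodType k;
  idm : forall X, hom X X;
  cmp : forall X Y Z, hom Y Z -> hom X Y -> hom X Z;
  cmp_idl : forall X Y (f : hom X Y), cmp (idm Y) f = f;
  cmp_idr : forall X Y (f : hom X Y), cmp f (idm X) = f;
  cmpA : forall X Y Z T (h : hom Z T) (g : hom Y Z) (f : hom X Y),
    cmp h (cmp g f) = cmp (cmp h g) f;
  cmp_linl : forall X Y Z (f : hom X Y), linear (fun g : hom Y Z => cmp g f);
  cmp_linr : forall X Y Z (g : hom Y Z), linear (fun f : hom X Y => cmp g f)
}.
Arguments hom {k C} X Y : rename.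
Arguments idm {k C} X : rename.
Arguments cmp {k C X Y Z} g f : rename.

Notation "g ∘ f" := (cmp g f) (at level 40, left associativity) : cat_scope.

Section Abelian.
Variables (k : fieldType) (C : klin_cat k).
Implicit Types X Y Z : C.

Definition is_iso X Y (f : hom X Y) :=
  exists g : hom Y X, g ∘ f = idm X /\ f ∘ g = idm Y.

Definition is_mono X Y (f : hom X Y) :=
  forall Z (g h : hom Z X), f ∘ g = f ∘ h -> g = h.

Definition is_epi X Y (f : hom X Y) :=
  forall Z (g h : hom Y Z), g ∘ f = h ∘ f -> g = h.

Definition is_zero Z :=
  (forall X (f : hom X Z), f = 0) /\ (forall X (f : hom Z X), f = 0).

Definition is_kernel K X Y (i : hom K X) (f : hom X Y) :=
  f ∘ i = 0 /\
  forall Z (g : hom Z X), f ∘ g = 0 -> exists! h : hom Z K, i ∘ h = g.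

Definition is_cokernel X Y K (p : hom Y K) (f : hom X Y) :=
  p ∘ f = 0 /\
  forall Z (g : hom Y Z), g ∘ f = 0 -> exists! h : hom K Z, h ∘ p = g.

Definition is_biproduct X Y P (i1 : hom X P) (i2 : hom Y P)
    (p1 : hom P X) (p2 : hom P Y) :=
  [/\ p1 ∘ i1 = idm X, p2 ∘ i2 = idm Y, p2 ∘ i1 = 0, p1 ∘ i2 = 0
    & i1 ∘ p1 + i2 ∘ p2 = idm P].

Definition abelian_cat :=
  [/\ exists Z, is_zero Z,
      forall X Y, exists P i1 i2 p1 p2, @is_biproduct X Y P i1 i2 p1 p2,
      forall X Y (f : hom X Y), exists K (i : hom K X), is_kernel i f,
      forall X Y (f : hom X Y), exists K (p : hom Y K), is_cokernel p f
    & (forall X Y (f : hom X Y), is_mono f ->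
         exists Z (g : hom Y Z), is_kernel f g) /\
      (forall X Y (f : hom X Y), is_epi f ->
         exists Z (g : hom Z X), is_cokernel f g)].

Definition is_simple X :=
  ~ is_zero X /\
  forall Y (i : hom Y X), is_mono i -> is_zero Y \/ is_iso i.

Definition short_exact X Y Z (f : hom X Y) (g : hom Y Z) :=
  is_kernel f g /\ is_cokernel g f.

(* ker g = im f: f factors as an epimorphism followed by the kernel of g. *)
Definition exact_at X Y Z (f : hom X Y) (g : hom Y Z) :=
  exists K (i : hom K Y) (p : hom X K), [/\ is_kernel i g, is_epi p & f = i ∘ p].

(* Yoneda extensions of length n = m + 2,                                     *)
(*   0 -> Y -> E 0 -> E 1 -> ... -> E m.+1 -> X -> 0,                         *)
(* the values of E beyond m.+1 and of d beyond m being irrelevant.            *)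
Record yoneda_ext (m : nat) X Y := YonedaExt {
  ext_obj : nat -> C;
  ext_in : hom Y (ext_obj 0);
  ext_d : forall i, hom (ext_obj i) (ext_obj i.+1);
  ext_out : hom (ext_obj m.+1) X;
  ext_mono : is_mono ext_in;
  ext_exact_in : exact_at ext_in (ext_d 0);
  ext_exact : forall i, (i < m)%N -> exact_at (ext_d i) (ext_d i.+1);
  ext_exact_out : exact_at (ext_d m) ext_out;
  ext_epi : is_epi ext_out
}.

Definition ext_morph m X Y (E E' : yoneda_ext m X Y) :=
  exists phi : forall i, hom (ext_obj E i) (ext_obj E' i),
  [/\ phi 0%N ∘ ext_in E = ext_in E',
      forall i, (i <= m)%N -> phi i.+1 ∘ ext_d E i = ext_d E' i ∘ phi i
    & ext_out E' ∘ phi m.+1 = ext_out E].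

(* Ext^(m+2)(X, Y) is the set of classes of extensions for the equivalence    *)
(* relation generated by the morphisms that are the identity on X and Y.  It  *)
(* is never empty, so it vanishes iff all extensions lie in one class.        *)
Definition ext_eqv m X Y : yoneda_ext m X Y -> yoneda_ext m X Y -> Prop :=
  clos_refl_sym_trans _ (@ext_morph m X Y).

Definition ext_vanishes m X Y := forall E E' : yoneda_ext m X Y, ext_eqv E E'.

Definition hereditary := forall m X Y, ext_vanishes m X Y.

End Abelian.

Section Functors.
Variable k : fieldType.
Implicit Types C D E : klin_cat k.

Record lin_functor C D := LinFunctor {
  fob :> C -> D;
  fmap : forall X Y, hom X Y -> hom (fob X) (fob Y);
  fmap_lin : forall X Y, linear (@fmap X Y);
  fmap_id : forall X, fmap (idm X) = idm (fob X);
  fmap_cmp : forall X Y Z (g : hom Y Z) (f : hom X Y),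
    fmap (g ∘ f) = fmap g ∘ fmap f
}.

Definition faithful C D (F : lin_functor C D) :=
  forall X Y, injective (@fmap _ _ F X Y).

Definition exact_functor C D (F : lin_functor C D) :=
  forall X Y Z (f : hom X Y) (g : hom Y Z),
    short_exact f g -> short_exact (fmap F f) (fmap F g).

Definition id_functor C : lin_functor C C :=
  @LinFunctor C C id (fun _ _ f => f) (fun _ _ _ _ _ => erefl) (fun=> erefl)
    (fun _ _ _ _ _ => erefl).

Section CompFunctor.
Variables (C D E : klin_cat k) (G : lin_functor D E) (F : lin_functor C D).
Let GF_map X Y (f : hom X Y) : hom (G (F X)) (G (F Y)) := fmap G (fmap F f).
Fact comp_functor_lin X Y : linear (@GF_map X Y).
Proof. by move=> a f g; rewrite /GF_map !fmap_lin. Qed.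
Fact comp_functor_id X : GF_map (idm X) = idm (G (F X)).
Proof. by rewrite /GF_map !fmap_id. Qed.
Fact comp_functor_cmp X Y Z (g : hom Y Z) (f : hom X Y) :
  GF_map (g ∘ f) = GF_map g ∘ GF_map f.
Proof. by rewrite /GF_map !fmap_cmp. Qed.
Definition comp_functor : lin_functor C E :=
  LinFunctor comp_functor_lin comp_functor_id comp_functor_cmp.
End CompFunctor.

Definition is_nat_iso C D (F G : lin_functor C D)
    (eta : forall X, hom (F X) (G X)) :=
  (forall X, is_iso (eta X)) /\
  forall X Y (f : hom X Y), eta Y ∘ fmap F f = fmap G f ∘ eta X.

Definition nat_iso C D (F G : lin_functor C D) :=
  exists eta, @is_nat_iso C D F G eta.

Definition is_equivalence C D (F : lin_functor C D) :=
  exists G : lin_functor D C,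
    nat_iso (comp_functor G F) (id_functor C) /\
    nat_iso (comp_functor F G) (id_functor D).

Definition equivalent_cat C D := exists F : lin_functor C D, is_equivalence F.

End Functors.

Section Monoidal.
Variable k : fieldType.

Record monoidal (C : klin_cat k) := Monoidal {
  tob : C -> C -> C;
  tmor : forall X X' Y Y',
    hom X X' -> hom Y Y' -> hom (tob X Y) (tob X' Y');
  tunit : C;
  assoc : forall X Y Z, hom (tob (tob X Y) Z) (tob X (tob Y Z));
  lunit : forall X, hom (tob tunit X) X;
  runit : forall X, hom (tob X tunit) X;
  tmor_linl : forall X X' Y Y' (g : hom Y Y'),
    linear (fun f : hom X X' => tmor f g);
  tmor_linr : forall X X' Y Y' (f : hom X X'),
    linear (fun g : hom Y Y' => tmor f g);
  tmor_id : forall X Y, tmor (idm X) (idm Y) = idm (tob X Y);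
  tmor_cmp : forall X X' X'' Y Y' Y'' (f' : hom X' X'') (f : hom X X')
      (g' : hom Y' Y'') (g : hom Y Y'),
    tmor (f' ∘ f) (g' ∘ g) = tmor f' g' ∘ tmor f g;
  assoc_iso : forall X Y Z, is_iso (assoc X Y Z);
  lunit_iso : forall X, is_iso (lunit X);
  runit_iso : forall X, is_iso (runit X);
  assoc_nat : forall X X' Y Y' Z Z'
      (f : hom X X') (g : hom Y Y') (h : hom Z Z'),
    assoc X' Y' Z' ∘ tmor (tmor f g) h = tmor f (tmor g h) ∘ assoc X Y Z;
  lunit_nat : forall X X' (f : hom X X'),
    lunit X' ∘ tmor (idm tunit) f = f ∘ lunit X;
  runit_nat : forall X X' (f : hom X X'),
    runit X' ∘ tmor f (idm tunit) = f ∘ runit X;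
  triangle : forall X Y,
    tmor (idm X) (lunit Y) ∘ assoc X tunit Y = tmor (runit X) (idm Y);
  pentagon : forall X Y Z T,
    assoc X Y (tob Z T) ∘ assoc (tob X Y) Z T
    = tmor (idm X) (assoc Y Z T) ∘ assoc X (tob Y Z) T
      ∘ tmor (assoc X Y Z) (idm T)
}.

(* Associativity and unitality of the product on isomorphism classes come     *)
(* from the associator and the unitors, so that the classes of simple objects *)
(* form a monoid as soon as they contain the unit and are closed under it.    *)
Definition pointed (C : klin_cat k) (M : monoidal C) :=
  is_simple (tunit M) /\
  forall X Y : C, is_simple X -> is_simple Y -> is_simple (tob M X Y).

Record strong_monoidal (C D : klin_cat k) (M : monoidal C) (N : monoidal D)
    (F : lin_functor C D) := StrongMonoidal {
  mon2 : forall X Y, hom (tob N (F X) (F Y)) (F (tob M X Y));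
  mon0 : hom (tunit N) (F (tunit M));
  mon2_iso : forall X Y, is_iso (mon2 X Y);
  mon0_iso : is_iso mon0;
  mon2_nat : forall X X' Y Y' (f : hom X X') (g : hom Y Y'),
    mon2 X' Y' ∘ tmor N (fmap F f) (fmap F g) = fmap F (tmor M f g) ∘ mon2 X Y;
  mon_assoc : forall X Y Z,
    fmap F (assoc M X Y Z) ∘ mon2 (tob M X Y) Z ∘ tmor N (mon2 X Y) (idm (F Z))
    = mon2 X (tob M Y Z) ∘ tmor N (idm (F X)) (mon2 Y Z)
      ∘ assoc N (F X) (F Y) (F Z);
  mon_lunit : forall X,
    fmap F (lunit M X) ∘ mon2 (tunit M) X ∘ tmor N mon0 (idm (F X))
    = lunit N (F X);
  mon_runit : forall X,
    fmap F (runit M X) ∘ mon2 X (tunit M) ∘ tmor N (idm (F X)) mon0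
    = runit N (F X)
}.

Lemma is_iso_cmp (C : klin_cat k) (X Y Z : C) (g : hom Y Z) (f : hom X Y) :
  is_iso g -> is_iso f -> is_iso (g ∘ f).
Proof.
case=> g' [g'g gg'] [f' [f'f ff']]; exists (f' ∘ g'); split.
  by rewrite cmpA -(cmpA f') g'g cmp_idr.
by rewrite cmpA -(cmpA g) ff' cmp_idr.
Qed.

Lemma is_iso_fmap (C D : klin_cat k) (F : lin_functor C D) (X Y : C)
  (f : hom X Y) : is_iso f -> is_iso (fmap F f).
Proof.
by case=> g [gf fg]; exists (fmap F g); rewrite -!fmap_cmp gf fg !fmap_id.
Qed.

Section Composition.
Variables (C D E : klin_cat k) (M : monoidal C) (N : monoidal D).
Variables (P : monoidal E) (F : lin_functor C D) (G : lin_functor D E).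
Variables (J : strong_monoidal M N F) (H : strong_monoidal N P G).

Let GF := comp_functor G F.
Definition comp_mon2 (X Y : C) : hom (tob P (GF X) (GF Y)) (GF (tob M X Y)) :=
  fmap G (mon2 J X Y) ∘ mon2 H (F X) (F Y).
Definition comp_mon0 : hom (tunit P) (GF (tunit M)) :=
  fmap G (mon0 J) ∘ mon0 H.

Fact comp_mon2_iso X Y : is_iso (comp_mon2 X Y).
Proof. apply: (is_iso_cmp _ (mon2_iso H _ _)); exact/is_iso_fmap/mon2_iso. Qed.

Fact comp_mon0_iso : is_iso comp_mon0.
Proof. apply: (is_iso_cmp _ (mon0_iso H)); exact/is_iso_fmap/mon0_iso. Qed.

Fact comp_mon2_nat (X X' Y Y' : C) (f : hom X X') (g : hom Y Y') :
  comp_mon2 X' Y' ∘ tmor P (fmap GF f) (fmap GF g)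
  = fmap GF (tmor M f g) ∘ comp_mon2 X Y.
Proof. by rewrite /comp_mon2 /= -cmpA mon2_nat !cmpA -!fmap_cmp mon2_nat. Qed.

Lemma tmor_cmpl (X X' X'' Y : E) (f' : hom X' X'') (f : hom X X') :
  tmor P (f' ∘ f) (idm Y) = tmor P f' (idm Y) ∘ tmor P f (idm Y).
Proof. by rewrite -tmor_cmp cmp_idl. Qed.

Lemma tmor_cmpr (X Y Y' Y'' : E) (g' : hom Y' Y'') (g : hom Y Y') :
  tmor P (idm X) (g' ∘ g) = tmor P (idm X) g' ∘ tmor P (idm X) g.
Proof. by rewrite -tmor_cmp cmp_idl. Qed.

Lemma mon2_natl (X X' Y : D) (f : hom X X') :
  mon2 H X' Y ∘ tmor P (fmap G f) (idm (G Y))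
  = fmap G (tmor N f (idm Y)) ∘ mon2 H X Y.
Proof. by rewrite -mon2_nat fmap_id. Qed.

Lemma mon2_natr (X Y Y' : D) (g : hom Y Y') :
  mon2 H X Y' ∘ tmor P (idm (G X)) (fmap G g)
  = fmap G (tmor N (idm X) g) ∘ mon2 H X Y.
Proof. by rewrite -mon2_nat fmap_id. Qed.

Fact comp_mon_assoc (X Y Z : C) :
  fmap GF (assoc M X Y Z) ∘ comp_mon2 (tob M X Y) Z
    ∘ tmor P (comp_mon2 X Y) (idm (GF Z))
  = comp_mon2 X (tob M Y Z) ∘ tmor P (idm (GF X)) (comp_mon2 Y Z)
    ∘ assoc P (GF X) (GF Y) (GF Z).
Proof.
rewrite /comp_mon2 tmor_cmpl tmor_cmpr /=.
rewrite -[in RHS](cmpA (fmap G _)) [in RHS](cmpA (mon2 H _ _)) mon2_natr.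
rewrite -!cmpA [in RHS](cmpA (mon2 H _ _)) -mon_assoc.
rewrite [in LHS](cmpA (mon2 H _ _)) mon2_natl.
by rewrite !cmpA -!fmap_cmp mon_assoc.
Qed.

Fact comp_mon_lunit (X : C) :
  fmap GF (lunit M X) ∘ comp_mon2 (tunit M) X ∘ tmor P comp_mon0 (idm (GF X))
  = lunit P (GF X).
Proof.
rewrite /comp_mon2 /comp_mon0 tmor_cmpl /= -!cmpA.
rewrite (cmpA (mon2 H _ _)) mon2_natl !cmpA -!fmap_cmp mon_lunit.
exact: mon_lunit.
Qed.

Fact comp_mon_runit (X : C) :
  fmap GF (runit M X) ∘ comp_mon2 X (tunit M) ∘ tmor P (idm (GF X)) comp_mon0
  = runit P (GF X).
Proof.
rewrite /comp_mon2 /comp_mon0 tmor_cmpr /= -!cmpA.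
rewrite (cmpA (mon2 H _ _)) mon2_natr !cmpA -!fmap_cmp mon_runit.
exact: mon_runit.
Qed.

Definition comp_monoidal : strong_monoidal M P GF :=
  StrongMonoidal comp_mon2_iso comp_mon0_iso comp_mon2_nat comp_mon_assoc
    comp_mon_lunit comp_mon_runit.
End Composition.

Definition is_monoidal_nat_iso (C D : klin_cat k) (M : monoidal C)
    (N : monoidal D) (F G : lin_functor C D) (J : strong_monoidal M N F)
    (H : strong_monoidal M N G) (eta : forall X, hom (F X) (G X)) :=
  [/\ is_nat_iso eta,
      forall X Y, eta (tob M X Y) ∘ mon2 J X Y
                  = mon2 H X Y ∘ tmor N (eta X) (eta Y)
    & eta (tunit M) ∘ mon0 J = mon0 H].

Definition monoidal_iso (C D : klin_cat k) (M : monoidal C) (N : monoidal D)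
    (F G : lin_functor C D) (J : strong_monoidal M N F)
    (H : strong_monoidal M N G) :=
  exists eta, is_monoidal_nat_iso J H eta.

End Monoidal.

(* {ffun I -> _} has a vector space structure only for constant families, so  *)
(* the direct sum of a dependent family is built as functions on I.           *)
Section DirectSum.
Variables (k : fieldType) (I : finType) (V : I -> vectType k).

Definition dsum : Type := {dffun forall i, V i}.
Definition dsum_fun (u : dsum) : {dffun forall i, V i} := u.
Coercion dsum_fun : dsum >-> dfinfun_of.
Definition mk_dsum (u : forall i, V i) : dsum := finfun u.

Lemma mk_dsumE u i : mk_dsum u i = u i.
Proof. exact: ffunE. Qed.
Lemma dsumP (u v : dsum) : (forall i, u i = v i) -> u = v.
Proof. by move=> e; apply/ffunP. Qed.

HB.instance Definition _ := Choice.copy dsum {dffun forall i, V i}.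

Definition dsum_add (u v : dsum) := mk_dsum (fun i => u i + v i).
Definition dsum_opp (u : dsum) := mk_dsum (fun i => - u i).
Definition dsum_scale (a : k) (u : dsum) := mk_dsum (fun i => a *: u i).

Fact dsum_addA : associative dsum_add.
Proof. by move=> u v w; apply: dsumP => i; rewrite !mk_dsumE addrA. Qed.
Fact dsum_addC : commutative dsum_add.
Proof. by move=> u v; apply: dsumP => i; rewrite !mk_dsumE addrC. Qed.
Fact dsum_add0 : left_id (mk_dsum (fun=> 0)) dsum_add.
Proof. by move=> u; apply: dsumP => i; rewrite !mk_dsumE add0r. Qed.
Fact dsum_addN : left_inverse (mk_dsum (fun=> 0)) dsum_opp dsum_add.
Proof. by move=> u; apply: dsumP => i; rewrite !mk_dsumE addNr. Qed.
HB.instance Definition _ :=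
  GRing.isZmodule.Build dsum dsum_addA dsum_addC dsum_add0 dsum_addN.

Fact dsum_scaleA a b u : dsum_scale a (dsum_scale b u) = dsum_scale (a * b) u.
Proof. by apply: dsumP => i; rewrite !mk_dsumE scalerA. Qed.
Fact dsum_scale1 : left_id 1 dsum_scale.
Proof. by move=> u; apply: dsumP => i; rewrite !mk_dsumE scale1r. Qed.
Fact dsum_scaleDr : right_distributive dsum_scale +%R.
Proof. by move=> a u v; apply: dsumP => i; rewrite !mk_dsumE scalerDr. Qed.
Fact dsum_scaleDl u : {morph dsum_scale^~ u : a b / a + b}.
Proof. by move=> a b; apply: dsumP => i; rewrite !mk_dsumE scalerDl. Qed.
HB.instance Definition _ := GRing.Zmodule_isLmodule.Build k dsum
  dsum_scaleA dsum_scale1 dsum_scaleDr dsum_scaleDl.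

Lemma dsumD (u v : dsum) i : (u + v) i = u i + v i.
Proof. exact: mk_dsumE. Qed.
Lemma dsumZ a (u : dsum) i : (a *: u) i = a *: u i.
Proof. exact: mk_dsumE. Qed.

Let J : finType := {i : I & 'I_(\dim {: V i})}.
Fact dsum_vect_iso : Vector.axiom #|J| dsum.
Proof.
pose f (u : dsum) : 'rV[k]_#|J| :=
  \row_j coord (vbasis {: V (tag (enum_val j : J))})
               (tagged (enum_val j : J)) (u (tag (enum_val j : J))).
pose g (x : 'rV[k]_#|J|) : dsum := mk_dsum
  (fun i => \sum_(j < \dim {: V i}) x 0 (enum_rank (@Tagged _ i (fun i => 'I_(\dim {: V i})) j : J))
              *: (vbasis {: V i})`_j).
exists f; first by move=> a u v; apply/rowP=> j; rewrite !mxE dsumD dsumZ linearP.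
exists g => [u | x].
  apply: dsumP => i; rewrite mk_dsumE [RHS](coord_vbasis (memvf _)).
  by apply: eq_bigr => j _; rewrite mxE enum_rankK.
apply/rowP=> j; rewrite mxE mk_dsumE coord_sum_free; last first.
  exact: (basis_free (vbasisP _)).
by congr (x 0 _); apply: (canLR enum_valK); case: (enum_val j).
Qed.
HB.instance Definition _ := Lmodule_hasFinDim.Build k dsum dsum_vect_iso.

End DirectSum.


Section Linear.
Variable k : fieldType.
Implicit Types V W X Y : vectType k.

Lemma linfunE V W (f : V -> W) v : linear f -> linfun f v = f v.
Proof.
move=> fL.
pose g : {linear V -> W} := HB.pack f (GRing.isLinear.Build _ _ _ _ f fL).
exact: (lfunE g).
Qed.

Lemma comp_lfun_linl V W X (f : 'Hom(V, W)) :
  linear (fun g : 'Hom(W, X) => (g \o f)%VF).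
Proof. by move=> a g g'; rewrite comp_lfunDl comp_lfunZl. Qed.

Lemma comp_lfun_linr V W X (g : 'Hom(W, X)) :
  linear (fun f : 'Hom(V, W) => (g \o f)%VF).
Proof. by move=> a f f'; rewrite comp_lfunDr comp_lfunZr. Qed.

Definition vbase V (i : 'I_(\dim {: V})) : V := (vbasis {: V})`_i.
Definition vcoord V (i : 'I_(\dim {: V})) (v : V) : k :=
  coord (vbasis {: V}) i v.

(* Tensors are matrices of coordinates in vbasis; tlift_pure and tensor_ext   *)
(* below are the universal property: a bilinear map factors, uniquely,        *)
(* through pure.                                                              *)
Definition tensor V W : vectType k := 'M[k]_(\dim {: V}, \dim {: W}).

Definition pure V W (v : V) (w : W) : tensor V W :=
  \matrix_(i, j) (vcoord i v * vcoord j w).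

Definition tlift V W X (b : V -> W -> X) : 'Hom(tensor V W, X) :=
  linfun (fun t : 'M[k]_(\dim {: V}, \dim {: W}) =>
            \sum_i \sum_j t i j *: b (vbase i) (vbase j)).

Definition bilin V W X (b : V -> W -> X) :=
  (forall w, linear (b^~ w)) /\ (forall v, linear (b v)).

Lemma linsum V W (f : V -> W) (I : finType) (a : I -> k) (u : I -> V) :
  linear f -> f (\sum_i a i *: u i) = \sum_i a i *: f (u i).
Proof.
move=> fL; rewrite -(linfunE _ fL) linear_sum; apply: eq_bigr => i _.
by rewrite linearZ /= linfunE.
Qed.

Lemma vbase_sum V (v : V) : v = \sum_i vcoord i v *: vbase i.
Proof. exact: coord_vbasis (memvf v). Qed.

Lemma vcoord_base V i j : vcoord i (vbase j : V) = (i == j)%:R.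
Proof.
by rewrite /vcoord /vbase eq_sym; apply: coord_free (basis_free (vbasisP _)).
Qed.

Lemma pure_bilin V W : bilin (@pure V W).
Proof.
split=> [w a v v' | v a w w']; apply/matrixP=> i j;
  rewrite !mxE /vcoord linearP /=; first by rewrite mulrDl mulrA.
by rewrite mulrDr mulrCA.
Qed.

Lemma tlift_pure V W X (b : V -> W -> X) v w :
  bilin b -> tlift b (pure v w) = b v w.
Proof.
case=> bl br; rewrite linfunE => [|a s u]; last first.
  rewrite scaler_sumr -big_split /=; apply: eq_bigr => i _.
  rewrite scaler_sumr -big_split /=; apply: eq_bigr => j _.
  by rewrite !mxE scalerDl scalerA.
rewrite [in RHS](vbase_sum v) (linsum _ _ (bl w)); apply: eq_bigr => i _.
rewrite [in RHS](vbase_sum w) (linsum _ _ (br _)) scaler_sumr.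
by apply: eq_bigr => j _; rewrite scalerA mxE.
Qed.

Lemma tensor_ext V W X (f g : 'Hom(tensor V W, X)) :
  (forall v w, f (pure v w) = g (pure v w)) -> f = g.
Proof.
move=> e; apply/lfunP => t.
have -> : t = \sum_i \sum_j t i j *: pure (vbase i) (vbase j) :> tensor V W.
  rewrite [LHS]matrix_sum_delta; apply: eq_bigr => i _; apply: eq_bigr => j _.
  congr (_ *: _); apply/matrixP=> a c.
  by rewrite !mxE !vcoord_base -natrM mulnb.
rewrite !linear_sum; apply: eq_bigr => i _; rewrite !linear_sum.
by apply: eq_bigr => j _; rewrite !linearZ /= e.
Qed.

End Linear.

Section Vec.
Variable k : fieldType.
Implicit Types U V W X Y Z : vectType k.

(* vectType's are finite dimensional. *)
Definition vec : klin_cat k :=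
  @KLinCat k (vectType k) (fun V W => 'Hom(V, W)) (fun V => \1%VF)
    (fun V W X g f => (g \o f)%VF)
    (fun V W f => comp_lfun1l f) (fun V W f => comp_lfun1r f)
    (fun V W X Y h g f => comp_lfunA h g f)
    (fun V W X f => comp_lfun_linl f) (fun V W X g => comp_lfun_linr g).

Definition tmap V V' W W' (f : 'Hom(V, V')) (g : 'Hom(W, W')) :
    'Hom(tensor V W, tensor V' W') :=
  tlift (fun v w => pure (f v) (g w)).

Definition tassoc V W X :
    'Hom(tensor (tensor V W) X, tensor V (tensor W X)) :=
  tlift (fun t x => tlift (fun v w => pure v (pure w x)) t).

Definition tlunit V : 'Hom(tensor k^o V, V) :=
  tlift (fun (a : k^o) v => a *: v).

Definition trunit V : 'Hom(tensor V k^o, V) :=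
  tlift (fun v (a : k^o) => a *: v).

Lemma pure_linl V W (w : W) : linear (fun v : V => pure v w).
Proof. by case: (@pure_bilin k V W). Qed.
Lemma pure_linr V W (v : V) : linear (fun w : W => pure v w).
Proof. by case: (@pure_bilin k V W). Qed.

Lemma pureZl V W a (v : V) (w : W) : pure (a *: v) w = a *: pure v w.
Proof. by apply/matrixP=> i j; rewrite !mxE /vcoord linearZ /= mulrA. Qed.
Lemma pureZr V W a (v : V) (w : W) : pure v (a *: w) = a *: pure v w.
Proof. by apply/matrixP=> i j; rewrite !mxE /vcoord linearZ /= mulrCA. Qed.

Lemma tlift_lin (U : vectType k) V W X (b : U -> V -> W -> X) t :
  (forall u, bilin (b u)) -> (forall v w, linear (fun u => b u v w)) ->
  linear (fun u => tlift (b u) t).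
Proof.
move=> b2 b1 a u u'.
suff -> : tlift (b (a *: u + u')) = a *: tlift (b u) + tlift (b u').
  by rewrite lfunE /= lfunE.
by apply: tensor_ext => v w; rewrite lfunE /= lfunE /= !tlift_pure // b1.
Qed.

Lemma tmap_pure V V' W W' (f : 'Hom(V, V')) (g : 'Hom(W, W')) v w :
  tmap f g (pure v w) = pure (f v) (g w).
Proof.
apply: tlift_pure; split=> [{}w a x y | {}v a x y]; rewrite linearP.
  exact: pure_linl.
exact: pure_linr.
Qed.

Lemma tassoc_pure V W X (v : V) (w : W) (x : X) :
  tassoc V W X (pure (pure v w) x) = pure v (pure w x).
Proof.
have b2 y : bilin (fun (v : V) (w : W) => pure v (pure w y : tensor W X)).
  split=> [{}w|{}v a u u']; first exact: pure_linl.
  by rewrite pure_linl pure_linr.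
rewrite /tassoc tlift_pure; first by rewrite tlift_pure.
split=> [y a s t | s]; first by rewrite linearP.
apply: tlift_lin => // {}v {}w a y y'; by rewrite !pure_linr.
Qed.

Lemma tlunit_pure V (a : k^o) v : tlunit V (pure a v) = a *: v.
Proof.
apply: tlift_pure; split=> [w b x y | b c x y].
  by rewrite scalerDl scalerA.
by rewrite scalerDr !scalerA mulrC.
Qed.

Lemma trunit_pure V v (a : k^o) : trunit V (pure v a) = a *: v.
Proof.
apply: tlift_pure; split=> [b c x y | w b x y].
  by rewrite scalerDr !scalerA mulrC.
by rewrite scalerDl scalerA.
Qed.

Lemma tensor_ext3 V W X Y (f g : 'Hom(tensor (tensor V W) X, Y)) :
  (forall v w x, f (pure (pure v w) x) = g (pure (pure v w) x)) -> f = g.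
Proof.
move=> e; apply: tensor_ext => t x.
pose fx (h : 'Hom(tensor (tensor V W) X, Y)) : 'Hom(tensor V W, Y) :=
  linfun (fun t => h (pure t x)).
have fxE h s : fx h s = h (pure s x).
  by apply: linfunE => a u u'; rewrite pure_linl linearP.
rewrite -!fxE; congr (fun_of_lfun _ t); apply: tensor_ext => v w.
by rewrite !fxE.
Qed.

Lemma tensor_ext3r V W X Y (f g : 'Hom(tensor V (tensor W X), Y)) :
  (forall v w x, f (pure v (pure w x)) = g (pure v (pure w x))) -> f = g.
Proof.
move=> e; apply: tensor_ext => v t.
pose fx (h : 'Hom(tensor V (tensor W X), Y)) : 'Hom(tensor W X, Y) :=
  linfun (fun t => h (pure v t)).
have fxE h s : fx h s = h (pure v s).
  by apply: linfunE => a u u'; rewrite pure_linr linearP.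
rewrite -!fxE; congr (fun_of_lfun _ t); apply: tensor_ext => w x.
by rewrite !fxE.
Qed.

Lemma tensor_ext4 V W X Y Z
    (f g : 'Hom(tensor (tensor (tensor V W) X) Y, Z)) :
  (forall v w x y, f (pure (pure (pure v w) x) y)
                   = g (pure (pure (pure v w) x) y)) -> f = g.
Proof.
move=> e; apply: tensor_ext => t y.
pose fy (h : 'Hom(tensor (tensor (tensor V W) X) Y, Z)) :
  'Hom(tensor (tensor V W) X, Z) := linfun (fun t => h (pure t y)).
have fyE h s : fy h s = h (pure s y).
  by apply: linfunE => a u u'; rewrite pure_linl linearP.
rewrite -!fyE; congr (fun_of_lfun _ t); apply: tensor_ext3 => v w x.
by rewrite !fyE.
Qed.

Fact tmap_linl V V' W W' (g : 'Hom(W, W')) :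
  linear (fun f : 'Hom(V, V') => tmap f g).
Proof.
move=> a f f'; apply: tensor_ext => v w.
by rewrite lfunE /= [in RHS]lfunE /= !tmap_pure lfunE /= lfunE /= pure_linl.
Qed.

Fact tmap_linr V V' W W' (f : 'Hom(V, V')) :
  linear (fun g : 'Hom(W, W') => tmap f g).
Proof.
move=> a g g'; apply: tensor_ext => v w.
by rewrite lfunE /= [in RHS]lfunE /= !tmap_pure lfunE /= lfunE /= pure_linr.
Qed.

Fact tmap_id V W : tmap (\1 : 'End(V))%VF (\1 : 'End(W))%VF = \1%VF.
Proof. by apply: tensor_ext => v w; rewrite tmap_pure !lfunE. Qed.

Fact tmap_comp V V' V'' W W' W'' (f' : 'Hom(V', V'')) (f : 'Hom(V, V'))
    (g' : 'Hom(W', W'')) (g : 'Hom(W, W')) :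
  tmap (f' \o f)%VF (g' \o g)%VF = (tmap f' g' \o tmap f g)%VF.
Proof.
by apply: tensor_ext => v w; rewrite !(tmap_pure, lfunE) /= !tmap_pure.
Qed.

Fact vec_assoc_iso (V W X : vec) :
  is_iso (tassoc V W X
          : hom (tensor (tensor V W) X : vec) (tensor V (tensor W X))).
Proof.
pose b (x : X) (v : V) (w : W) : tensor (tensor V W) X := pure (pure v w) x.
pose g : 'Hom(tensor V (tensor W X), tensor (tensor V W) X) :=
  tlift (fun v t => tlift (fun w x => pure (pure v w) x) t).
have gE v w x : g (pure v (pure w x)) = pure (pure v w) x.
  have b2 u : bilin (fun w x => pure (pure u w : tensor V W) x
                                : tensor (tensor V W) X).
    split=> [{}x a y y' | {}w]; last exact: pure_linr.
    by rewrite pure_linr pure_linl.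
  rewrite /g tlift_pure; first by rewrite tlift_pure.
  split=> [t | u a s t]; last by rewrite linearP.
  by apply: tlift_lin => // {}w {}x a u u'; rewrite !pure_linl.
exists g; split.
  by apply: tensor_ext3 => v w x; rewrite !lfunE /= tassoc_pure gE.
by apply: tensor_ext3r => v w x; rewrite !lfunE /= gE tassoc_pure.
Qed.

Fact vec_lunit_iso (V : vec) :
  is_iso (tlunit V : hom (tensor k^o V : vec) (V : vec)).
Proof.
pose g : 'Hom(V, tensor k^o V) := linfun (fun v => pure (1 : k^o) v).
have gE v : g v = pure (1 : k^o) v by apply: linfunE; apply: pure_linr.
exists g; split; last first.
  by apply/lfunP => v; rewrite !lfunE /= gE tlunit_pure scale1r.
apply: tensor_ext => a v; rewrite !lfunE /= tlunit_pure gE.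
by rewrite pureZr -pureZl /GRing.scale /= mulr1.
Qed.

Fact vec_runit_iso (V : vec) :
  is_iso (trunit V : hom (tensor V k^o : vec) (V : vec)).
Proof.
pose g : 'Hom(V, tensor V k^o) := linfun (fun v => pure v (1 : k^o)).
have gE v : g v = pure v (1 : k^o) by apply: linfunE; apply: pure_linl.
exists g; split; last first.
  by apply/lfunP => v; rewrite !lfunE /= gE trunit_pure scale1r.
apply: tensor_ext => v a; rewrite !lfunE /= trunit_pure gE.
by rewrite pureZl -pureZr /GRing.scale /= mulr1.
Qed.

Fact tassoc_nat V V' W W' X X'
    (f : 'Hom(V, V')) (g : 'Hom(W, W')) (h : 'Hom(X, X')) :
  (tassoc V' W' X' \o tmap (tmap f g) h
   = tmap f (tmap g h) \o tassoc V W X)%VF.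
Proof.
apply: tensor_ext3 => v w x.
by rewrite !lfunE /= !(tassoc_pure, tmap_pure).
Qed.

Fact tlunit_nat V V' (f : 'Hom(V, V')) :
  (tlunit V' \o tmap \1 f = f \o tlunit V)%VF.
Proof.
apply: tensor_ext => a v.
by rewrite !lfunE /= tmap_pure !tlunit_pure lfunE /= linearZ.
Qed.

Fact trunit_nat V V' (f : 'Hom(V, V')) :
  (trunit V' \o tmap f \1 = f \o trunit V)%VF.
Proof.
apply: tensor_ext => v a.
by rewrite !lfunE /= tmap_pure !trunit_pure lfunE /= linearZ.
Qed.

Fact tensor_triangle V W :
  (tmap \1 (tlunit W) \o tassoc V k^o W = tmap (trunit V) \1)%VF.
Proof.
apply: tensor_ext3 => v a w; rewrite !lfunE /= tassoc_pure !tmap_pure.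
by rewrite trunit_pure tlunit_pure !lfunE /= pureZl pureZr.
Qed.

Fact tensor_pentagon V W X Y :
  (tassoc V W (tensor X Y) \o tassoc (tensor V W) X Y
   = tmap \1 (tassoc W X Y) \o tassoc V (tensor W X) Y
     \o tmap (tassoc V W X) \1)%VF.
Proof.
apply: tensor_ext4 => v w x y.
by do !rewrite ?(lfunE, tassoc_pure, tmap_pure) /=.
Qed.

Definition vec_monoidal : monoidal vec :=
  @Monoidal k vec (@tensor k) tmap k^o tassoc tlunit trunit
    (@tmap_linl) (@tmap_linr) (@tmap_id) (@tmap_comp)
    vec_assoc_iso vec_lunit_iso vec_runit_iso
    (@tassoc_nat) (@tlunit_nat) (@trunit_nat) (@tensor_triangle)
    (@tensor_pentagon).

Definition is_fiber_functor (C : klin_cat k) (M : monoidal C)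
    (F : lin_functor C vec) (J : strong_monoidal M vec_monoidal F) :=
  exact_functor F /\ faithful F.

End Vec.

Section Comodules.
Variable k : fieldType.

Record coalgebra := Coalgebra {
  coalg_space :> vectType k;
  comul : 'Hom(coalg_space, tensor coalg_space coalg_space);
  counit : 'Hom(coalg_space, k^o);
  comulA : (tmap \1 comul \o comul
            = tassoc coalg_space coalg_space coalg_space
              \o tmap comul \1 \o comul)%VF;
  counitl : (tlunit coalg_space \o tmap counit \1 \o comul = \1)%VF;
  counitr : (trunit coalg_space \o tmap \1 counit \o comul = \1)%VF
}.

Variable A : coalgebra.

Record comodule := Comodule {
  comod_space :> vectType k;
  coact : 'Hom(comod_space, tensor comod_space A);
  coactA : (tmap \1 (comul A) \o coact
            = tassoc comod_space A A \o tmap coact \1 \o coact)%VF;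
  coact_counit : (trunit comod_space \o tmap \1 (counit A) \o coact = \1)%VF
}.
Implicit Types V W X : comodule.

Definition is_comod_hom V W : pred 'Hom(V, W) :=
  fun f => (coact W \o f == tmap f \1 \o coact V)%VF.

Record comod_hom V W := ComodHom {
  comod_fun :> 'Hom(V, W);
  comod_funP : is_comod_hom comod_fun
}.
HB.instance Definition _ V W := [isSub for @comod_fun V W].
HB.instance Definition _ V W := [Choice of comod_hom V W by <:].

Fact comod_hom_submod V W : subsemimod_closed (@is_comod_hom V W).
Proof.
split; [split=> [|f g] | move=> a f]; rewrite -!topredE /= /is_comod_hom.
- have t0 : tmap (0 : 'Hom(V, W)) \1 = 0 :> 'Hom(tensor V A, tensor W A).
    by rewrite -(linfunE 0 (@tmap_linl _ V W A A \1)) linear0.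
  by rewrite comp_lfun0r t0 comp_lfun0l.
- move=> /eqP fP /eqP gP; have := tmap_linl (\1 : 'End(A))%VF 1 f g.
  by rewrite !scale1r => ->; rewrite comp_lfunDr comp_lfunDl fP gP.
move=> /eqP fP.
have := tmap_linl (\1 : 'End(A))%VF a f 0.
have -> : tmap (0 : 'Hom(V, W)) \1 = 0 :> 'Hom(tensor V A, tensor W A).
  by rewrite -(linfunE 0 (@tmap_linl _ V W A A \1)) linear0.
by rewrite !addr0 => ->; rewrite -comp_lfunZr -comp_lfunZl fP.
Qed.
HB.instance Definition _ V W := GRing.SubChoice_isSubLmodule.Build k
  'Hom(V, W) (@is_comod_hom V W) (comod_hom V W) (@comod_hom_submod V W).

Fact comod_idP V : is_comod_hom (\1 : 'Hom(V, V))%VF.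
Proof. by rewrite /is_comod_hom comp_lfun1r tmap_id comp_lfun1l. Qed.

Fact comod_compP V W X (g : comod_hom W X) (f : comod_hom V W) :
  is_comod_hom (g \o f)%VF.
Proof.
have [/eqP gP /eqP fP] := (comod_funP g, comod_funP f).
rewrite /is_comod_hom comp_lfunA gP -comp_lfunA fP comp_lfunA -tmap_comp.
by rewrite comp_lfun1l.
Qed.

Definition comod_id V : comod_hom V V := ComodHom (comod_idP V).
Definition comod_comp V W X (g : comod_hom W X) (f : comod_hom V W) :=
  ComodHom (comod_compP g f).

Fact comod_idl V W (f : comod_hom V W) : comod_comp (comod_id W) f = f.
Proof. by apply/val_inj/comp_lfun1l. Qed.
Fact comod_idr V W (f : comod_hom V W) : comod_comp f (comod_id V) = f.
Proof. by apply/val_inj/comp_lfun1r. Qed.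
Fact comod_compA V W X Y (h : comod_hom X Y) (g : comod_hom W X)
    (f : comod_hom V W) :
  comod_comp h (comod_comp g f) = comod_comp (comod_comp h g) f.
Proof. by apply/val_inj/comp_lfunA. Qed.
Fact comod_linl V W X (f : comod_hom V W) :
  linear (fun g : comod_hom W X => comod_comp g f).
Proof. by move=> a g g'; apply/val_inj/comp_lfun_linl. Qed.
Fact comod_linr V W X (g : comod_hom W X) :
  linear (fun f : comod_hom V W => comod_comp g f).
Proof. by move=> a f f'; apply/val_inj/comp_lfun_linr. Qed.

Definition comod_cat : klin_cat k :=
  @KLinCat k comodule (fun V W => comod_hom V W) comod_id comod_comp
    comod_idl comod_idr comod_compA comod_linl comod_linr.

End Comodules.

Definition finite_cat (k : fieldType) (C : klin_cat k) :=
  exists A : coalgebra k, equivalent_cat C (comod_cat A).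

Record quiver := Quiver {
  vertex : finType;
  arrow : finType;
  src : arrow -> vertex;
  tgt : arrow -> vertex
}.

(* No nonempty path a :: p of composable arrows returns to its start.         *)
Definition acyclic (Q : quiver) :=
  forall (a : arrow Q) (p : seq (arrow Q)),
    path (fun b c => tgt b == src c) a p -> tgt (last a p) != src a.

Section Representations.
Variables (k : fieldType) (Q : quiver).

Record rep := Rep {
  rep_space :> vertex Q -> vectType k;
  rep_map : forall a : arrow Q, 'Hom(rep_space (src a), rep_space (tgt a))
}.
Implicit Types V W X : rep.

Definition is_rep_hom V W :
    pred (dsum (fun g => 'Hom(V g, W g) : vectType k)) :=
  fun f => [forall a, rep_map W a \o f (src a) == f (tgt a) \o rep_map V a]%VF.

Record rep_hom V W := RepHom {
  rep_fun :> dsum (fun g => 'Hom(V g, W g) : vectType k);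
  rep_funP : is_rep_hom rep_fun
}.
HB.instance Definition _ V W := [isSub for @rep_fun V W].
HB.instance Definition _ V W := [Choice of rep_hom V W by <:].

Fact rep_hom_submod V W : subsemimod_closed (@is_rep_hom V W).
Proof.
split; [split=> [|f g] | move=> b f]; rewrite -!topredE /= /is_rep_hom.
- apply/forallP=> a; rewrite ![(0 : dsum _) _]mk_dsumE.
  by rewrite comp_lfun0l comp_lfun0r.
- move=> /forallP fP /forallP gP; apply/forallP=> a.
  by rewrite !dsumD comp_lfunDl comp_lfunDr (eqP (fP a)) (eqP (gP a)).
move=> /forallP fP.
by apply/forallP=> a; rewrite !dsumZ -comp_lfunZl -comp_lfunZr (eqP (fP a)).
Qed.
HB.instance Definition _ V W := GRing.SubChoice_isSubLmodule.Build k
  (dsum (fun g => 'Hom(V g, W g) : vectType k)) (@is_rep_hom V W) (rep_hom V W)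
  (@rep_hom_submod V W).

Lemma rep_homP V W (f g : rep_hom V W) : (forall i, f i = g i) -> f = g.
Proof. by move=> e; apply/val_inj/dsumP. Qed.

Fact rep_idP V :
  @is_rep_hom V V (mk_dsum (V := fun g => 'Hom(V g, V g)) (fun g => \1%VF)).
Proof. by apply/forallP=> a; rewrite !mk_dsumE comp_lfun1l comp_lfun1r. Qed.

Fact rep_compP V W X (g : rep_hom W X) (f : rep_hom V W) :
  @is_rep_hom V X
    (mk_dsum (V := fun i => 'Hom(V i, X i)) (fun i => g i \o f i)%VF).
Proof.
apply/forallP=> a; rewrite !mk_dsumE comp_lfunA.
rewrite (eqP (forallP (rep_funP g) a)) -!comp_lfunA.
by rewrite (eqP (forallP (rep_funP f) a)).
Qed.

Definition rep_id V : rep_hom V V := RepHom (rep_idP V).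
Definition rep_comp V W X (g : rep_hom W X) (f : rep_hom V W) : rep_hom V X :=
  RepHom (rep_compP g f).

Fact rep_idl V W (f : rep_hom V W) : rep_comp (rep_id W) f = f.
Proof. by apply: rep_homP => i; rewrite !mk_dsumE comp_lfun1l. Qed.
Fact rep_idr V W (f : rep_hom V W) : rep_comp f (rep_id V) = f.
Proof. by apply: rep_homP => i; rewrite !mk_dsumE comp_lfun1r. Qed.
Fact rep_compA V W X Y (h : rep_hom X Y) (g : rep_hom W X) (f : rep_hom V W) :
  rep_comp h (rep_comp g f) = rep_comp (rep_comp h g) f.
Proof. by apply: rep_homP => i; rewrite !mk_dsumE comp_lfunA. Qed.
Fact rep_linl V W X (f : rep_hom V W) :
  linear (fun g : rep_hom W X => rep_comp g f).
Proof.
move=> a g g'; apply: rep_homP => i.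
by rewrite !mk_dsumE comp_lfun_linl.
Qed.
Fact rep_linr V W X (g : rep_hom W X) :
  linear (fun f : rep_hom V W => rep_comp g f).
Proof.
move=> a f f'; apply: rep_homP => i.
by rewrite !mk_dsumE comp_lfun_linr.
Qed.

Definition rep_cat : klin_cat k :=
  @KLinCat k rep (fun V W => rep_hom V W) rep_id rep_comp
    rep_idl rep_idr rep_compA rep_linl rep_linr.

Definition forget_ob V : vectType k := dsum V.
Definition forget_map V W (f : rep_hom V W) : 'Hom(forget_ob V, forget_ob W) :=
  linfun (fun v : dsum V => mk_dsum (V := W) (fun g => f g (v g))).

Fact forget_mapE V W (f : rep_hom V W) (v : dsum V) g :
  (forget_map f v : dsum W) g = f g (v g).
Proof.
rewrite /forget_map linfunE ?mk_dsumE // => a u w.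
by apply: dsumP => i; rewrite !mk_dsumE linearP.
Qed.

Fact forget_lin V W : linear (@forget_map V W).
Proof.
move=> a f g; apply/lfunP => v; apply: dsumP => i.
have -> : (a *: forget_map f + forget_map g) v
          = a *: forget_map f v + forget_map g v by rewrite !lfunE /= lfunE.
rewrite forget_mapE mk_dsumE lfunE /= mk_dsumE lfunE /=.
by rewrite [RHS]dsumD dsumZ !forget_mapE.
Qed.

Fact forget_id V : forget_map (rep_id V) = \1%VF.
Proof.
by apply/lfunP => v; apply: dsumP => i; rewrite forget_mapE mk_dsumE !lfunE.
Qed.

Fact forget_cmp V W X (g : rep_hom W X) (f : rep_hom V W) :
  forget_map (rep_comp g f) = (forget_map g \o forget_map f)%VF.
Proof.
apply/lfunP => v; apply: dsumP => i.
by rewrite forget_mapE mk_dsumE !lfunE /= !forget_mapE.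
Qed.

Definition forget : lin_functor rep_cat (vec k) :=
  @LinFunctor k rep_cat (vec k) forget_ob forget_map
    forget_lin forget_id forget_cmp.

End Representations.

(* (C, omega) is equivalent to (Rep Q, F) for some monoidal structure on      *)
(* Rep Q and some strong monoidal structure on the forgetful functor F.       *)
Definition equivalent_to_rep (k : fieldType) (C : klin_cat k) (M : monoidal C)
    (omega : lin_functor C (vec k))
    (J : strong_monoidal M (vec_monoidal k) omega) (Q : quiver) :=
  exists (N : monoidal (rep_cat k Q))
         (H : strong_monoidal N (vec_monoidal k) (forget k Q)),
    is_fiber_functor H /\
    exists (E : lin_functor C (rep_cat k Q)) (K : strong_monoidal M N E),
      is_equivalence E /\ monoidal_iso (comp_monoidal K H) J.

(* Main.v *)
From HB Require Import structures.
From mathcomp Require Import all_boot all_order all_algebra.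
From Stdlib Require Import Classical IndefiniteDescription.
Require Import Defs.

(* Tensor powers of a simple object S are simple, and the fiber dimensions of *)
(* simple objects are bounded; hence omega(S) is one-dimensional.  The fiber  *)
(* functor is represented by a projective object P, which then contains the   *)
(* projective cover R_i of each simple object S_i exactly once, so that       *)
(* omega(X) is the direct sum of the Hom(R_i, X).  As C is hereditary, the    *)
(* radical K_i of R_i is projective, hence a direct sum of covers R_j; these  *)
(* summands are the arrows i -> j of the quiver, which is acyclic because     *)
(* dim omega(R_j) < dim omega(R_i).  The functor X |-> (Hom(R_i, X))_i to     *)
(* Rep Q is full because arrows generate all morphisms between covers, and    *)
(* essentially surjective because the decomposition of the K_i makes the      *)
(* images of the R_i free.  The monoidal structure is transported along it.   *)

Set Implicit Arguments.
Unset Strict Implicit.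
Unset Printing Implicit Defensive.
Import GRing.Theory.
Local Open Scope ring_scope.
Local Open Scope cat_scope.

(** This is Gabriel's theorem for a hereditary category whose simple objects have one-dimensional
    fibers, followed by a transport of monoidal structure.

    The dual algebra of a finite-dimensional coalgebra, seen as a comodule, is free on one element,
    so the category has a generator ([dual_generator], [finite_generator]). From it one builds an
    object P with omega(X) = Hom(P, X) naturally in X ([represents_ex]), and P is projective because
    omega is exact. Exactness and faithfulness also make monomorphisms, epimorphisms and exactness
    visible on vectors, so that most arguments chase elements of fibers.

    Every simple object is a quotient of P, which bounds its dimension; tensor powers of a simple
    object are simple by pointedness and their dimensions are powers, so the dimension is 1
    ([simple_dim1]). Hence Hom(P, S) is one-dimensional for S simple, and P is the direct sum of
    pairwise non-isomorphic projective covers R_i. Vanishing of Ext^2 makes the radical K_i of R_i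
    projective ([hereditary_kernel]), so K_i is again a direct sum of covers
    ([projective_decomposition]). All these data form a [presentation] ([presentation_ex]).

    The inclusions R_j -> K_i -> R_i of the summands are the arrows. Iterating the decomposition,
    every morphism between covers is a linear combination of compositions of arrows
    ([arrows_generate]), which gives fullness ([pres_full]); because the decompositions are direct
    the arrows satisfy no relation, so the image of R_i is free on its identity ([pres_free]), which
    gives essential surjectivity ([pres_ess_surj]). Finally the sum of the Hom(R_i, X) is omega(X)
    ([pres_eval_nat_iso]), and this isomorphism is monoidal once the tensor product has been carried
    to Rep Q and the structure of the forgetful functor has been pulled back from omega
    ([assembly]). *)

Lemma min_measure (T : Type) (P : T -> Prop) (m : T -> nat) :
  (exists x, P x) -> exists2 x, P x & forall y, P y -> (m x <= m y)%N.
Proof.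
case=> x; have [n] := ubnP (m x); elim: n x => // n IH x le_mx Px.
have [[y [Py lt_yx]] | noy] := classic (exists y, P y /\ (m y < m x)%N).
  by apply: (IH y) => //; apply: leq_trans lt_yx _.
exists x => // y Py; rewrite leqNgt; apply/negP => lt_yx.
by apply: noy; exists y.
Qed.

(** * Linear maps, kernels, cokernels and isomorphisms in linear categories *)

Section LinearPred.
Variables (k : fieldType) (V W : lmodType k) (F : V -> W).
Hypothesis F_lin : linear F.
Let G : {linear V -> W} := HB.pack F (GRing.isLinear.Build _ _ _ _ F F_lin).

Lemma linp0 : F 0 = 0. Proof. exact: (linear0 G). Qed.
Lemma linpD u v : F (u + v) = F u + F v. Proof. exact: (linearD G). Qed.
Lemma linpN u : F (- u) = - F u. Proof. exact: (linearN G). Qed.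
Lemma linpB u v : F (u - v) = F u - F v. Proof. exact: (linearB G). Qed.
Lemma linpZ a u : F (a *: u) = a *: F u. Proof. exact: (linearZ_LR G). Qed.
Lemma linp_sum (I : finType) (P : pred I) (u : I -> V) :
  F (\sum_(i | P i) u i) = \sum_(i | P i) F (u i).
Proof. exact: (linear_sum G). Qed.
End LinearPred.

Section KlinCat.
Variables (k : fieldType) (C : klin_cat k).
Implicit Types X Y Z T : C.

Lemma cmp0l X Y Z (f : hom X Y) : (0 : hom Y Z) ∘ f = 0.
Proof. exact: linp0 (cmp_linl f). Qed.
Lemma cmp0r X Y Z (g : hom Y Z) : g ∘ (0 : hom X Y) = 0.
Proof. exact: linp0 (cmp_linr g). Qed.
Lemma cmpDl X Y Z (g g' : hom Y Z) (f : hom X Y) :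
  (g + g') ∘ f = g ∘ f + g' ∘ f.
Proof. exact: (linpD (cmp_linl f)). Qed.
Lemma cmpDr X Y Z (g : hom Y Z) (f f' : hom X Y) :
  g ∘ (f + f') = g ∘ f + g ∘ f'.
Proof. exact: (linpD (cmp_linr g)). Qed.
Lemma cmpBl X Y Z (g g' : hom Y Z) (f : hom X Y) :
  (g - g') ∘ f = g ∘ f - g' ∘ f.
Proof. exact: (linpB (cmp_linl f)). Qed.
Lemma cmpBr X Y Z (g : hom Y Z) (f f' : hom X Y) :
  g ∘ (f - f') = g ∘ f - g ∘ f'.
Proof. exact: (linpB (cmp_linr g)). Qed.
Lemma cmpZl X Y Z a (g : hom Y Z) (f : hom X Y) : (a *: g) ∘ f = a *: (g ∘ f).
Proof. exact: (linpZ (cmp_linl f)). Qed.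
Lemma cmpZr X Y Z a (g : hom Y Z) (f : hom X Y) : g ∘ (a *: f) = a *: (g ∘ f).
Proof. exact: (linpZ (cmp_linr g)). Qed.
Lemma cmp_suml X Y Z (I : finType) (g : I -> hom Y Z) (f : hom X Y) :
  (\sum_i g i) ∘ f = \sum_i g i ∘ f.
Proof. exact: (linp_sum (cmp_linl f)). Qed.
Lemma cmp_sumr X Y Z (I : finType) (g : hom Y Z) (f : I -> hom X Y) :
  g ∘ (\sum_i f i) = \sum_i g ∘ f i.
Proof. exact: (linp_sum (cmp_linr g)). Qed.

Lemma kernel_mono K X Y (i : hom K X) (f : hom X Y) : is_kernel i f -> is_mono i.
Proof.
case=> fi0 univ Z g h e; have [|u [_ uu]] := univ Z (i ∘ g).
  by rewrite cmpA fi0 cmp0l.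
by rewrite -(uu g) // -(uu h).
Qed.

Lemma cokernel_epi X Y K (p : hom Y K) (f : hom X Y) :
  is_cokernel p f -> is_epi p.
Proof.
case=> pf0 univ Z g h e; have [|u [_ uu]] := univ Z (g ∘ p).
  by rewrite -cmpA pf0 cmp0r.
by rewrite -(uu g) // -(uu h).
Qed.

Lemma mono_kernel_cokernel X Y Z (f : hom X Y) (p : hom Y Z) :
  (exists W (g : hom Y W), is_kernel f g) -> is_cokernel p f -> is_kernel f p.
Proof.
case=> W [g [gf0 univ]] [pf0 couniv]; split=> // T h ph0.
have [u [up _]] := couniv _ g gf0.
by apply: univ; rewrite -up -cmpA ph0 cmp0r.
Qed.

Lemma epi_cokernel_kernel X Y K (f : hom X Y) (i : hom K X) :
  (exists W (g : hom W X), is_cokernel f g) -> is_kernel i f -> is_cokernel f i.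
Proof.
case=> W [g [fg0 couniv]] [fi0 univ]; split=> // T h hi0.
have [u [iu _]] := univ _ g fg0.
by apply: couniv; rewrite -iu cmpA hi0 cmp0l.
Qed.

Lemma is_zeroP Z : is_zero Z <-> idm Z = 0.
Proof.
split=> [[h _] | e]; first exact: h.
split=> X f; first by rewrite -[f]cmp_idl e cmp0l.
by rewrite -[f]cmp_idr e cmp0r.
Qed.

Lemma is_iso_id X : is_iso (idm X).
Proof. by exists (idm X); rewrite cmp_idl. Qed.

Lemma iso_mono X Y (f : hom X Y) : is_iso f -> is_mono f.
Proof.
case=> g [gf _] Z u v e.
by rewrite -[u]cmp_idl -[v]cmp_idl -gf -!cmpA e.
Qed.

Lemma iso_epi X Y (f : hom X Y) : is_iso f -> is_epi f.
Proof.
case=> g [_ fg] Z u v e.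
by rewrite -[u]cmp_idr -[v]cmp_idr -fg !cmpA e.
Qed.

End KlinCat.

Section LinFunctor.
Variables (k : fieldType) (C D : klin_cat k) (F : lin_functor C D).
Implicit Types X Y : C.
Lemma fmap0 X Y : fmap F (0 : hom X Y) = 0.
Proof. exact: linp0 (@fmap_lin _ _ _ F X Y). Qed.
End LinFunctor.

(* Monomorphisms and epimorphisms of vector spaces are detected by k and by   *)
(* a projection onto a complement of the image.                               *)
Section VecCat.
Variable k : fieldType.
Implicit Types V W : vec k.

Lemma vcompE (U V W : vectType k) (g : 'Hom(V, W)) (f : 'Hom(U, V)) x :
  (g \o f)%VF x = g (f x).
Proof. by rewrite lfunE. Qed.
Lemma vidE (V : vectType k) (x : V) : (\1%VF : 'End(V)) x = x.
Proof. by rewrite lfunE. Qed.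

Definition vec_line (V : vectType k) (v : V) : 'Hom(k^o, V) :=
  linfun (fun a : k^o => a *: v).

Lemma vec_lineE (V : vectType k) (v : V) a : vec_line v a = a *: v.
Proof. by apply: linfunE => b x y; rewrite scalerDl scalerA. Qed.

Lemma vec_mono_inj V W (f : hom V W) :
  is_mono f -> injective (fun_of_lfun f).
Proof.
move=> mf x y e.
have /lfunP/(_ 1) : vec_line x = vec_line y.
  apply: (mf (k^o : vectType k)); apply/lfunP=> a; rewrite !lfunE /=.
  by rewrite !vec_lineE !linearZ /= e.
by rewrite !vec_lineE !scale1r.
Qed.

Lemma vec_epi_surj V W (f : hom V W) :
  is_epi f -> forall y : W, exists x : V, fun_of_lfun f x = y.
Proof.
move=> ef y; pose U := limg (f : 'Hom(V, W)).
have /lfunP/(_ y) : projv U = \1%VF.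
  apply: (ef W); apply/lfunP=> x; rewrite !lfunE /= lfunE /=.
  by apply: projv_id; apply: memv_img; apply: memvf.
rewrite lfunE /= => e; have := memv_proj U y; rewrite e.
by case/memv_imgP=> x _ ->; exists x.
Qed.

Lemma vec_kernel (K V W : vec k) (i : hom K V) (f : hom V W) (x : V) :
  is_kernel i f -> fun_of_lfun f x = 0 -> exists y, x = fun_of_lfun i y.
Proof.
case=> _ univ fx0; have [|h [ih _]] := univ (k^o : vectType k) (vec_line x).
  by apply/lfunP=> a; rewrite !lfunE /= vec_lineE linearZ /= fx0 scaler0.
exists (fun_of_lfun h 1); have /lfunP/(_ 1) := ih.
by rewrite vec_lineE scale1r lfunE.
Qed.

End VecCat.

(** * Exact faithful functors to vector spaces *)

Section Fiber.
Variables (k : fieldType) (C : klin_cat k) (omega : lin_functor C (vec k)).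
Hypothesis (aC : abelian_cat C).
Hypothesis (omega_exact : exact_functor omega) (omega_faithful : faithful omega).
Implicit Types X Y Z : C.

Definition vmap X Y (f : hom X Y) (x : omega X : vectType k) :
  (omega Y : vectType k) := fun_of_lfun (fmap omega f) x.

Definition fdim X := \dim {: (omega X : vectType k)}.

Lemma vmap0r X Y (f : hom X Y) : vmap f 0 = 0. Proof. exact: linear0. Qed.
Lemma vmapDr X Y (f : hom X Y) x y : vmap f (x + y) = vmap f x + vmap f y.
Proof. exact: linearD. Qed.
Lemma vmapBr X Y (f : hom X Y) x y : vmap f (x - y) = vmap f x - vmap f y.
Proof. exact: linearB. Qed.
Lemma vmapZr X Y (f : hom X Y) a x : vmap f (a *: x) = a *: vmap f x.
Proof. exact: linearZ. Qed.
Lemma vmap_sumr X Y (f : hom X Y) (I : finType) (x : I -> _) :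
  vmap f (\sum_i x i) = \sum_i vmap f (x i).
Proof. exact: linear_sum. Qed.
Lemma vmap_cmp X Y Z (g : hom Y Z) (f : hom X Y) x : vmap (g ∘ f) x = vmap g (vmap f x).
Proof. by rewrite /vmap fmap_cmp lfunE. Qed.
Lemma vmap_id X x : vmap (idm X) x = x.
Proof. by rewrite /vmap fmap_id lfunE. Qed.
Lemma vmap_linl X Y x : linear (fun f : hom X Y => vmap f x).
Proof. by move=> a f g; rewrite /vmap fmap_lin lfunE /= lfunE. Qed.
Lemma vmap0l X Y x : vmap (0 : hom X Y) x = 0.
Proof. exact: (linp0 (@vmap_linl X Y x)). Qed.
Lemma vmapDl X Y (f g : hom X Y) x : vmap (f + g) x = vmap f x + vmap g x.
Proof. exact: (linpD (@vmap_linl X Y x)). Qed.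
Lemma vmapBl X Y (f g : hom X Y) x : vmap (f - g) x = vmap f x - vmap g x.
Proof. exact: (linpB (@vmap_linl X Y x)). Qed.
Lemma vmapZl X Y a (f : hom X Y) x : vmap (a *: f) x = a *: vmap f x.
Proof. exact: (linpZ (@vmap_linl X Y x)). Qed.
Lemma vmap_suml X Y (I : finType) (f : I -> hom X Y) x :
  vmap (\sum_i f i) x = \sum_i vmap (f i) x.
Proof. exact: (linp_sum (@vmap_linl X Y x)). Qed.

Lemma vmap_inj X Y (f g : hom X Y) : vmap f =1 vmap g -> f = g.
Proof. by move=> e; apply: omega_faithful; apply/lfunP. Qed.

Lemma vmap_eq0 X Y (f : hom X Y) : (forall x, vmap f x = 0) -> f = 0.
Proof. by move=> e; apply: vmap_inj => x; rewrite e vmap0l. Qed.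

Definition inj X Y (f : hom X Y) := injective (vmap f).
Definition sur X Y (f : hom X Y) := forall y, exists x, vmap f x = y.

Lemma inj0 X Y (f : hom X Y) : (forall x, vmap f x = 0 -> x = 0) -> inj f.
Proof.
by move=> h x y e; apply/subr0_eq/h; rewrite vmapBr e subrr.
Qed.

Lemma mono_exact X Y Z (f : hom X Y) (p : hom Y Z) :
  is_mono f -> is_cokernel p f -> short_exact f p.
Proof.
by case: aC => _ _ _ _ [mk _] mf pc; split=> //;
   exact: mono_kernel_cokernel (mk _ _ _ mf) pc.
Qed.

Lemma epi_exact X Y K (f : hom X Y) (i : hom K X) :
  is_epi f -> is_kernel i f -> short_exact i f.
Proof.
by case: aC => _ _ _ _ [_ ek] ef ik; split=> //;
   exact: epi_cokernel_kernel (ek _ _ _ ef) ik.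
Qed.

(** A monomorphism is the kernel of its cokernel, and [omega] preserves that short exact sequence;
    the converse is faithfulness. *)
Lemma monoP X Y (f : hom X Y) : is_mono f <-> inj f.
Proof.
split=> [mf | jf].
  have [_ _ _ /(_ _ _ f)[Z [p pc]] _] := aC.
  have /omega_exact[/kernel_mono] := mono_exact mf pc.
  by move/vec_mono_inj.
move=> Z g h e; apply: vmap_inj => x; apply: jf.
by rewrite -!vmap_cmp e.
Qed.

Lemma epiP X Y (f : hom X Y) : is_epi f <-> sur f.
Proof.
split=> [ef | sf].
  have [_ _ /(_ _ _ f)[K [i ik]] _ _] := aC.
  have /omega_exact[_ /cokernel_epi] := epi_exact ef ik.
  by move/vec_epi_surj.
move=> Z g h e; apply: vmap_inj => y; have [x <-] := sf y.
by rewrite -!vmap_cmp e.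
Qed.

Lemma short_exact_im X Y Z (f : hom X Y) (g : hom Y Z) y :
  short_exact f g -> vmap g y = 0 -> exists x, y = vmap f x.
Proof. by move/omega_exact=> [kf _]; apply: (vec_kernel kf). Qed.

Lemma short_exact_cmp X Y Z (f : hom X Y) (g : hom Y Z) x :
  short_exact f g -> vmap g (vmap f x) = 0.
Proof. by case=> -[gf0 _] _; rewrite -vmap_cmp gf0 vmap0l. Qed.

(** Since [i] is the kernel of its cokernel, it is enough that this cokernel kills [g], which
    faithfulness allows to be checked on vectors. *)
Lemma lift_mono X Y Z (i : hom Y X) (g : hom Z X) :
  inj i -> (forall z, exists y, vmap g z = vmap i y) -> exists h, i ∘ h = g.
Proof.
move=> /monoP mi im; have [_ _ _ /(_ _ _ i)[W [p pc]] _] := aC.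
have se := mono_exact mi pc; have [[_ univ] _] := se.
have [|h [ih _]] := univ _ g; last by exists h.
apply: vmap_eq0 => z; have [y gz] := im z.
by rewrite vmap_cmp gz (short_exact_cmp _ se).
Qed.

Lemma lift_epi X Y Z (p : hom X Y) (g : hom X Z) :
  sur p -> (forall x, vmap p x = 0 -> vmap g x = 0) -> exists h, h ∘ p = g.
Proof.
move=> /epiP ep ke; have [_ _ /(_ _ _ p)[K [i ik]] _ _] := aC.
have se := epi_exact ep ik; have [_ [_ univ]] := se.
have [|h [hp _]] := univ _ g; last by exists h.
apply: vmap_eq0 => z; rewrite vmap_cmp ke //.
by rewrite (short_exact_cmp _ se).
Qed.

Lemma inj_iso X Y (f : hom X Y) : inj f -> sur f -> is_iso f.
Proof.
move=> jf sf; have [y|h fh] := lift_mono (g := idm Y) jf.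
  by have [x <-] := sf y; exists x; rewrite vmap_id.
exists h; split=> //; have /monoP mf := jf; apply: mf.
by rewrite cmpA fh cmp_idl cmp_idr.
Qed.

Lemma iso_sur X Y (f : hom X Y) : is_iso f -> sur f.
Proof. by move=> isf; apply/epiP/iso_epi. Qed.

Lemma image_ex X Y (f : hom X Y) :
  exists I (e : hom X I) (m : hom I Y), [/\ sur e, inj m & f = m ∘ e].
Proof.
have [_ _ kers cokers [_ ek]] := aC.
have [K [i ik]] := kers _ _ f; have [I [e ec]] := cokers _ _ i.
have [_ univ] := ec; have [m [me _]] := univ _ f (proj1 ik).
have ee := cokernel_epi ec.
exists I, e, m; split=> //; first exact/epiP.
(* If [m] kills [d], it factors through the cokernel [q] of [d]. The epimorphism [q ∘ e] is the
   cokernel of some [t] with [f ∘ t = 0], hence [e ∘ t = 0] and [e] factors through [q ∘ e]; so [q]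
   has a left inverse and [d = 0]. *)
apply/monoP => Z g h mgh; apply: subr0_eq; set d := g - h.
have md0 : m ∘ d = 0 by rewrite cmpBr mgh subrr.
have [I' [q qc]] := cokers _ _ d; have [_ /(_ _ m md0)[m' [m'q _]]] := qc.
have eq := cokernel_epi qc.
have /ek[W [t [qet0 /(_ _ e)]]] : is_epi (q ∘ e).
  by move=> T u v; rewrite !cmpA => /ee /eq.
case=> [|r [rqe _]].
  have ft0 : f ∘ t = 0 by rewrite -me -m'q -(cmpA m') -(cmpA m') qet0 cmp0r.
  have [_ /(_ _ t ft0)[t' [<- _]]] := ik.
  by rewrite cmpA; have [-> _] := ec; rewrite cmp0l.
have rq : r ∘ q = idm I by apply: ee; rewrite -cmpA rqe cmp_idl.
by rewrite -[d]cmp_idl -rq -cmpA; have [-> _] := qc; rewrite cmp0r.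
Qed.

(** Exactness of [omega] concerns short exact sequences only, so [f] is replaced by the epimorphism
    of its image factorization, which has the same kernel. *)
Lemma kernel_ex X Y (f : hom X Y) :
  exists K (i : hom K X),
    [/\ is_kernel i f, inj i & forall x, vmap f x = 0 -> exists y, x = vmap i y].
Proof.
have [_ _ /(_ _ _ f)[K [i ik]] _ _] := aC.
exists K, i; split=> //; first exact/monoP/(kernel_mono ik).
have [I [e [m [se jm fme]]]] := image_ex f => x; rewrite fme vmap_cmp => fx0.
have /epiP ee := se; have ex0 : vmap e x = 0 by apply: jm; rewrite fx0 vmap0r.
apply: (short_exact_im _ ex0); apply: epi_exact => //.
split=> [|Z g eg0].
  by have /monoP mm := jm; apply: mm; rewrite cmpA -fme cmp0r (proj1 ik).
by apply: (proj2 ik); rewrite fme -cmpA eg0 cmp0r.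
Qed.

Lemma cokernel_ex X Y (f : hom X Y) :
  exists Z (p : hom Y Z),
    [/\ p ∘ f = 0, sur p & forall y, vmap p y = 0 -> exists x, y = vmap f x].
Proof.
have [I [e [m [se jm fme]]]] := image_ex f.
have [_ _ _ /(_ _ _ m)[Z [p pc]] _] := aC.
have /monoP mm := jm.
exists Z, p; split=> [||y py0].
- by rewrite fme cmpA; have [-> _] := pc; rewrite cmp0l.
- exact/epiP/(cokernel_epi pc).
have [z ->] := short_exact_im (mono_exact mm pc) py0.
by have [x <-] := se z; exists x; rewrite fme vmap_cmp.
Qed.

Lemma exact_atP X Y Z (f : hom X Y) (g : hom Y Z) :
  exact_at f g <->
  g ∘ f = 0 /\ forall y, vmap g y = 0 -> exists x, y = vmap f x.
Proof.
split=> [[K [i [p [ik /epiP sp ->]]]] | [gf0 ke]].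
  split=> [|y gy0]; first by rewrite cmpA (proj1 ik) cmp0l.
  have [K' [i' [ik' _ /(_ y gy0)[z ->]]]] := kernel_ex g.
  have [_ /(_ _ i' (proj1 ik'))[h [<- _]]] := ik.
  by have [x e] := sp (vmap h z); exists x; rewrite !vmap_cmp e.
have [K [i [ik ji ki]]] := kernel_ex g.
have [_ /(_ _ f gf0)[p [ip _]]] := ik.
exists K, i, p; split=> //; apply/epiP => z.
have [|x e] := ke (vmap i z); first by rewrite -vmap_cmp (proj1 ik) vmap0l.
by exists x; apply: ji; rewrite -vmap_cmp ip e.
Qed.

Lemma fdim_inj X Y (f : hom X Y) : inj f -> (fdim X <= fdim Y)%N.
Proof.
move=> jf; pose F : 'Hom(_, _) := fmap omega f.
have /eqP kF : lker F == 0%VS by apply/lker0P.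
by rewrite /fdim -(limg_dim_eq (f := F)) ?kF ?capv0 // dimvS ?subvf.
Qed.

Lemma fdim_sur X Y (f : hom X Y) : sur f -> (fdim Y <= fdim X)%N.
Proof.
move=> sf; pose F : 'Hom(_, _) := fmap omega f.
rewrite /fdim -(limg_ker_dim F fullv).
have -> : (F @: fullv)%VS = fullv.
  apply/eqP; rewrite eqEsubv subvf; apply/subvP => y _.
  by have [x <-] := sf y; apply/memv_img/memvf.
exact: leq_addl.
Qed.

Lemma inj_dim_iso X Y (f : hom X Y) : inj f -> (fdim Y <= fdim X)%N -> is_iso f.
Proof.
move=> jf le; apply: inj_iso => // y; pose F : 'Hom(_, _) := fmap omega f.
have /eqP kF : lker F == 0%VS by apply/lker0P.
have : y \in limg F.
  have /eqP-> : limg F == fullv; last exact: memvf.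
  by rewrite eqEdim subvf limg_dim_eq ?kF ?capv0.
by case/memv_imgP=> x _ ->; exists x.
Qed.

Lemma sur_dim_iso X Y (f : hom X Y) : sur f -> (fdim X <= fdim Y)%N -> is_iso f.
Proof.
move=> sf le; apply: inj_iso => //; pose F : 'Hom(_, _) := fmap omega f.
suff /lker0P : lker F == 0%VS by [].
have iF : (F @: fullv)%VS = fullv.
  apply/eqP; rewrite eqEsubv subvf; apply/subvP => y _.
  by have [x <-] := sf y; apply/memv_img/memvf.
have := limg_ker_dim F fullv; rewrite iF capfv => e.
rewrite -dimv_eq0 -leqn0 -(leq_add2r (\dim {: (omega Y : vectType k)})) e.
by rewrite add0n.
Qed.

Lemma fdim_zero X : is_zero X <-> fdim X = 0%N.
Proof.
split=> [/is_zeroP e | d0].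
  apply/eqP; rewrite dimv_eq0 -subv0; apply/subvP => x _.
  by rewrite -[x]vmap_id e vmap0l mem0v.
apply/is_zeroP/vmap_eq0 => x; rewrite vmap_id; apply/eqP.
by rewrite -memv0; have /eqP := d0; rewrite dimv_eq0 => /eqP <-; apply: memvf.
Qed.

Lemma nonzero_vec X : ~ is_zero X -> exists x : omega X : vectType k, x != 0.
Proof.
move=> nz; apply: NNPP => no; apply/nz/is_zeroP/vmap_eq0 => x.
by rewrite vmap_id; apply/eqP/negP => /negP x0; apply: no; exists x.
Qed.

End Fiber.

(** * Direct sums, projective objects and hereditary categories *)

Section BigSum.
Variables (k : fieldType) (C : klin_cat k) (J : finType) (X : J -> C).

Definition is_bigsum Z (i : forall j, hom (X j) Z) (p : forall j, hom Z (X j)) :=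
  [/\ forall j, p j ∘ i j = idm (X j), forall j l, j != l -> p j ∘ i l = 0
    & \sum_j i j ∘ p j = idm Z].

Lemma bigsum_in Z i p (W : C) (f : forall j, hom (X j) W) j :
  @is_bigsum Z i p -> (\sum_l f l ∘ p l) ∘ i j = f j.
Proof.
case=> pi1 pi0 _; rewrite cmp_suml (bigD1 j) //= -cmpA pi1 cmp_idr big1 ?addr0 //.
by move=> l lj; rewrite -cmpA pi0 // cmp0r.
Qed.

Lemma bigsum_out Z i p (W : C) (f : forall j, hom W (X j)) j :
  @is_bigsum Z i p -> p j ∘ (\sum_l i l ∘ f l) = f j.
Proof.
case=> pi1 pi0 _; rewrite cmp_sumr (bigD1 j) //= cmpA pi1 cmp_idl big1 ?addr0 //.
by move=> l lj; rewrite cmpA pi0 1?eq_sym // cmp0l.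
Qed.

Lemma bigsum_split_in Z i p (W : C) (f : hom Z W) :
  @is_bigsum Z i p -> f = \sum_l (f ∘ i l) ∘ p l.
Proof.
case=> _ _ e; rewrite -{1}[f]cmp_idr -e cmp_sumr.
by apply: eq_bigr => l _; rewrite cmpA.
Qed.

Lemma bigsum_split_out Z i p (W : C) (f : hom W Z) :
  @is_bigsum Z i p -> f = \sum_l i l ∘ (p l ∘ f).
Proof.
case=> _ _ e; rewrite -{1}[f]cmp_idl -e cmp_suml.
by apply: eq_bigr => l _; rewrite -cmpA.
Qed.

(** The Kronecker delta of the family; the identity has to be transported along the equality of
    indices to have the right type. *)
Definition delta_mor (j l : J) : hom (X j) (X l) :=
  if j =P l is ReflectT e then
    eq_rect j (fun l => hom (X j) (X l)) (idm (X j)) l e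
  else 0.

Lemma delta_mor_id j : delta_mor j j = idm (X j).
Proof.
by rewrite /delta_mor; case: eqP => // e; rewrite (eq_axiomK e).
Qed.

Lemma delta_mor0 j l : j != l -> delta_mor j l = 0.
Proof. by rewrite /delta_mor; case: eqP. Qed.

Lemma bigsum_ex : abelian_cat C -> exists Z i p, @is_bigsum Z i p.
Proof.
case=> [[O zO] bip _ _ _].
(* The induction runs over a list of indices while the families stay indexed by all of [J]: an index
   not yet treated has zero injection and projection. *)
suff [Z [i [p [pi1 pi0 sum _]]]] : exists Z (i : forall j, hom (X j) Z) p,
  [/\ forall j, j \in enum J -> p j ∘ i j = idm (X j),
      forall j l, j != l -> p j ∘ i l = 0,
      \sum_(j <- enum J) i j ∘ p j = idm Z
    & forall j, j \notin enum J -> i j = 0 /\ p j = 0].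
  exists Z, i, p; split=> // [j|]; first by rewrite pi1 ?mem_enum.
  by rewrite -sum big_enum.
elim: (enum J) (enum_uniq J) => [_|a s IH /andP[as_ us]].
  exists O, (fun=> 0), (fun=> 0); split; [by []| move=> j l _ | | by []].
    exact: cmp0l.
  by rewrite big_nil; apply/esym; case: zO => h _; exact: h.
have [Z [i [p [pi1 pi0 sum out]]]] := IH us.
have [i_a p_a] := out a as_.
have [P [i1 [i2 [p1 [p2 [p1i1 p2i2 p2i1 p1i2 e]]]]]] := bip (X a) Z.
pose i' j := i1 ∘ delta_mor j a + i2 ∘ i j.
pose p' j := delta_mor a j ∘ p1 + p j ∘ p2.
have pi' j l : p' j ∘ i' l = delta_mor a j ∘ delta_mor l a + p j ∘ i l.
  rewrite /p' /i' cmpDl !cmpDr -!cmpA (cmpA p1 i1) (cmpA p1 i2) (cmpA p2 i1).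
  by rewrite (cmpA p2 i2) p1i1 p1i2 p2i1 p2i2 !cmp0l !cmp_idl !cmp0r addr0 add0r.
exists P, i', p'; split=> [j js|j l jl||j js].
- rewrite pi'; have [->|ja] := eqVneq j a.
    by rewrite delta_mor_id cmp_idl i_a cmp0r addr0.
  rewrite delta_mor0 1?eq_sym // cmp0l add0r pi1 //.
  by move: js; rewrite inE (negPf ja).
- rewrite pi' pi0 // addr0; have [e1|aj] := eqVneq a j.
    by rewrite (@delta_mor0 l a) ?cmp0r // e1 eq_sym.
  by rewrite delta_mor0 // cmp0l.
- rewrite big_cons {1}/i' {1}/p' i_a p_a cmp0r cmp0l !addr0 delta_mor_id.
  rewrite cmp_idl cmp_idr -e; congr (_ + _).
  rewrite -[p2 in RHS]cmp_idl -sum.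
  have -> : (\sum_(j <- s) i j ∘ p j) ∘ p2 = \sum_(j <- s) (i j ∘ p j) ∘ p2.
    exact: (big_morph (fun f => f ∘ p2) (fun f g => cmpDl f g p2) (cmp0l _ p2)).
  have -> : i2 ∘ (\sum_(j <- s) i j ∘ p j ∘ p2) =
            \sum_(j <- s) i2 ∘ (i j ∘ p j ∘ p2).
    exact: (big_morph (fun f => i2 ∘ f) (fun f g => cmpDr i2 f g) (cmp0r _ i2)).
  rewrite [LHS]big_seq [RHS]big_seq; apply: eq_bigr => j js.
  have ja : j != a by apply: contraNneq as_ => <-.
  have d1 : delta_mor j a = 0 by apply: delta_mor0.
  have d2 : delta_mor a j = 0 by apply: delta_mor0; rewrite eq_sym.
  by rewrite /i' /p' d1 d2 cmp0r cmp0l !add0r !cmpA.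
move: js; rewrite inE negb_or => /andP[ja js].
have [i0 p0] := out j js.
have d1 : delta_mor j a = 0 by apply: delta_mor0.
have d2 : delta_mor a j = 0 by apply: delta_mor0; rewrite eq_sym.
rewrite /i' /p' i0 p0 d1 d2 !cmp0l !cmp0r.
by split; rewrite addr0.
Qed.

End BigSum.

Section Projective.
Variables (k : fieldType) (C : klin_cat k) (omega : lin_functor C (vec k)).
Hypothesis (aC : abelian_cat C).
Hypothesis (omega_exact : exact_functor omega) (omega_faithful : faithful omega).
Implicit Types X Y Z : C.
Notation inj := (inj omega).
Notation sur := (sur omega).

Definition projective P :=
  forall Y Z (p : hom Y Z) (f : hom P Z), is_epi p -> exists g, p ∘ g = f.

Lemma proj_lift P X Y Z (f : hom X Y) (g : hom Y Z) (h : hom P Y) :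
  projective P -> exact_at f g -> g ∘ h = 0 -> exists h', f ∘ h' = h.
Proof.
move=> pP [K [i [p [[_ univ] ep ->]]]] /univ[r [ir _]].
by have [s ps] := pP _ _ p r ep; exists s; rewrite -cmpA ps.
Qed.

Lemma projective_retract P R (i : hom R P) (r : hom P R) :
  r ∘ i = idm R -> projective P -> projective R.
Proof.
move=> ri pP Y Z p f ep; have [g pg] := pP _ _ p (f ∘ r) ep.
by exists (g ∘ i); rewrite cmpA pg -cmpA ri cmp_idr.
Qed.

Section TwoExtensions.
Variables (P K X : C) (pi : hom P X) (i : hom K P).
Hypothesis (pP : projective P) (pi_epi : is_epi pi) (ik : is_kernel i pi).

(* The class of E in Ext^2(X, N) vanishes: its image in Ext^1(K, N) under     *)
(* dimension shifting along 0 -> K -> P -> X -> 0 splits.                     *)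
Definition null_ext N (E : yoneda_ext 0 X N) :=
  exists (p : hom P (ext_obj E 1)) (q : hom K (ext_obj E 0)),
    ext_out E ∘ p = pi /\ ext_d E 0 ∘ q = p ∘ i.

Lemma null_ext_fwd N (E E' : yoneda_ext 0 X N) :
  ext_morph E E' -> null_ext E -> null_ext E'.
Proof.
case=> phi [_ /(_ 0%N isT) sq out] [p [q [op dq]]].
exists (phi 1%N ∘ p), (phi 0%N ∘ q); split; first by rewrite cmpA out.
by rewrite cmpA -sq -!cmpA dq.
Qed.

(** As the morphism is the identity on [N] and [X], the term [ext_obj E 0] consists of the pairs (x,
    y) in [ext_obj E 1] and [ext_obj E' 0] such that x is killed by [ext_out E] and the images of x
    and y in [ext_obj E' 1] agree. A map from [K] into it is therefore given by its two
    components. *)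
Lemma null_ext_bwd N (E E' : yoneda_ext 0 X N) :
  ext_morph E E' -> null_ext E' -> null_ext E.
Proof.
case=> phi [phi_in /(_ 0%N isT) sq out] [p' [q' [op' dq']]].
have [p op] := pP pi (@ext_epi _ _ _ _ _ E).
(* Both [phi 1 ∘ p] and [p'] lift [pi]; their difference comes from [ext_obj E' 0], and adding it to
   [q'] makes the second component compatible with [p]. *)
have [|s ds] := proj_lift (h := phi 1%N ∘ p - p') pP (ext_exact_out E').
  by rewrite cmpBr cmpA out op op' subrr.
have [_ bip _ _ _] := aC.
have [B [i1 [i2 [p1 [p2 [p1i1 p2i2 p2i1 p1i2 e]]]]]] :=
  bip (ext_obj E 1) (ext_obj E' 0).
pose t := q' + s ∘ i.
have dt : ext_d E' 0 ∘ t = phi 1%N ∘ p ∘ i.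
  by rewrite /t cmpDr dq' cmpA ds cmpBl addrC subrK.
pose m := i1 ∘ ext_d E 0 + i2 ∘ phi 0%N; pose f := i1 ∘ (p ∘ i) + i2 ∘ t.
have p1m : p1 ∘ m = ext_d E 0.
  by rewrite /m cmpDr !cmpA p1i1 p1i2 cmp_idl cmp0l addr0.
have p2m : p2 ∘ m = phi 0%N.
  by rewrite /m cmpDr !cmpA p2i1 p2i2 cmp_idl cmp0l add0r.
have p1f : p1 ∘ f = p ∘ i.
  by rewrite /f cmpDr !(cmpA p1) p1i1 p1i2 cmp_idl cmp0l addr0.
have p2f : p2 ∘ f = t.
  by rewrite /f cmpDr !(cmpA p2) p2i1 p2i2 cmp_idl cmp0l add0r.
have injB (x y : omega B : vectType k) :
    vmap p1 x = vmap p1 y -> vmap p2 x = vmap p2 y -> x = y.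
  move=> e1 e2; rewrite -[x]vmap_id -[y]vmap_id -e !vmapDl !vmap_cmp.
  by rewrite e1 e2.
have /(exact_atP aC omega_exact omega_faithful)[din kd] := ext_exact_in E.
have /(exact_atP aC omega_exact omega_faithful)[din' kd'] := ext_exact_in E'.
have /(exact_atP aC omega_exact omega_faithful)[od ko] := ext_exact_out E.
have /(monoP aC omega_exact omega_faithful) jin' := @ext_mono _ _ _ _ _ E'.
have jm : inj m.
  apply: inj0 => x mx0.
  have /kd[n xn] : vmap (ext_d E 0) x = 0 by rewrite -p1m vmap_cmp mx0 vmap0r.
  have : vmap (phi 0%N) x = 0 by rewrite -p2m vmap_cmp mx0 vmap0r.
  rewrite xn -vmap_cmp phi_in -[0](vmap0r omega (ext_in E')).
  by move/jin' => ->; rewrite vmap0r.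
have [z|q mq] := lift_mono aC omega_exact omega_faithful (g := f) jm.
  have [|x pix] := ko (vmap (p ∘ i) z).
    by rewrite -vmap_cmp cmpA op (proj1 ik) vmap0l.
  have [|n xtn] := kd' (vmap (phi 0%N) x - vmap t z).
    rewrite vmapBr -!vmap_cmp -sq dt vmap_cmp -pix -vmap_cmp cmpA.
    by rewrite subrr.
  exists (x - vmap (ext_in E) n); apply: injB.
    rewrite -!vmap_cmp p1f p1m vmapBr -(vmap_cmp (ext_d E 0)) din vmap0l subr0.
    by rewrite -pix.
  rewrite -!vmap_cmp p2f p2m vmapBr -(vmap_cmp (phi 0%N)) phi_in -xtn.
  by rewrite opprB addrC subrK.
exists p, q; split=> //; by rewrite -p1m -cmpA mq.
Qed.

Lemma null_ext_eqv N (E E' : yoneda_ext 0 X N) :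
  ext_eqv E E' -> null_ext E <-> null_ext E'.
Proof.
elim=> [E1 E2 m|E1|E1 E2 _ [h h']|E1 E2 E3 _ [h1 h2] _ [h3 h4]].
- by split; [apply: null_ext_fwd | apply: null_ext_bwd].
- by [].
- by [].
by split=> [/h1/h3|/h4/h2].
Qed.

Section Make.
Variables (N Y0 Y1 : C) (a : hom N Y0) (d : hom Y0 Y1) (b : hom Y1 X).
Hypotheses (ma : is_mono a) (xa : exact_at a d) (xb : exact_at d b)
  (eb : is_epi b).
Let Y n := if n is 0 then Y0 else Y1.
Let D n : hom (Y n) (Y n.+1) := if n is 0 then d else 0.
Let xD n : (n < 0)%N -> exact_at (D n) (D n.+1). Proof. by []. Qed.
Definition make_ext : yoneda_ext 0 X N :=
  @YonedaExt k C 0 X N Y a D b ma xa xD xb eb.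
End Make.

(** To lift [f : K -> Z] through an epimorphism [e], pull [e] back along [f] to [g : T -> K] with
    kernel N, and splice into 0 -> N -> T -> P -> X -> 0. As Ext^2 vanishes, this is equivalent to
    the trivial extension, hence null; the resulting map [K -> T] is a section of [g] up to a
    correction that extends to [P]. *)
Lemma hereditary_kernel : hereditary C -> projective K.
Proof.
move=> her Y Z e f /(epiP aC omega_exact omega_faithful) se.
have [_ bip kers _ _] := aC.
have [B [i1 [i2 [p1 [p2 [p1i1 p2i2 p2i1 p1i2 eB]]]]]] := bip Y K.
have [T [t [tk jt kt]]] :=
  kernel_ex aC omega_exact omega_faithful (e ∘ p1 - f ∘ p2).
have injB (x y : omega B : vectType k) :
    vmap p1 x = vmap p1 y -> vmap p2 x = vmap p2 y -> x = y.
  by move=> e1 e2; rewrite -[x]vmap_id -[y]vmap_id -eB !vmapDl !vmap_cmp e1 e2.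
have et : e ∘ (p1 ∘ t) = f ∘ (p2 ∘ t).
  by apply/subr0_eq; rewrite !cmpA -cmpBl (proj1 tk).
have mkT (y : omega Y : vectType k) (z : omega K : vectType k) : vmap e y = vmap f z ->
    exists x, vmap (p1 ∘ t) x = y /\ vmap (p2 ∘ t) x = z.
  move=> eyz; have [|x ex] := kt (vmap i1 y + vmap i2 z).
    rewrite vmapBl !vmap_cmp !vmapDr -(vmap_cmp p1) -(vmap_cmp p1 i2) -(vmap_cmp p2 i1).
    rewrite -(vmap_cmp p2 i2) p1i1 p1i2 p2i1 p2i2 !vmap_id !vmap0l !vmap0r addr0 add0r eyz.
    by rewrite subrr.
  exists x; rewrite !(vmap_cmp _ t) -ex !vmapDr -!vmap_cmp p1i1 p1i2 p2i1 p2i2.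
  by rewrite !vmap_id !vmap0l addr0 add0r.
pose g := p2 ∘ t.
have sg : sur g.
  by move=> z; have [y /mkT[x [_ <-]]] := se (vmap f z); exists x.
have [N [n [nk jn kn]]] := kernel_ex aC omega_exact omega_faithful g.
have ji : inj i := proj1 (monoP aC omega_exact omega_faithful i) (kernel_mono ik).
have spi : sur pi := proj1 (epiP aC omega_exact omega_faithful pi) pi_epi.
have [K0 [i0 [i0k _ ki0]]] := kernel_ex aC omega_exact omega_faithful pi.
have ki (x : omega P : vectType k) : vmap pi x = 0 -> exists y, x = vmap i y.
  move=> /ki0[y ->]; have [_ /(_ _ i0 (proj1 i0k))[h [<- _]]] := ik.
  by exists (vmap h y); rewrite vmap_cmp.
have mn : is_mono n by apply: kernel_mono nk.
have xn : exact_at n (i ∘ g).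
  apply/(exact_atP aC omega_exact omega_faithful); split.
    by rewrite -cmpA (proj1 nk) cmp0r.
  by move=> y; rewrite vmap_cmp -(vmap0r omega i) => /ji /kn.
have xg : exact_at (i ∘ g) pi.
  apply/(exact_atP aC omega_exact omega_faithful); split.
    by rewrite cmpA (proj1 ik) cmp0l.
  by move=> y /ki[z ->]; have [x <-] := sg z; exists x; rewrite vmap_cmp.
have mN : is_mono (idm N) by apply: iso_mono; apply: is_iso_id.
have eX : is_epi (idm X) by apply: iso_epi; apply: is_iso_id.
have x0 : exact_at (idm N) (0 : hom N X).
  apply/(exact_atP aC omega_exact omega_faithful).
  by rewrite cmp0l; split=> // y _; exists y; rewrite vmap_id.
have x1 : exact_at (0 : hom N X) (idm X).
  apply/(exact_atP aC omega_exact omega_faithful).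
  by rewrite cmp_idl; split=> // y; rewrite vmap_id => ->; exists 0; rewrite vmap0r.
(* The second extension, with the zero map between two identities, is null by [pi] and 0. *)
have := null_ext_eqv (her 0%N X N (make_ext mn xn xg pi_epi) (make_ext mN x0 x1 eX)).
case=> _ []; first by exists pi, 0; rewrite /= cmp_idl cmp0l (proj1 ik).
move=> /= p [q [pip igq]].
(* The map [p] lifts [pi] without being the identity, so [g ∘ q] is the identity plus [s ∘ i]. As
   [s] is defined on the projective [P] it lifts through [g], and subtracting its lift turns [q]
   into a section. *)
have [s is_] : exists s, i ∘ s = p - idm P.
  have [|s [<- _]] := proj2 ik _ (p - idm P); last by exists s.
  by rewrite cmpBr pip cmp_idr subrr.
have gq : g ∘ q = idm K + s ∘ i.
  apply: (kernel_mono ik); rewrite cmpA igq cmpDr cmp_idr cmpA is_ cmpBl cmp_idl.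
  by rewrite addrC subrK.
have [s' gs'] : exists s', g ∘ s' = s.
  by apply: pP; apply/(epiP aC omega_exact omega_faithful).
exists (p1 ∘ t ∘ (q - s' ∘ i)).
rewrite cmpA et -cmpA cmpBr -/g gq cmpA gs' addrK.
by rewrite cmp_idr.
Qed.

End TwoExtensions.
End Projective.

(** * Comodules over a finite-dimensional coalgebra *)

Section Dual.
Variables (k : fieldType) (A : coalgebra k).
Implicit Types V W : vectType k.
Notation dualA := ('Hom(A, k^o)).

(** Contraction of the second tensor factor with [f]. All the contractions together separate tensors
    ([slice_ext]), which turns comodule identities into identities of modules over the dual
    algebra. *)
Definition slice V (f : dualA) : 'Hom(tensor V A, V) :=
  locked (trunit V \o tmap \1 f)%VF.

Lemma sliceE V f : slice V f = (trunit V \o tmap \1 f)%VF.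
Proof. by rewrite /slice -lock. Qed.

Lemma slice_pure V f (v : V) a : slice V f (pure v a) = (f a : k) *: v.
Proof. by rewrite sliceE vcompE tmap_pure trunit_pure vidE. Qed.

Lemma slice_lin V t : linear (fun f : dualA => slice V f t).
Proof.
by move=> a f g; rewrite !sliceE !vcompE tmap_linr !lfunE /= lfunE linearP.
Qed.

Lemma slice_nat V W (F : 'Hom(V, W)) f t :
  slice W f (tmap F \1%VF t) = F (slice V f t).
Proof.
suff /lfunP/(_ t) : (slice W f \o tmap F \1 = F \o slice V f)%VF.
  by rewrite !vcompE.
apply: tensor_ext => v a.
by rewrite !vcompE tmap_pure !slice_pure vidE linearZ.
Qed.

Definition covec (i : 'I_(\dim {: A})) : dualA := linfun (vcoord i : A -> k^o).

Lemma covecE i a : covec i a = vcoord i a.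
Proof. by apply: linfunE => b x y; rewrite /vcoord linearP. Qed.

Lemma slice_sum V t : t = \sum_i pure (slice V (covec i) t) (vbase i).
Proof.
pose F : 'Hom(tensor V A, tensor V A) :=
  linfun (fun t => \sum_i pure (slice V (covec i) t) (vbase i : A)).
have FE s : F s = \sum_i pure (slice V (covec i) s) (vbase i : A).
  apply: linfunE => b x y; rewrite scaler_sumr -big_split /=.
  by apply: eq_bigr => i _; rewrite linearP /= pure_linl.
rewrite -FE; suff -> : F = \1%VF by rewrite vidE.
apply: tensor_ext => v a; rewrite FE vidE [a in RHS]vbase_sum.
rewrite [RHS](linp_sum (@pure_linr _ _ _ v)); apply: eq_bigr => i _.
by rewrite slice_pure covecE pureZl pureZr.
Qed.

Lemma slice_ext V (s t : tensor V A) :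
  (forall f, slice V f s = slice V f t) -> s = t.
Proof.
by move=> e; rewrite [s]slice_sum [t]slice_sum; under eq_bigr do rewrite e.
Qed.

Lemma slice_assoc V f g t :
  slice V f (tmap \1%VF (slice A g) (tassoc V A A t))
  = slice V f (slice (tensor V A) g t).
Proof.
suff /lfunP/(_ t) : (slice V f \o (tmap \1 (slice A g) \o tassoc V A A)
    = slice V f \o slice (tensor V A) g)%VF by rewrite !vcompE.
apply: tensor_ext3 => v a b; rewrite !vcompE tassoc_pure tmap_pure vidE.
rewrite !slice_pure !linearZ /= !slice_pure.
exact: (esym (scalerA _ _ _)).
Qed.

Lemma slice_ext2 V (s t : tensor V (tensor A A)) :
  (forall f g, slice V f (tmap \1%VF (slice A g) s)
               = slice V f (tmap \1%VF (slice A g) t)) -> s = t.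
Proof.
have [h [_ ah]] := @vec_assoc_iso k V A A => e.
have ahE x : tassoc V A A (h x) = x.
  by have /lfunP/(_ x) := ah; rewrite vcompE vidE.
rewrite -(ahE s) -(ahE t); congr (fun_of_lfun _ _).
apply: slice_ext => g; apply: slice_ext => f.
by rewrite -!slice_assoc !ahE.
Qed.

(** The action of the dual algebra on a comodule, v being sent to the sum of the v_0 f(v_1) in
    Sweedler notation. *)
Definition hit V (rho : 'Hom(V, tensor V A)) (f : dualA) : 'End(V) :=
  (slice V f \o rho)%VF.

Lemma hitE V (rho : 'Hom(V, tensor V A)) f v : hit rho f v = slice V f (rho v).
Proof. exact: vcompE. Qed.

(** The convolution product of the dual algebra: it makes [hit] a left action ([hit_conv]), with the
    counit as unit. *)
Definition conv (f g : dualA) : dualA := (f \o hit (comul A) g)%VF.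

Lemma convE f g a : conv f g a = f (hit (comul A) g a).
Proof. exact: vcompE. Qed.

Lemma slice_comul V f g t :
  slice V f (tmap \1%VF (slice A g) (tmap \1%VF (comul A) t))
  = slice V (conv f g) t.
Proof.
suff /lfunP/(_ t) : (slice V f \o (tmap \1 (slice A g) \o tmap \1 (comul A))
    = slice V (conv f g))%VF by rewrite !vcompE.
by apply: tensor_ext => v a; rewrite !vcompE !tmap_pure !slice_pure !vidE convE hitE.
Qed.

Lemma hit_conv V (rho : 'Hom(V, tensor V A)) f g v :
  (tmap \1 (comul A) \o rho = tassoc V A A \o tmap rho \1 \o rho)%VF ->
  hit rho f (hit rho g v) = hit rho (conv f g) v.
Proof.
move=> /lfunP/(_ v); rewrite !vcompE => e.
by rewrite -slice_nat -slice_assoc -e slice_comul.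
Qed.

Lemma conv_lin g : linear (fun f => conv f g).
Proof. by move=> a f f'; apply: comp_lfun_linl. Qed.

Lemma hit_lin V (rho : 'Hom(V, tensor V A)) v : linear (fun f => hit rho f v).
Proof. by move=> a f g; rewrite !hitE slice_lin. Qed.

Lemma conv_linr f : linear (conv f).
Proof.
move=> a g h; apply/lfunP => x.
by rewrite convE hit_lin linearP add_lfunE scale_lfunE !convE.
Qed.

Lemma covec_sum (f : dualA) : f = \sum_i (f (vbase i) : k) *: covec i.
Proof.
apply/lfunP => a; rewrite [a]vbase_sum linear_sum sum_lfunE /=.
apply: eq_bigr => i _; rewrite linearZ /= lfunE /= covecE.
rewrite (linsum (V := A) (W := k^o) (f := vcoord i)) => [|b x y].
  rewrite (bigD1 i) //= vcoord_base eqxx big1 => [|j ji].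
    by rewrite addr0 /GRing.scale /= mulr1 mulrC.
  by rewrite vcoord_base eq_sym (negPf ji) scaler0.
by rewrite /vcoord linearP.
Qed.

(** The coaction whose associated action is left multiplication ([dual_slice]): the left regular
    module of the dual algebra. *)
Definition dual_coact : 'Hom(dualA, tensor dualA A) :=
  linfun (fun g : dualA => \sum_i pure (conv (covec i) g) (vbase i : A)).

Lemma dual_slice f g : slice _ f (dual_coact g) = conv f g.
Proof.
rewrite linfunE => [|a x y].
  rewrite linear_sum {2}[f]covec_sum (linp_sum (@conv_lin g)).
  by apply: eq_bigr => i _; rewrite /= slice_pure (linpZ (@conv_lin g)).
rewrite scaler_sumr -big_split /=; apply: eq_bigr => i _.
by rewrite conv_linr pure_linl.
Qed.

Lemma conv_assoc f g h : conv (conv f g) h = conv f (conv g h).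
Proof.
apply/lfunP => a; rewrite !convE hit_conv //.
exact: comulA.
Qed.

Lemma conv_counitl g : conv (counit A) g = g.
Proof.
apply/lfunP => a; rewrite convE hitE.
have /lfunP/(_ a) := counitl A; rewrite !vcompE vidE.
move: (comul A a) => t <-.
suff /lfunP/(_ t) : (counit A \o slice A g
    = g \o (tlunit A \o tmap (counit A) \1))%VF by rewrite !vcompE.
apply: tensor_ext => x y; rewrite !vcompE slice_pure tmap_pure.
by rewrite tlunit_pure vidE !linearZ; apply: mulrC.
Qed.

Lemma hit_counit V (rho : 'Hom(V, tensor V A)) :
  (trunit V \o tmap \1 (counit A) \o rho = \1)%VF ->
  forall v, hit rho (counit A) v = v.
Proof. by move=> e v; rewrite /hit sliceE e vidE. Qed.

Fact dual_coactA : (tmap \1 (comul A) \o dual_coact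
  = tassoc dualA A A \o tmap dual_coact \1 \o dual_coact)%VF.
Proof.
apply/lfunP => h; apply: slice_ext2 => f g.
rewrite !vcompE slice_comul slice_assoc slice_nat !dual_slice.
exact: conv_assoc.
Qed.

Fact dual_counit : (trunit dualA \o tmap \1 (counit A) \o dual_coact = \1)%VF.
Proof.
by apply/lfunP => h; rewrite -sliceE vcompE dual_slice conv_counitl vidE.
Qed.

Definition dual_comod : comodule A := Comodule dual_coactA dual_counit.

Section Represent.
Variables (V : comodule A) (v : V).

Let F : 'Hom(dual_comod, V) := linfun (fun g : dualA => hit (coact V) g v).
Let FE g : F g = hit (coact V) g v.
Proof. exact: (linfunE _ (@hit_lin _ _ v)). Qed.

(** The regular module is free on its unit, the counit of [A]: let g act on [v]. *)
Lemma dual_comod_ex : exists f : comod_hom dual_comod V, f (counit A) = v.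
Proof.
have FP : is_comod_hom (F : 'Hom(dual_comod, V)).
  apply/eqP/lfunP => g; rewrite !vcompE; apply: slice_ext => f.
  rewrite slice_nat dual_slice !FE -hitE.
  by rewrite hit_conv //; apply: coactA.
by exists (ComodHom FP); rewrite /= FE hit_counit //; apply: coact_counit.
Qed.

Lemma dual_comod_uniq (f : comod_hom dual_comod V) (g : dualA) :
  f (counit A) = v -> f g = hit (coact V) g v.
Proof.
move=> fv; have /eqP/lfunP/(_ (counit A)) := comod_funP f.
rewrite !vcompE fv => ->.
rewrite slice_nat dual_slice; congr (comod_fun f _).
apply/lfunP => a; rewrite convE hit_counit //; exact: counitr.
Qed.

End Represent.

Lemma comod_bij_iso (V W : comod_cat A) (f : hom V W) :
  injective (f : comod_hom V W) ->
  (forall w : comod_space W, exists v, (f : comod_hom V W) v = w) -> is_iso f.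
Proof.
case: f => f fP /= /lker0P kf sf.
pose g := (f^-1)%VF.
have gf : (g \o f)%VF = \1%VF by apply: lker0_compVf.
have fg : (f \o g)%VF = \1%VF.
  apply/lfunP => w; rewrite vcompE vidE limg_lfunVK //.
  by have [v <-] := sf w; apply/memv_img/memvf.
have gP : @is_comod_hom _ A W V g.
  apply/eqP/lfunP => w; have [v <-] := sf w.
  have /eqP/lfunP/(_ v) := fP; rewrite !vcompE => ->.
  have /lfunP/(_ v) := gf; rewrite vcompE vidE => ->.
  by rewrite -[RHS]vcompE -tmap_comp gf comp_lfun1l tmap_id vidE.
by exists (ComodHom gP); split; apply: val_inj.
Qed.

End Dual.

(** Hom(P, -) reflects isomorphisms; in this form the notion passes through equivalences and uses no
    exactness. *)
Definition generator (k : fieldType) (C : klin_cat k) (P : C) :=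
  forall (X Y : C) (i : hom Y X), (forall f : hom P Y, i ∘ f = 0 -> f = 0) ->
    (forall f : hom P X, exists g, i ∘ g = f) -> is_iso i.

Lemma dual_generator (k : fieldType) (A : coalgebra k) :
  generator (dual_comod A : comod_cat A).
Proof.
move=> X Y i i0 lift; apply: comod_bij_iso => [y1 y2 e12|v].
  apply/subr0_eq; set y := y1 - y2.
  have e0 : (i : comod_hom _ _) y = 0 by rewrite linearB /= e12 subrr.
  have [f fy] := dual_comod_ex y.
  have f0 : (f : hom (dual_comod A : comod_cat A) _) = 0.
    apply: i0; apply/val_inj/lfunP => g; rewrite vcompE zero_lfunE.
    pose h : comod_hom (dual_comod A) X := comod_comp i f.
    have hE g' : h g' = i (f g') by rewrite vcompE.
    rewrite -[LHS]hE (@dual_comod_uniq _ _ _ 0) ?hitE ?linear0 //.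
    by rewrite hE fy.
  by rewrite -fy f0 zero_lfunE.
have [f fv] := dual_comod_ex v; have [g ig] := lift f.
exists ((g : comod_hom _ _) (counit A)).
by rewrite -fv -ig vcompE.
Qed.

Lemma equivalence_generator (k : fieldType) (C D : klin_cat k)
  (Phi : lin_functor C D) (R : D) :
  is_equivalence Phi -> generator R -> exists P : C, generator P.
Proof.
case=> [Psi [[ep [ep_iso ep_nat]] [be [be_iso be_nat]]]] genR.
exists (Psi R) => X Y i i0 lift.
have [|f|j [ji ij]] := genR _ _ (fmap Phi i).
- move=> f f0.
  have e1 : i ∘ (ep Y ∘ fmap Psi f) = 0.
    rewrite cmpA -[i]/(fmap (id_functor C) i) -ep_nat -cmpA -fmap_cmp f0 fmap0.
    exact: cmp0r.
  have e2 : fmap Psi f = 0.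
    by apply: (iso_mono (ep_iso Y)); rewrite cmp0r; apply: i0.
  apply: (iso_epi (be_iso R)); rewrite cmp0l.
  rewrite -[f]/(fmap (id_functor _) f) -be_nat /= e2 fmap0.
  exact: cmp0r.
- have [g ig] := lift (ep X ∘ fmap Psi f).
  have [ep' [ep'ep epep']] := ep_iso Y.
  have [be' [_ bebe']] := be_iso R.
  have e1 : fmap Psi f = fmap Psi (fmap Phi i) ∘ (ep' ∘ g).
    apply: (iso_mono (ep_iso X)).
    rewrite cmpA [X in _ = X ∘ _]ep_nat /= -cmpA (cmpA (ep Y)) epep'.
    by rewrite cmp_idl ig.
  exists (be (Phi Y) ∘ fmap Phi (ep' ∘ g) ∘ be').
  have := be_nat _ _ f; rewrite /= e1 fmap_cmp => e3.
  rewrite -[RHS]cmp_idr -bebe' [RHS]cmpA -e3 [in RHS]cmpA be_nat /=.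
  by rewrite !cmpA.
have [epX' [hX1 hX2]] := ep_iso X; have [epY' [hY1 hY2]] := ep_iso Y.
have nat_i := ep_nat _ _ i; rewrite /= in nat_i.
exists (ep Y ∘ fmap Psi j ∘ epX'); split.
  have e : epX' ∘ i = fmap Psi (fmap Phi i) ∘ epY'.
    by rewrite -[i in LHS]cmp_idr -hY2 (cmpA i) -nat_i !cmpA hX1 cmp_idl.
  rewrite -!cmpA e (cmpA (fmap Psi j)) -fmap_cmp ji fmap_id cmp_idl.
  exact: hY2.
rewrite !cmpA -nat_i -(cmpA (ep X)) -fmap_cmp ij fmap_id cmp_idr.
exact: hX2.
Qed.

Lemma finite_generator (k : fieldType) (C : klin_cat k) :
  finite_cat C -> exists P : C, generator P.
Proof.
case=> A [Phi eqPhi]; apply: equivalence_generator eqPhi _.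
exact: dual_generator.
Qed.

(** * Representability of the fiber functor *)

(** A subspace of maximal dimension contained in [S] cannot grow by a line through a vector of [S],
    so it contains all of them. *)
Lemma vspace_pred (k : fieldType) (V : vectType k) (S : V -> Prop) :
  S 0 -> (forall a u v, S u -> S v -> S (a *: u + v)) ->
  exists U : {vspace V}, forall x, x \in U <-> S x.
Proof.
move=> S0 SD.
have [|U SU maxU] := @min_measure {vspace V} (fun U => forall x, x \in U -> S x)
  (fun U => \dim {:V} - \dim U)%N.
  by exists 0%VS => x; rewrite memv0 => /eqP->.
exists U => x; split=> [|Sx]; first exact: SU.
have /maxU : forall y, y \in (U + <[x]>)%VS -> S y.
  move=> y /memv_addP[u uU [_ /vlineP[a ->] ->]].
  by rewrite addrC; apply: SD => //; apply: SU.
rewrite leq_sub2lE => [le|]; last by rewrite dimvS ?subvf.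
have /eqP-> : U == (U + <[x]>)%VS by rewrite eqEdim addvSl.
by apply: (subvP (addvSr U _)); apply: memv_line.
Qed.

Section HomSpace.
Variables (k : fieldType) (C : klin_cat k) (omega : lin_functor C (vec k)).
Hypothesis (omega_faithful : faithful omega).

(** Faithfulness embeds [hom X Y] as a subspace of the linear maps between fibers. The coordinate
    system is data, hence the existential over a sigma type. *)
Lemma hom_vect_ex (X Y : C) : exists p : {n & Vector.axiom n (hom X Y)}, True.
Proof.
pose S (phi : 'Hom(omega X, omega Y)) := exists f : hom X Y, fmap omega f = phi.
have [||U US] := @vspace_pred _ _ S.
- by exists 0; rewrite fmap0.
- by move=> a _ _ [f <-] [g <-]; exists (a *: f + g); rewrite fmap_lin.
pose v2r (f : hom X Y) : 'rV[k]_(\dim U) :=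
  \row_i coord (vbasis U) i (fmap omega f : 'Hom(_, _)).
have Uf f : (fmap omega f : 'Hom(_, _)) \in U by apply/US; exists f.
have v2rK f : \sum_i v2r f 0 i *: (vbasis U)`_i = fmap omega f.
  by rewrite [RHS](coord_vbasis (Uf f)); apply: eq_bigr => i _; rewrite mxE.
have r2v_ex (r : 'rV[k]_(\dim U)) :
    exists f : hom X Y, fmap omega f = \sum_i r 0 i *: (vbasis U)`_i.
  apply/US/memv_suml => i _; apply/memvZ/vbasis_mem.
  by rewrite mem_nth // size_tuple.
pose r2v r := proj1_sig (constructive_indefinite_description _ (r2v_ex r)).
have r2vE r : fmap omega (r2v r) = \sum_i r 0 i *: (vbasis U)`_i.
  by rewrite /r2v; case: constructive_indefinite_description.
suff ax : Vector.axiom (\dim U) (hom X Y) 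
  by exists (existT (fun n => Vector.axiom n (hom X Y)) _ ax).
exists v2r.
  move=> a f g; apply/rowP => i; rewrite !mxE fmap_lin.
  by rewrite linearP.
exists r2v => [f|r]; first by apply: omega_faithful; rewrite r2vE v2rK.
apply/rowP => i; rewrite mxE r2vE coord_sum_free //.
exact: (basis_free (vbasisP _)).
Qed.

Definition hom_dim_axiom X Y := proj1_sig
  (constructive_indefinite_description _ (@hom_vect_ex X Y)).

(* A vectType on hom X Y itself rather than on its image under omega, so that *)
(* vectors are morphisms.                                                     *)
Definition homV (X Y : C) : vectType k :=
  HB.pack (GRing.Lmodule.sort (hom X Y))
    (Lmodule_hasFinDim.Build k (hom X Y) (projT2 (hom_dim_axiom X Y))).

Definition precomp (X Y Z : C) (f : hom X Y) : 'Hom(homV Y Z, homV X Z) :=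
  linfun (fun g : homV Y Z => (g : hom Y Z) ∘ f : homV X Z).
Definition postcomp (X Y Z : C) (g : hom Y Z) : 'Hom(homV X Y, homV X Z) :=
  linfun (fun f : homV X Y => g ∘ (f : hom X Y) : homV X Z).

Lemma precompE (X Y Z : C) (f : hom X Y) (g : hom Y Z) :
  precomp Z f g = g ∘ f.
Proof. exact: (@linfunE _ (homV Y Z) (homV X Z) _ g (cmp_linl f)). Qed.
Lemma postcompE (X Y Z : C) (g : hom Y Z) (f : hom X Y) :
  postcomp X g f = g ∘ f.
Proof. exact: (@linfunE _ (homV X Y) (homV X Z) _ f (cmp_linr g)). Qed.

End HomSpace.

Section Represent.
Variables (k : fieldType) (C : klin_cat k) (omega : lin_functor C (vec k)).
Hypothesis (aC : abelian_cat C).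
Hypothesis (omega_exact : exact_functor omega) (omega_faithful : faithful omega).

Definition represents (P : C) (u : omega P : vectType k) :=
  forall X (x : omega X : vectType k), exists! f : hom P X, vmap f u = x.

Lemma bigsum_vec (J : finType) (X : J -> C) Z i p (z : omega Z : vectType k) :
  @is_bigsum _ _ J X Z i p -> z = \sum_j vmap (i j) (vmap (p j) z).
Proof.
case=> _ _ e; rewrite -{1}[z]vmap_id -e vmap_suml.
by apply: eq_bigr => j _; rewrite vmap_cmp.
Qed.

(* P is the least subobject of P0^n whose image under omega contains the      *)
(* vector with components a basis of omega(P0).                               *)
Lemma represents_ex (P0 : C) : generator P0 -> exists P u, @represents P u.
Proof.
move=> genP0; pose V0 : vectType k := omega P0.
have [Q [i [p bQ]]] := bigsum_ex (fun _ : 'I_(\dim {: V0}) => P0) aC.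
pose q : omega Q : vectType k := \sum_j vmap (i j) (vbase j : V0).
have pq j : vmap (p j) q = vbase j.
  have [pi1 pi0 _] := bQ; rewrite vmap_sumr (bigD1 j) //= -vmap_cmp pi1 vmap_id.
  by rewrite big1 ?addr0 // => l lj; rewrite -vmap_cmp pi0 1?eq_sym // vmap0l.
(* The components of [q] form a basis of omega(P0), so a linear combination of the projections
   followed by any map from [P0] reaches every vector in the image of that map. *)
pose S X (x : omega X : vectType k) := exists f : hom Q X, vmap f q = x.
have S0 X : S X 0 by exists 0; rewrite vmap0l.
have SD X a x y : S X x -> S X y -> S X (a *: x + y).
  by move=> [f <-] [g <-]; exists (a *: f + g); rewrite vmapDl vmapZl.
have Ssum X (I : finType) (x : I -> _) : (forall j, S X (x j)) -> S X (\sum_j x j).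
  move=> Sx; apply: big_ind => // y z Sy Sz.
  by rewrite -[y]scale1r; apply: SD.
have SP0 X (h : hom P0 X) y : S X (vmap h y).
  exists (\sum_j vcoord j y *: (h ∘ p j)); rewrite vmap_suml.
  rewrite [y in RHS](vbase_sum (y : V0)) vmap_sumr; apply: eq_bigr => j _.
  by rewrite vmapZl vmap_cmp pq vmapZr.
have SQ X (f : hom Q X) z : S X (vmap f z).
  rewrite (bigsum_vec z bQ) vmap_sumr; apply: Ssum => j.
  by rewrite -vmap_cmp; apply: SP0.
(* The reachable vectors form a subspace [U], spanned by the values at [q] of finitely many maps
   from [Q]. The image of the sum of these maps contains the image of every map from [P0], so by the
   generator property it is all of [X]. *)
have Sall X x : S X x.
  have [U US] := vspace_pred (S0 X) (SD X).
  have [f fE] : exists f : 'I_(\dim U) -> hom Q X,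
      forall l, vmap (f l) q = (vbasis U)`_l.
    have ex (l : 'I_(\dim U)) : exists g : hom Q X, vmap g q = (vbasis U)`_l.
      by apply/US/vbasis_mem; rewrite mem_nth // size_tuple.
    by have [f fE] := fin_all_exists ex; exists f.
  have [Z [i' [p' bZ]]] := bigsum_ex (fun _ : 'I_(\dim U) => Q) aC.
  pose F := \sum_l f l ∘ p' l.
  have Fi l : F ∘ i' l = f l by apply: bigsum_in bZ.
  have [I [e [m [se jm Fme]]]] := image_ex aC omega_exact omega_faithful F.
  have mm : is_mono m by apply/(monoP aC omega_exact omega_faithful).
  have /(iso_sur aC omega_exact omega_faithful)/(_ x)[y <-] : is_iso m.
    apply: genP0 => [g mg0|h]; first by apply: mm; rewrite mg0 cmp0r.
    apply: (lift_mono aC omega_exact omega_faithful jm) => z.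
    have /US zU := SP0 _ h z; rewrite (coord_vbasis zU).
    exists (vmap e (\sum_l coord (vbasis U) l (vmap h z) *: vmap (i' l) q)).
    rewrite -vmap_cmp -Fme vmap_sumr; apply: eq_bigr => l _.
    by rewrite vmapZr -vmap_cmp Fi fE.
  have [z <-] := se y; rewrite -vmap_cmp -Fme (bigsum_vec z bZ) vmap_sumr.
  by apply: Ssum => l; rewrite -vmap_cmp Fi; apply: SQ.
pose T := {P : C & {i : hom P Q & omega P : vectType k}}.
have [|[P [m u]] /= [jm mu] minP] := @min_measure T
  (fun t => inj omega (projT1 (projT2 t)) /\
            vmap (projT1 (projT2 t)) (projT2 (projT2 t)) = q)
  (fun t => fdim omega (projT1 t)).
  exists (existT _ Q (existT _ (idm Q) q)) => /=; split; last exact: vmap_id.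
  by move=> x y; rewrite !vmap_id.
exists P, u => X x; have [f fq] := Sall X x.
exists (f ∘ m); split=> [|g gu]; first by rewrite vmap_cmp mu.
(* Two maps agreeing at [u] have an equalizer whose fiber contains a preimage of [u]; by minimality
   of [P] the equalizer is [P]. *)
have [K [i1 [ik ji ki]]] :=
  kernel_ex aC omega_exact omega_faithful (f ∘ m - g).
have [|y uy] := ki u; first by rewrite vmapBl vmap_cmp mu fq gu subrr.
have le : (fdim omega P <= fdim omega K)%N.
  apply: (minP (existT _ K (existT _ (m ∘ i1) y))).
  split; last by rewrite /= vmap_cmp -uy.
  by move=> a b; rewrite !vmap_cmp => /jm/ji.
have /(iso_epi) ei := inj_dim_iso aC omega_exact omega_faithful ji le.
by apply/subr0_eq/ei; rewrite (proj1 ik) cmp0l.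
Qed.

Lemma represents_uniq P u X (f g : hom P X) :
  represents u -> vmap f u = vmap g u -> f = g.
Proof. by move=> /(_ X (vmap g u))[h [_ hu]] e; rewrite -(hu f) // -(hu g). Qed.

Lemma represents_projective P u : @represents P u -> projective P.
Proof.
move=> Pu Y Z p f /(epiP aC omega_exact omega_faithful) sp.
have [y py] := sp (vmap f u); have [g [gu _]] := Pu _ y.
by exists g; apply: (represents_uniq Pu); rewrite vmap_cmp gu.
Qed.

End Represent.

(** * Simple objects and projective covers *)

Lemma sum_option (V : zmodType) (J : finType) (F : option J -> V) :
  \sum_o F o = F None + \sum_j F (Some j).
Proof.
rewrite (bigD1 None) //=; congr (_ + _).
rewrite (reindex_omap Some id) => [|[j|]] //=.
by apply: eq_bigl => j; rewrite eqxx.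
Qed.

Lemma independent_card (k : fieldType) (V : vectType k) (J : finType) (w : J -> V) :
  (forall c : J -> k, \sum_j c j *: w j = 0 -> forall j, c j = 0) ->
  (#|J| <= \dim {:V})%N.
Proof.
move=> ind; pose X := [tuple w (enum_val i) | i < #|J|].
suff : free X by move/eqP; rewrite size_tuple => <-; apply/dimvS/subvf.
apply/freeP => c c0 i; rewrite -(enum_valK i).
apply: (ind (fun j => c (enum_rank j))).
rewrite -[RHS]c0 (eq_bigl (mem J)) // big_enum_val; apply: eq_bigr => l _.
by rewrite enum_valK -tnth_nth tnth_mktuple.
Qed.

Lemma one_dim (k : fieldType) (V : vectType k) (x y : V) :
  \dim {:V} = 1%N -> x != 0 -> exists a, y = a *: x.
Proof.
move=> d1 x0; have : y \in <[x]>%VS.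
  suff /eqP-> : <[x]>%VS == fullv by apply: memvf.
  by rewrite eqEdim subvf d1 dim_vline x0.
by case/vlineP=> a ->; exists a.
Qed.

Section Simple.
Variables (k : fieldType) (C : klin_cat k) (omega : lin_functor C (vec k)).
Hypothesis (aC : abelian_cat C).
Hypothesis (omega_exact : exact_functor omega) (omega_faithful : faithful omega).
Implicit Types X Y Z S T W R P : C.
Notation inj := (inj omega).
Notation sur := (sur omega).
Notation fdim := (fdim omega).

Lemma simple_sur X S (f : hom X S) : is_simple S -> f <> 0 -> sur f.
Proof.
move=> [_ sS] f0; have [I [e [m [se jm fme]]]] := image_ex aC omega_exact omega_faithful f.
have [|/is_zeroP I0|im y] := sS _ m; first exact/(monoP aC omega_exact omega_faithful).
  by case: f0; rewrite fme -[m]cmp_idr I0 cmp0r cmp0l.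
have [z <-] := iso_sur aC omega_exact omega_faithful im y.
by have [x <-] := se z; exists x; rewrite fme vmap_cmp.
Qed.

Lemma simple_inj X S (f : hom S X) : is_simple S -> f <> 0 -> inj f.
Proof.
move=> [_ sS] f0; have [K [i [ik ji ki]]] := kernel_ex aC omega_exact omega_faithful f.
have [|/is_zeroP K0|/iso_epi ei] := sS _ i; first exact: kernel_mono ik.
  by apply: inj0 => x /ki[y ->]; rewrite -[y]vmap_id K0 vmap0l vmap0r.
by case: f0; apply: ei; rewrite (proj1 ik) cmp0l.
Qed.

Lemma simple_iso S T (f : hom S T) :
  is_simple S -> is_simple T -> f <> 0 -> is_iso f.
Proof.
move=> sS sT f0; apply: (inj_iso aC omega_exact omega_faithful).
  exact: simple_inj.
exact: simple_sur.
Qed.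

Lemma sur_neq0 X S (f : hom X S) : is_simple S -> sur f -> f <> 0.
Proof.
move=> [nS _] sf f0; have [x /eqP x0] := nonzero_vec omega_faithful nS.
by case: x0; have [y <-] := sf x; rewrite f0 vmap0l.
Qed.

(** Take a nonzero quotient of least dimension: dividing it by a subobject gives zero or changes
    nothing. *)
Lemma simple_quotient X : ~ is_zero X ->
  exists S (p : hom X S), is_simple S /\ sur p.
Proof.
move=> nX; pose T := {S : C & hom X S}.
have [|[S p] /= [nS sp] minS] := @min_measure T
  (fun t => ~ is_zero (projT1 t) /\ sur (projT2 t)) (fun t => fdim (projT1 t)).
  exists (existT _ X (idm X)); split=> //= y; exists y; exact: vmap_id.
exists S, p; split=> //; split=> // Y i mi.
have ji : inj i by apply/(monoP aC omega_exact omega_faithful).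
have [Z [q [qi0 sq kq]]] := cokernel_ex aC omega_exact omega_faithful i.
have [Z0 | nZ] := classic (is_zero Z); [right | left].
  apply: (inj_iso aC omega_exact omega_faithful) => // y.
  have [|x ->] := kq y; last by exists x.
  by move/is_zeroP: Z0 => Z0; rewrite -[LHS]vmap_id Z0 vmap0l.
have le : (fdim S <= fdim Z)%N.
  apply: (minS (existT _ Z (q ∘ p))); split=> //= z.
  have [y <-] := sq z; have [x <-] := sp y.
  by exists x; rewrite vmap_cmp.
have iq := sur_dim_iso aC omega_exact omega_faithful sq le.
apply/is_zeroP/mi; apply: (iso_mono iq).
by rewrite cmp_idr qi0 !cmp0r.
Qed.

(** A form of Nakayama's lemma: a nonzero cokernel of [h] would have a simple quotient. *)
Lemma sur_simple X Z (h : hom X Z) :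
  (forall S (g : hom Z S), is_simple S -> g ∘ h = 0 -> g = 0) -> sur h.
Proof.
move=> hs; have [W [p [ph0 sp kp]]] := cokernel_ex aC omega_exact omega_faithful h.
have [W0 | nW] := classic (is_zero W).
  move=> y; have [|x ->] := kp y; last by exists x.
  by move/is_zeroP: W0 => W0; rewrite -[LHS]vmap_id W0 vmap0l.
have [S [q [sS sq]]] := simple_quotient nW.
case: (sur_neq0 (f := q ∘ p) sS).
  move=> z; have [y <-] := sq z; have [x <-] := sp y.
  by exists x; rewrite vmap_cmp.
by apply: hs => //; rewrite -cmpA ph0 cmp0r.
Qed.

Section Dim.
Variables (P : C) (u : omega P : vectType k).
Hypothesis Pu : represents u.

Lemma represent_simple S : is_simple S -> exists f : hom P S, f <> 0.
Proof.
move=> [nS _]; have [x /eqP x0] := nonzero_vec omega_faithful nS.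
have [f [fu _]] := Pu x; exists f => f0.
by case: x0; rewrite -fu f0 vmap0l.
Qed.

Lemma vec_iso_dim (V W : vec k) (f : hom V W) :
  is_iso f -> \dim {: (V : vectType k)} = \dim {: (W : vectType k)}.
Proof.
case=> g [gf fg].
have fK v : fun_of_lfun g (fun_of_lfun f v) = v.
  by have /lfunP/(_ v) := gf; rewrite vcompE vidE.
have gK w : fun_of_lfun f (fun_of_lfun g w) = w.
  by have /lfunP/(_ w) := fg; rewrite vcompE vidE.
have /eqP kf : lker f == 0%VS by apply/lker0P/(can_inj fK).
have <- : limg f = fullv.
  apply/eqP; rewrite eqEsubv subvf; apply/subvP => w _.
  by rewrite -[w]gK; apply/memv_img/memvf.
by rewrite limg_dim_eq // kf capv0.
Qed.

(** Simple objects are quotients of [P], so their dimensions are bounded by that of [P], whereas the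
    tensor powers of [S] are simple of dimension a power of [fdim S]. *)
Lemma simple_dim1 (M : monoidal C) (J : strong_monoidal M (vec_monoidal k) omega) S :
  pointed M -> is_simple S -> fdim S = 1%N.
Proof.
move=> [_ ptd] sS.
have dimT X Y : fdim (tob M X Y) = (fdim X * fdim Y)%N.
  by rewrite /fdim -(vec_iso_dim (mon2_iso J X Y)) [LHS]dimvf [LHS]dim_matrix.
pose T n := iter n (tob M S) S.
have sT n : is_simple (T n) by elim: n => //= n IH; apply: ptd.
have dT n : fdim (T n) = (fdim S ^ n.+1)%N.
  by elim: n => [|n IH]; rewrite ?expn1 // [T _]/= dimT IH -expnS.
have le n : (fdim S ^ n.+1 <= fdim P)%N.
  have [f f0] := represent_simple (sT n).
  by rewrite -dT; apply: (fdim_sur (f := f)); apply: simple_sur.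
case: (ltngtP (fdim S) 1) => [d0|d2|//].
  case: (sS) => -[]; apply/(fdim_zero omega_faithful).
  by move: d0; rewrite ltnS leqn0 => /eqP.
(* The power with exponent [fdim P] already exceeds [fdim P] when the base is at least 2. *)
have := leq_trans (ltn_expl (fdim P) d2) (leq_trans _ (le (fdim P))).
by rewrite leq_exp2l // leqnSn ltnn => /(_ isT).
Qed.

End Dim.

Section Top.
Hypothesis dim1 : forall S, is_simple S -> fdim S = 1%N.

Lemma simple_scalar X S (p g : hom X S) :
  is_simple S -> fdim X = 1%N -> p <> 0 -> exists a, g = a *: p.
Proof.
move=> sS X1 p0.
have [x /eqP x0] : exists x : omega X : vectType k, x != 0.
  apply: (nonzero_vec omega_faithful) => /(fdim_zero omega_faithful).
  by rewrite X1.
have px0 : vmap p x != 0.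
  apply/eqP => e; apply: p0; apply: (vmap_eq0 omega_faithful) => y.
  by have [|a ->] := one_dim y X1 (x := x); [apply/eqP | rewrite vmapZr e scaler0].
have [a ga] := one_dim (vmap g x) (dim1 sS) px0.
exists a; apply: (vmap_inj omega_faithful) => y.
have [|b ->] := one_dim y X1 (x := x); first exact/eqP.
by rewrite vmapZl !vmapZr ga !scalerA mulrC.
Qed.

Section Family.
Variables (Y : C) (J : finType) (T : J -> C) (f : forall j, hom Y (T j)).

(** For simple [T j], [top_free] says that Y maps onto the direct sum of the [T j], and [top_gen]
    that every map from Y to a simple object factors through that sum. Together they present the
    largest semisimple quotient of Y without constructing it. *)
Definition top_free := forall S (c : forall j, hom (T j) S),
  is_simple S -> \sum_j c j ∘ f j = 0 -> forall j, c j = 0.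
Definition top_gen := forall S (g : hom Y S),
  is_simple S -> exists c : forall j, hom (T j) S, g = \sum_j c j ∘ f j.

Lemma top_free_card : (forall j, is_simple (T j)) -> top_free -> (#|J| <= fdim Y)%N.
Proof.
move=> sT fr; have [Z [i [p bZ]]] := bigsum_ex T aC.
pose h := \sum_j i j ∘ f j.
have sh : sur h.
  apply: sur_simple => S g sS gh0; rewrite (bigsum_split_in g bZ).
  rewrite big1 // => j _; rewrite (fr S (fun l => g ∘ i l)) ?cmp0l //.
  by rewrite -[RHS]gh0 cmp_sumr; apply: eq_bigr => l _; rewrite cmpA.
apply: leq_trans (fdim_sur sh).
have [t t0] : exists t : forall j, omega (T j) : vectType k, forall j, t j != 0.
  apply: (@fin_all_exists J (fun j => omega (T j) : vectType k)
    (fun j x => x != 0)) => j.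
  by apply: (nonzero_vec omega_faithful); case: (sT j).
apply: (independent_card (w := fun j => vmap (i j) (t j))) => c c0 j.
have [pi1 pi0 _] := bZ.
have : vmap (p j) (\sum_j c j *: vmap (i j) (t j)) = c j *: t j.
  rewrite vmap_sumr (bigD1 j) //= vmapZr -vmap_cmp pi1 vmap_id big1 ?addr0 // => l lj.
  by rewrite vmapZr -vmap_cmp pi0 1?eq_sym // vmap0l scaler0.
rewrite c0 vmap0r => /esym/eqP; rewrite scaler_eq0 (negPf (t0 j)) orbF.
by move/eqP.
Qed.

End Family.

(** A free family that does not generate can be enlarged by one map, but [top_free_card] bounds its
    size by [fdim Y]. *)
Lemma top_ex Y : exists (J : finType) (T : J -> C) (f : forall j, hom Y (T j)),
  [/\ forall j, is_simple (T j), top_free f & top_gen f].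
Proof.
have [//|no] := classic (exists (J : finType) (T : J -> C) (f : forall j, hom Y (T j)),
  [/\ forall j, is_simple (T j), top_free f & top_gen f]).
have [J [T [f [sT fr cJ]]]] : exists (J : finType) (T : J -> C) (f : forall j, hom Y (T j)),
  [/\ forall j, is_simple (T j), top_free f & #|J| = (fdim Y).+1].
  elim: (fdim Y).+1 => [|n [J [T [f [sT fr cJ]]]]].
    exists void, (fun j : void => match j with end),
      (fun j : void => match j with end).
    by split=> [[]|S c _ _ []|]; rewrite ?card_void.
  have [gen|ngen] := classic (top_gen f); first by case: no; exists J, T, f.
  have [S [g [sS ng]]] : exists S (g : hom Y S), is_simple S /\
      ~ exists c : forall j, hom (T j) S, g = \sum_j c j ∘ f j.
    apply: NNPP => h; apply: ngen => S g sS; apply: NNPP => ng.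
    by apply: h; exists S, g.
  pose T' o := if o is Some j then T j else S.
  pose f' o : hom Y (T' o) := if o is Some j then f j else g.
  exists (option J), T', f'; split; last by rewrite card_option cJ.
    by case.
  move=> S' c sS'; rewrite sum_option /= => e.
  (* Otherwise, by Schur's lemma, [c None] is invertible and [g] is a combination of the [f j]. *)
  have cN : c None = 0.
    apply: NNPP => /(simple_iso sS sS')[r [rc _]]; apply: ng.
    exists (fun j => - (r ∘ c (Some j))).
    have := congr1 (fun x => r ∘ x) e.
    rewrite /= cmpDr cmpA rc cmp_idl cmp0r => /eqP; rewrite addr_eq0 => /eqP->.
    rewrite cmp_sumr -sumrN; apply: eq_bigr => j _.
    by rewrite cmpA (linpN (cmp_linl _)).
  case=> [j|//]; apply: (fr _ (fun j => c (Some j))) => //.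
  by move: e; rewrite cN cmp0l add0r.
by have := top_free_card sT fr; rewrite cJ ltnn.
Qed.

(* For S simple, pi ∘ i <> 0 says that i is onto modulo ker pi, so the last   *)
(* condition says that ker pi is superfluous.                                 *)
Definition is_cover R S (pi : hom R S) :=
  [/\ projective R, sur pi
    & forall Y (i : hom Y R), inj i -> pi ∘ i <> 0 -> is_iso i].

Lemma cover_ex P S (p : hom P S) :
  projective P -> is_simple S -> p <> 0 -> exists R (pi : hom R S), is_cover pi.
Proof.
move=> pP sS p0; pose T := {M : C & hom M P}.
have [|[M m] /= [jm pm0] minM] := @min_measure T
  (fun t => inj (projT2 t) /\ p ∘ projT2 t <> 0) (fun t => fdim (projT1 t)).
  exists (existT _ P (idm P)) => /=; split; last by rewrite cmp_idr.
  by move=> x y; rewrite !vmap_id.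
have min Y (i : hom Y M) : inj i -> p ∘ m ∘ i <> 0 -> is_iso i.
  move=> ji pmi0; apply: (inj_dim_iso aC omega_exact omega_faithful ji).
  apply: (minM (existT _ Y (m ∘ i))); split=> /=; last by rewrite cmpA.
  by move=> x y; rewrite !vmap_cmp => /jm/ji.
have spm : sur (p ∘ m) by apply: simple_sur.
have [|phi pphi] := pP _ _ (p ∘ m) p.
  exact/(epiP aC omega_exact omega_faithful).
exists M, (p ∘ m); split=> //.
(* The image of [phi ∘ m] is not killed by [p ∘ m], so it is all of [M]; then [phi ∘ m] is
   invertible by dimension and [m] splits. *)
have [I [e [m' [se jm' eE]]]] := image_ex aC omega_exact omega_faithful (phi ∘ m).
have im' : is_iso m'.
  apply: min => // e0; apply: pm0; rewrite -pphi -cmpA eE cmpA e0.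
  exact: cmp0l.
have [r [rphi _]] : is_iso (phi ∘ m).
  apply: (sur_dim_iso aC omega_exact omega_faithful) => // x.
  have [y <-] := iso_sur aC omega_exact omega_faithful im' x.
  by have [z <-] := se y; exists z; rewrite eE vmap_cmp.
by apply: (projective_retract (i := m) (r := r ∘ phi)) pP; rewrite -cmpA.
Qed.

(** If [g] is nonzero its kernel is proper, hence killed by [pi]; so [pi] factors through [g] by a
    nonzero map of simple objects, which is invertible. *)
Lemma cover_hom R S (pi : hom R S) T (g : hom R T) :
  is_simple S -> is_simple T -> is_cover pi -> exists c, g = c ∘ pi.
Proof.
move=> sS sT [_ spi min]; have [->|g0] := classic (g = 0).
  by exists 0; rewrite cmp0l.
have [K [i [ik ji ki]]] := kernel_ex aC omega_exact omega_faithful g.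
have pii0 : pi ∘ i = 0.
  apply: NNPP => /(min _ _ ji)/iso_epi ei; apply: g0; apply: ei.
  by rewrite (proj1 ik) cmp0l.
have [||h hg] := lift_epi aC omega_exact omega_faithful (p := g) (g := pi).
- exact: (simple_sur sT g0).
- by move=> x /ki[y ->]; rewrite -vmap_cmp pii0 vmap0l.
have [|r [rh _]] := simple_iso sT sS (f := h).
  by move=> h0; apply: (sur_neq0 sS spi); rewrite -hg h0 cmp0l.
by exists r; rewrite -hg cmpA rh cmp_idl.
Qed.

Lemma projective_bigsum (J : finType) (R : J -> C) Z i p :
  @is_bigsum _ _ J R Z i p -> (forall j, projective (R j)) -> projective Z.
Proof.
move=> bZ pR A B q f eq.
have ex j : exists g : hom (R j) A, q ∘ g = f ∘ i j by apply: pR.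
have [g qg] := fin_all_exists ex.
exists (\sum_j g j ∘ p j); rewrite cmp_sumr [RHS](bigsum_split_in _ bZ).
by apply: eq_bigr => j _; rewrite cmpA qg.
Qed.

(** A projective object is determined by its top: lifting the [f j] to the covers gives a map from
    [Y] to the sum of the [R j] that is an isomorphism. *)
Lemma projective_decomposition Y (J : finType) (T R : J -> C)
    (f : forall j, hom Y (T j)) (pi : forall j, hom (R j) (T j)) :
  projective Y -> (forall j, is_simple (T j)) -> top_free f -> top_gen f ->
  (forall j, is_cover (pi j)) ->
  exists (psi : forall j, hom (R j) Y) (phi : forall j, hom Y (R j)),
    is_bigsum psi phi /\ forall j, pi j ∘ phi j = f j.
Proof.
move=> pY sT fr gen cov.
have ex j : exists g : hom Y (R j), pi j ∘ g = f j.
  apply: pY; apply/(epiP aC omega_exact omega_faithful).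
  by case: (cov j).
have [phi pphi] := fin_all_exists ex.
have [Z [i [p bZ]]] := bigsum_ex R aC.
pose Phi := \sum_j i j ∘ phi j.
have pPhi j : p j ∘ Phi = phi j by apply: bigsum_out bZ.
have pZ : projective Z.
  by apply: (projective_bigsum bZ) => j; case: (cov j).
(* A map from the sum to a simple object factors through the [pi j]; if it kills [Phi], freeness of
   the [f j] makes it vanish. *)
have sPhi : sur Phi.
  apply: sur_simple => S g sS gPhi0; rewrite (bigsum_split_in g bZ).
  have exc j : exists c, g ∘ i j = c ∘ pi j by apply: cover_hom.
  have [c gi] := fin_all_exists exc.
  rewrite big1 // => j _; rewrite gi (fr S c) ?cmp0l //.
  rewrite -[RHS]gPhi0 cmp_sumr; apply: eq_bigr => l _.
  by rewrite cmpA gi -cmpA pphi.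
have /(pZ _ _ _ (idm Z))[s Phis] : is_epi Phi.
  exact/(epiP aC omega_exact omega_faithful).
have [N [n [nk jn kn]]] := kernel_ex aC omega_exact omega_faithful Phi.
(* The kernel is a direct summand of [Y], so a simple quotient of it extends to [Y]. Such an
   extension is a combination of the [pi j ∘ phi j], which vanish on the kernel. *)
have N0 : is_zero N.
  apply: NNPP => /simple_quotient[T' [t [sT' st]]].
  have [|rho [nrho _]] := proj2 nk _ (idm Y - s ∘ Phi).
    by rewrite cmpBr cmpA Phis cmp_idl cmp_idr subrr.
  have rhon : rho ∘ n = idm N.
    apply: (kernel_mono nk); rewrite cmpA nrho cmpBl -cmpA (proj1 nk).
    by rewrite cmp0r subr0 cmp_idl cmp_idr.
  have [c tc] := gen _ (t ∘ rho) sT'.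
  apply: (sur_neq0 sT' st); rewrite -[t]cmp_idr -rhon cmpA tc cmp_suml.
  rewrite big1 // => j _; rewrite -pphi -pPhi -!cmpA (proj1 nk).
  by rewrite !cmp0r.
have jPhi : inj Phi.
  apply: inj0 => x /kn[y ->]; move/is_zeroP: N0 => N0.
  by rewrite -[y]vmap_id N0 vmap0l vmap0r.
have [Psi [PsiPhi PhiPsi]] := inj_iso aC omega_exact omega_faithful jPhi sPhi.
exists (fun j => Psi ∘ i j), phi; split=> //.
have [pi1 pi0 e] := bZ; split=> [j|j l jl|].
- by rewrite -pPhi cmpA -(cmpA (p j)) PhiPsi cmp_idr.
- by rewrite -pPhi cmpA -(cmpA (p j)) PhiPsi cmp_idr pi0.
rewrite -PsiPhi /Phi cmp_sumr.
by apply: eq_bigr => j _; rewrite cmpA.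
Qed.

End Top.
End Simple.

(** * The projective covers, their radicals and the presentation of the category *)

Section Presentation.
Variables (k : fieldType) (C : klin_cat k) (omega : lin_functor C (vec k)).

Record arrows (I : Type) (R : I -> C) (K : C) := Arrows {
  arr : finType;
  arr_tgt : arr -> I;
  arr_in : forall j, hom (R (arr_tgt j)) K;
  arr_out : forall j, hom K (R (arr_tgt j));
  arr_sum : is_bigsum arr_in arr_out
}.

(* R i runs over the indecomposable projectives, S i is the top of R i and    *)
(* K i its radical; u i is the universal element: omega(X) is the direct sum  *)
(* of the Hom(R i, X), by evaluation at the u i.                              *)
Record presentation := Presentation {
  ix : finType;
  pR : ix -> C;
  pS : ix -> C;
  pK : ix -> C;
  pu : forall i, omega (pR i) : vectType k;
  ppi : forall i, hom (pR i) (pS i);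
  kap : forall i, hom (pK i) (pR i);
  parr : forall i, arrows pR (pK i);
  p_proj : forall i, projective (pR i);
  p_repr : forall X (x : omega X : vectType k),
    exists f : forall i, hom (pR i) X, x = \sum_i vmap (f i) (pu i);
  p_uniq : forall X (f : forall i, hom (pR i) X),
    \sum_i vmap (f i) (pu i) = 0 -> forall i, f i = 0;
  kap_mono : forall i, is_mono (kap i);
  ppi_kap : forall i, ppi i ∘ kap i = 0;
  ppi_neq0 : forall i, ppi i <> 0;
  p_diag : forall i (c : hom (pR i) (pR i)),
    exists a d, c = a *: idm (pR i) + kap i ∘ d;
  p_off : forall i h (c : hom (pR h) (pR i)), h <> i -> exists d, c = kap i ∘ d;
  p_lt : forall i (j : arr (parr i)),
    (fdim omega (pR (arr_tgt j)) < fdim omega (pR i))%N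
}.

Hypothesis (aC : abelian_cat C).
Hypothesis (omega_exact : exact_functor omega) (omega_faithful : faithful omega).
Hypothesis dim1 : forall S : C, is_simple S -> fdim omega S = 1%N.
Hypothesis her : hereditary C.
Variables (P : C) (u : omega P : vectType k).
Hypothesis Pu : represents u.

(** The vertices index the top of [P]. Every simple object occurs there exactly once: at least once
    since [P] maps onto it, at most once since Hom(P, S) is the one-dimensional omega(S). *)
Lemma presentation_ex : exists p : presentation, True.
Proof.
have PP := represents_projective aC omega_exact omega_faithful Pu.
have [I [S [f [sS fr gen]]]] := top_ex aC omega_exact omega_faithful P.
(* The values of [c ∘ f i] and [f j] at [u] lie on one line, so the two maps are proportional; for
   distinct indices this contradicts freeness. *)
have same i j (c : hom (S i) (S j)) : c <> 0 -> i = j.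
  move=> c0; apply: NNPP => /eqP ij.
  have fj0 : f j <> 0.
    move=> fj0; have := fr (S j) (fun l => delta_mor S l j) (sS j) _ j.
    rewrite delta_mor_id => h; have /is_zeroP zS : idm (S j) = 0.
      apply: h; rewrite (bigD1 j) //= fj0 cmp0r add0r big1 // => l lj.
      by rewrite delta_mor0 // cmp0l.
    by case: (sS j).
  have [x fjx] : exists x, x = vmap (f j) u by eexists.
  have x0 : x != 0.
    apply/eqP => x0; apply: fj0; apply: (represents_uniq Pu).
    by rewrite -fjx x0 vmap0l.
  have [a e] := one_dim (vmap (c ∘ f i) u) (dim1 (sS j)) x0.
  have e' : c ∘ f i = a *: f j.
    by apply: (represents_uniq Pu); rewrite e vmapZl fjx.
  apply: c0; have := fr (S j)
    (fun l => c ∘ delta_mor S l i - a *: delta_mor S l j) (sS j) _ i.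
  rewrite delta_mor_id cmp_idr (delta_mor0 _ ij) scaler0 subr0; apply.
  have sd l : \sum_m delta_mor S m l ∘ f m = f l.
    rewrite (bigD1 l) //= delta_mor_id cmp_idl big1 ?addr0 // => m ml.
    by rewrite delta_mor0 // cmp0l.
  under eq_bigr do rewrite cmpBl -cmpA cmpZl.
  rewrite sumrB -cmp_sumr sd -scaler_sumr sd e'.
  exact: subrr.
have all T : is_simple T -> exists i (c : hom T (S i)), is_iso c.
  move=> sT; have [g g0] := represent_simple omega_faithful Pu sT.
  have [c gc] := gen T g sT.
  have [i ci0] : exists i, c i <> 0.
    apply: NNPP => no; apply: g0; rewrite gc big1 // => i _.
    suff -> : c i = 0 by rewrite cmp0l.
    by apply: NNPP => ci; apply: no; exists i.
  have [c' [c'c cc']] := simple_iso aC omega_exact omega_faithful (sS i) sT ci0.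
  by exists i, c'; exists (c i).
have [D Dcov] : exists D : forall i, {R : C & hom R (S i)},
    forall i, is_cover omega (projT2 (D i)).
  suff ex i : exists d : {R : C & hom R (S i)}, is_cover omega (projT2 d).
    exact: fin_all_exists ex.
  have [p p0] := represent_simple omega_faithful Pu (sS i).
  have [R [pi cov]] := cover_ex aC omega_exact omega_faithful PP (sS i) p0.
  by exists (existT _ R pi).
pose R i := projT1 (D i); pose pi i : hom (R i) (S i) := projT2 (D i).
have cov i : is_cover omega (pi i) := Dcov i.
have [ps [ph [bP _]]] :=
  projective_decomposition aC omega_exact omega_faithful PP sS fr gen cov.
have [E Ek] : exists E : forall i, {K : C & hom K (R i)},
    forall i, is_kernel (projT2 (E i)) (pi i) /\ inj omega (projT2 (E i)).
  suff ex i : exists d : {K : C & hom K (R i)},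
      is_kernel (projT2 d) (pi i) /\ inj omega (projT2 d).
    exact: fin_all_exists ex.
  have [K [kp [kk jk _]]] := kernel_ex aC omega_exact omega_faithful (pi i).
  by exists (existT _ K kp).
pose K i := projT1 (E i); pose kp i : hom (K i) (R i) := projT2 (E i).
have kk i : is_kernel (kp i) (pi i) by case: (Ek i).
have epi i : is_epi (pi i).
  by apply/(epiP aC omega_exact omega_faithful); case: (cov i).
have projK i : projective (K i).
  have [projR _ _] := cov i.
  exact: (hereditary_kernel aC omega_exact omega_faithful projR (epi i) (kk i) her).
have arrK i : exists a : arrows R (K i), True.
  have [J [T [g [sT gfr ggen]]]] := top_ex aC omega_exact omega_faithful (K i).
  (* The simple constituents of the top of [K i] are only isomorphic to members of the fixed family
     [S]; composing with the isomorphisms lets the fixed covers [R] be used. *)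
  have [d diso] : exists d : forall j, {l : I & hom (T j) (S l)},
      forall j, is_iso (projT2 (d j)).
    suff ex j : exists d : {l : I & hom (T j) (S l)}, is_iso (projT2 d).
      exact: fin_all_exists ex.
    have [l [c ciso]] := all _ (sT j).
    by exists (existT _ l c).
  pose t j := projT1 (d j); pose c j : hom (T j) (S (t j)) := projT2 (d j).
  have fr' : top_free (fun j => c j ∘ g j).
    move=> S' e sS' e0 j; apply: (iso_epi (diso j)); rewrite cmp0l.
    apply: (gfr S' (fun j => e j ∘ c j)) => //.
    by rewrite -[RHS]e0; apply: eq_bigr => l _; rewrite cmpA.
  have gen' : top_gen (fun j => c j ∘ g j).
    move=> S' h sS'; have [e ->] := ggen S' h sS'.
    have [r rP] := fin_all_exists diso.
    exists (fun j => e j ∘ r j); apply: eq_bigr => j _.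
    by rewrite cmpA -(cmpA (e j)); case: (rP j) => -> _; rewrite cmp_idr.
  have [be [al [bK _]]] :=
    projective_decomposition aC omega_exact omega_faithful (projK i)
      (fun j => sS (t j)) fr' gen' (fun j => cov (t j)).
  by exists (Arrows bK).
have [pa _] := fin_all_exists arrK.
have [phpsi1 phpsi0 psph] := bP.
have liftK i X (c : hom X (R i)) : pi i ∘ c = 0 -> exists d, c = kp i ∘ d.
  by move=> c0; have [d [<- _]] := proj2 (kk i) _ c c0; exists d.
have pi0 i : pi i <> 0.
  by apply: (sur_neq0 omega_faithful (sS i)); case: (cov i).
suff pr : presentation by exists pr.
apply: (@Presentation I R S K (fun i => vmap (ph i) u) pi kp pa).
- by move=> i; case: (cov i).
- move=> X x; have [h [hu _]] := Pu x; exists (fun i => h ∘ ps i).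
  rewrite -hu -{1}[h]cmp_idr -psph cmp_sumr vmap_suml.
  by apply: eq_bigr => i _; rewrite cmpA !vmap_cmp.
- move=> X h h0 i; have e : \sum_i h i ∘ ph i = 0.
    apply: (represents_uniq Pu); rewrite vmap0l vmap_suml -[RHS]h0.
    by apply: eq_bigr => j _; rewrite vmap_cmp.
  by rewrite -(bigsum_in h i bP) e cmp0l.
- by move=> i; apply: kernel_mono (kk i).
- by move=> i; case: (kk i).
- exact: pi0.
- move=> i c.
  have [d pic] := cover_hom aC omega_exact omega_faithful (pi i ∘ c) (sS i)
    (sS i) (cov i).
  have [id0 | id0] := classic (idm (S i) = 0).
    by case: (sS i) => -[]; apply/is_zeroP.
  have [a da] := simple_scalar omega_faithful dim1 d (sS i) (dim1 (sS i)) id0.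
  have [|e ce] := liftK i _ (c - a *: idm (R i)).
    by rewrite cmpBr pic da cmpZl cmp_idl cmpZr cmp_idr subrr.
  by exists a, e; rewrite -ce addrC subrK.
- move=> i h c hi; apply: liftK; apply: NNPP => pc0; apply: hi.
  have [d pic] := cover_hom aC omega_exact omega_faithful (pi i ∘ c) (sS h)
    (sS i) (cov h).
  by apply: (same h i d) => d0; apply: pc0; rewrite pic d0 cmp0l.
move=> i j; have [ao1 _ _] := arr_sum (pa i).
(* The target cover is a direct summand of the radical, and the radical is proper because [pi i] is
   nonzero. *)
apply: (@leq_ltn_trans (fdim omega (K i))).
  apply: (fdim_inj (f := arr_in j)); apply: inj0 => x x0.
  by rewrite -[x]vmap_id -ao1 vmap_cmp x0 vmap0r.
rewrite ltnNge; apply/negP => le.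
have /iso_epi ek : is_iso (kp i).
  by apply: (inj_dim_iso aC omega_exact omega_faithful) le; case: (Ek i).
by apply: (pi0 i); apply: ek; rewrite cmp0l; case: (kk i).
Qed.

End Presentation.

(** * The quiver and its representations *)

Section VectAux.
Variable k : fieldType.

Lemma functional_ex (V : vectType k) (v : V) :
  v != 0 -> exists mu : 'Hom(V, k^o), mu v = 1.
Proof.
move=> v0; have [i vi0] : exists i, vcoord i v != 0.
  apply: NNPP => no; case/eqP: v0; rewrite [v]vbase_sum big1 // => i _.
  have [->|vi] := eqVneq (vcoord i v) 0; first exact: scale0r.
  by case: no; exists i.
have cl : linear (fun x : V => (vcoord i v)^-1 * vcoord i x : k^o).
  by move=> a x y; rewrite /vcoord linearP mulrDr mulrCA.
by exists (linfun (fun x : V => (vcoord i v)^-1 * vcoord i x : k^o));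
  rewrite linfunE // mulVf.
Qed.

Lemma lfun_factor (A B W : vectType k) (p : 'Hom(A, B)) (q : 'Hom(A, W)) :
  (forall b, exists a, p a = b) -> (forall a, p a = 0 -> q a = 0) ->
  exists r : 'Hom(B, W), forall a, r (p a) = q a.
Proof.
move=> sp kpq; exists (q \o p^-1)%VF => a; rewrite vcompE.
apply/subr0_eq; rewrite -linearB; apply: kpq.
by rewrite linearB /= limg_lfunVK ?subrr // memv_img ?memvf.
Qed.

Lemma vec_cmpE (U V W : vec k) (g : hom V W) (f : hom U V) x :
  fun_of_lfun (g ∘ f) x = fun_of_lfun g (fun_of_lfun f x).
Proof. exact: vcompE. Qed.

Lemma vec_bij_iso (V W : vec k) (f : hom V W) :
  (forall v, fun_of_lfun f v = 0 -> v = 0) ->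
  (forall w, exists v, fun_of_lfun f v = w) -> is_iso f.
Proof.
move=> f0 sf; have kf : lker f == 0%VS.
  apply/lker0P => x y e; apply/subr0_eq/f0.
  by rewrite linearB /= e subrr.
exists (f^-1)%VF; split; first exact: lker0_compVf.
apply/lfunP => w; have [v <-] := sf w.
by rewrite [LHS]vcompE limg_lfunVK ?vidE // memv_img ?memvf.
Qed.

End VectAux.

Section RepAux.
Variables (k : fieldType) (Q : quiver).

Lemma rep_homE (V W : rep k Q) (f : rep_hom V W) a v :
  rep_map W a (f (src a) v) = f (tgt a) (rep_map V a v).
Proof.
by have /forallP/(_ a)/eqP/lfunP/(_ v) := rep_funP f; rewrite !vcompE.
Qed.

Lemma rep_hom_make (V W : rep k Q) (F : forall i, 'Hom(V i, W i)) :
  (forall a v, rep_map W a (F (src a) v) = F (tgt a) (rep_map V a v)) ->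
  exists f : rep_hom V W, forall i, f i = F i.
Proof.
move=> FE; have fP : is_rep_hom (mk_dsum (V := fun i => 'Hom(V i, W i)) F).
  by apply/forallP => a; apply/eqP/lfunP => v; rewrite !mk_dsumE !vcompE FE.
by exists (RepHom fP) => i; rewrite mk_dsumE.
Qed.

Lemma rep_bij_iso (V W : rep_cat k Q) (f : hom V W) :
  (forall i v, (f : rep_hom V W) i v = 0 -> v = 0) ->
  (forall i w, exists v, (f : rep_hom V W) i v = w) -> is_iso f.
Proof.
move=> f0 sf.
have ex i : exists g : 'Hom(W i, V i), forall v, g ((f : rep_hom V W) i v) = v.
  have [|a|g gE] := @lfun_factor _ _ _ _ ((f : rep_hom V W) i) \1%VF.
  - exact: sf.
  - by move/f0->; rewrite linear0.
  by exists g => v; rewrite gE vidE.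
have [g gf] := fin_all_exists ex.
have fg i w : (f : rep_hom V W) i (g i w) = w by have [v <-] := sf i w; rewrite gf.
have [|h hE] := @rep_hom_make W V g.
  move=> a w; have [v <-] := sf _ w; by rewrite rep_homE !gf.
exists h; split; apply: rep_homP => i; apply/lfunP => v.
  by rewrite !mk_dsumE vcompE vidE hE gf.
by rewrite !mk_dsumE vcompE vidE hE fg.
Qed.

End RepAux.

Section Quiver.
Variables (k : fieldType) (C : klin_cat k) (omega : lin_functor C (vec k)).
Hypothesis (aC : abelian_cat C).
Hypothesis (omega_exact : exact_functor omega) (omega_faithful : faithful omega).
Variable p : presentation omega.
Implicit Types X Y Z : C.
Notation R := (@pR k C omega p).
Notation K := (@pK k C omega p).
Notation homV := (homV omega_faithful).
Notation postcomp := (postcomp omega_faithful).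
Notation precomp := (precomp omega_faithful).

Definition pres_quiver : quiver :=
  @Quiver (ix p) {i : ix p & arr (parr i)} (fun a => tag a)
    (fun a => arr_tgt (tagged a)).
Notation Q := pres_quiver.

(** It runs against the arrow, so that precomposition sends Hom(R (src a), X) to Hom(R (tgt a), X),
    as a representation requires. *)
Definition arrow_mor (a : arrow Q) : hom (R (tgt a)) (R (src a)) :=
  kap (tag a) ∘ arr_in (tagged a).

(** The dimension of the cover drops strictly along each arrow. *)
Lemma pres_acyclic : acyclic Q.
Proof.
move=> a s; set d := fun i => fdim omega (R i).
suff lt : path (fun b c => tgt b == src c) a s ->
    (d (tgt (last a s)) < d (src a))%N.
  move/lt; apply: contraTneq => ->; by rewrite ltnn.
elim: s a => [|b s IH] a /=; first by move=> _; apply: p_lt.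
case/andP=> /eqP e /IH lt; apply: (ltn_trans lt).
have <- : tgt a = src b := e.
exact: p_lt.
Qed.

Definition pres_rep X : rep k Q :=
  @Rep k Q (fun i => homV (R i) X) (fun a => precomp X (arrow_mor a)).

Fact pres_mapP X Y (f : hom X Y) : @is_rep_hom k Q (pres_rep X) (pres_rep Y)
  (mk_dsum (V := fun i => 'Hom(homV (R i) X, homV (R i) Y))
     (fun i => postcomp (R i) f)).
Proof.
apply/forallP => a; apply/eqP/lfunP => g; rewrite !mk_dsumE !vcompE.
by rewrite !(precompE, postcompE) cmpA.
Qed.

Definition pres_map X Y (f : hom X Y) : rep_hom (pres_rep X) (pres_rep Y) :=
  RepHom (pres_mapP f).

Lemma pres_mapE X Y (f : hom X Y) i (g : hom (R i) X) :
  pres_map f i g = f ∘ g.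
Proof. by rewrite mk_dsumE postcompE. Qed.

Fact pres_lin X Y : linear (@pres_map X Y).
Proof.
move=> a f g; apply: rep_homP => i; apply/lfunP => h.
have -> : (a *: pres_map f + pres_map g) i = a *: pres_map f i + pres_map g i.
  by rewrite mk_dsumE mk_dsumE.
by rewrite add_lfunE scale_lfunE !pres_mapE cmpDl cmpZl.
Qed.

Fact pres_id X : pres_map (idm X) = rep_id (pres_rep X).
Proof.
apply: rep_homP => i; apply/lfunP => h.
by rewrite pres_mapE mk_dsumE vidE cmp_idl.
Qed.

Fact pres_cmp X Y Z (g : hom Y Z) (f : hom X Y) :
  pres_map (g ∘ f) = rep_comp (pres_map g) (pres_map f).
Proof.
apply: rep_homP => i; apply/lfunP => h.
by rewrite pres_mapE [in RHS]mk_dsumE vcompE !pres_mapE cmpA.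
Qed.

Definition pres_functor : lin_functor C (rep_cat k Q) :=
  @LinFunctor k C (rep_cat k Q) pres_rep pres_map pres_lin pres_id pres_cmp.

Definition pres_comp X (v : dsum (pres_rep X)) i : hom (R i) X := v i.

Lemma pres_comp_lin X i : linear (fun v : dsum (pres_rep X) => pres_comp v i).
Proof. by move=> a x y; have := dsumD (a *: x) y i; rewrite dsumZ. Qed.

Definition pres_eval X : 'Hom(forget_ob (pres_rep X), omega X) :=
  linfun (fun v : dsum (pres_rep X) => \sum_i vmap (pres_comp v i) (pu i)).

Lemma pres_evalE X (v : dsum (pres_rep X)) :
  pres_eval X v = \sum_i vmap (pres_comp v i) (pu i).
Proof.
rewrite linfunE // => a x y; rewrite scaler_sumr -big_split /=.
apply: eq_bigr => i _; rewrite pres_comp_lin.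
exact: vmap_linl.
Qed.

Lemma pres_eval_nat_iso :
  @is_nat_iso _ _ _ (comp_functor (forget k Q) pres_functor) omega pres_eval.
Proof.
split=> [X|X Y f]; last first.
  apply/lfunP => v; rewrite !vec_cmpE !pres_evalE.
  apply: etrans (esym (vmap_sumr f _)); apply: eq_bigr => i _.
  by rewrite /pres_comp forget_mapE pres_mapE vmap_cmp.
apply: vec_bij_iso => [v | x].
  rewrite pres_evalE => v0; apply: dsumP => i.
  transitivity (0 : homV (R i) X); first exact: (p_uniq v0 i).
  exact: (esym (mk_dsumE (V := pres_rep X) (fun=> 0) i)).
have [f fx] := p_repr p x.
exists (mk_dsum (V := pres_rep X) f); rewrite pres_evalE fx.
by apply: eq_bigr => i _; rewrite /pres_comp mk_dsumE.
Qed.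

Lemma pres_test X Y (g : hom X Y) :
  (forall i (c : hom (R i) X), g ∘ c = 0) -> g = 0.
Proof.
move=> g0; apply: (vmap_eq0 omega_faithful) => x.
have [f ->] := p_repr p x; rewrite vmap_sumr big1 // => i _.
by rewrite -vmap_cmp g0 vmap0l.
Qed.

Lemma pres_faithful : faithful pres_functor.
Proof.
move=> X Y f g e; apply/subr0_eq/pres_test => i c.
rewrite cmpBl -!pres_mapE; have e' : pres_map f = pres_map g := e.
by rewrite e' subrr.
Qed.

(** Every morphism between covers is a combination of paths: modulo a scalar it factors through the
    radical, hence through arrows to covers of smaller dimension, on which induction applies. A
    relation on pairs covers both uses, the graph of a morphism and the kernel of one. *)
Lemma arrows_generate X Y (S : forall i, hom (R i) X -> hom (R i) Y -> Prop) :
  (forall i, S i 0 0) ->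
  (forall i a f g f' g', S i f g -> S i f' g' -> S i (a *: f + f') (a *: g + g')) ->
  (forall (a : arrow Q) f g, S (src a) f g ->
    S (tgt a) (f ∘ arrow_mor a) (g ∘ arrow_mor a)) ->
  forall i h (c : hom (R h) (R i)) f g, S i f g -> S h (f ∘ c) (g ∘ c).
Proof.
move=> S0 SD Sx i; have [n] := ubnP (fdim omega (R i)).
elim: n i => // n IH i lt_i h c f g Sfg.
have Sk (d : hom (R h) (K i)) : S h (f ∘ (kap i ∘ d)) (g ∘ (kap i ∘ d)).
  rewrite (bigsum_split_out d (arr_sum (parr i))) !cmp_sumr.
  apply: (big_ind2 (S h)); first exact: S0.
    by move=> x1 x2 y1 y2 h1 h2; rewrite -[x1]scale1r -[x2]scale1r; apply: SD.
  move=> j _; pose a : arrow Q := existT _ i j.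
  have through (W : C) (e : hom (R i) W) :
      e ∘ (kap i ∘ (arr_in j ∘ (arr_out j ∘ d)))
      = e ∘ arrow_mor a ∘ (arr_out j ∘ d) by rewrite !cmpA.
  rewrite !through.
  apply: IH; last exact: (Sx a).
  by rewrite -ltnS; apply: leq_trans lt_i; rewrite ltnS; apply: p_lt.
have [e|ne] := classic (h = i); last first.
  by have [d ->] := p_off c ne.
subst h; have [a [d ->]] := p_diag c.
by rewrite !cmpDr !cmpZr !cmp_idr; apply: SD.
Qed.

(** [T] prescribes a morphism on any sum of covers; applied to a sum mapping onto [X], that morphism
    descends to [X]. *)
Lemma pres_full X Y (T : rep_hom (pres_rep X) (pres_rep Y)) :
  exists f : hom X Y, pres_map f = T.
Proof.
(* Commuting with arrows implies commuting with all morphisms between covers. *)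
have Tc i h (c : hom (R h) (R i)) (f : hom (R i) X) :
    T h (f ∘ c) = (T i f : hom (R i) Y) ∘ c.
  apply: esym; apply: (@arrows_generate X Y (fun i f g => g = T i f)) => //.
  - by move=> l; rewrite (linear0 (T l)).
  - by move=> l a f1 g1 f2 g2 -> ->; rewrite (linearP (T l)).
  move=> a f1 g1 ->; have := @rep_homE k Q _ _ T a f1.
  by rewrite /= !precompE.
pose L : finType := ('I_(\dim {: (omega X : vectType k)}) * ix p)%type.
have [F0 F0E] := fin_all_exists (fun l => p_repr p (vbase l : omega X : vectType k)).
pose F (l : L) : hom (R l.2) X := F0 l.1 l.2.
have [Z [i [pr bZ]]] := bigsum_ex (fun l : L => R l.2) aC.
pose pi := \sum_l F l ∘ pr l.
have pii l : pi ∘ i l = F l by apply: bigsum_in bZ.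
have spi : sur omega pi.
  move=> x; exists (\sum_(l : L) vcoord l.1 x *: vmap (i l) (pu l.2)).
  rewrite [RHS](vbase_sum (x : omega X : vectType k)) vmap_sumr.
  transitivity (\sum_a \sum_b vmap pi (vcoord a x *: vmap (i (a, b)) (pu b))).
    by rewrite pair_bigA; apply: eq_bigr => -[].
  apply: eq_bigr => a _; rewrite F0E scaler_sumr; apply: eq_bigr => b _.
  by rewrite vmapZr -vmap_cmp pii.
(* This is what [f ∘ pi] has to be. Tested on covers it equals [T] of the composite with [pi], so it
   vanishes on the kernel of [pi]. *)
pose pi' := \sum_l (T l.2 (F l) : hom (R l.2) Y) ∘ pr l.
have [N [n [nk jn kn]]] := kernel_ex aC omega_exact omega_faithful pi.
have pi'c j (c : hom (R j) Z) : pi' ∘ c = T j (pi ∘ c).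
  rewrite /pi /pi' !cmp_suml linear_sum; apply: eq_bigr => l _ /=.
  by rewrite -!cmpA Tc.
have pi'n : pi' ∘ n = 0.
  apply: pres_test => j c; rewrite -cmpA pi'c cmpA (proj1 nk) cmp0l.
  exact: (linear0 (T j)).
have [|f fpi] := lift_epi aC omega_exact omega_faithful (g := pi') spi.
  by move=> x /kn[y ->]; rewrite -vmap_cmp pi'n vmap0l.
exists f; apply: rep_homP => j; apply/lfunP => g; rewrite pres_mapE.
have [|c <-] := @p_proj k C omega p j _ _ pi g.
  exact/(epiP aC omega_exact omega_faithful).
by rewrite cmpA fpi pi'c.
Qed.

Lemma pres_kernel_stable X (V : rep k Q) (q : rep_hom (pres_rep X) V)
    i h (c : hom (R h) (R i)) (f : hom (R i) X) :
  q i f = 0 -> q h (f ∘ c) = 0.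
Proof.
move=> qf; apply: (@arrows_generate X X (fun i f _ => q i f = 0) _ _ _ i h c f f qf)
  => [l|l a f1 g1 f2 g2|a f1 g1].
- exact: (linear0 (q l)).
- by move=> e1 e2; rewrite (linearP (q l)) /= e1 e2 scaler0 addr0.
move=> e; have := @rep_homE k Q _ _ q a f1.
by rewrite e linear0 /= precompE => <-.
Qed.

(* Freeness: Hom(R h, R i) splits as k (if h = i) plus the Hom(R h, R j),     *)
(* one for each arrow i -> j, so the morphism is determined recursively.      *)
Lemma pres_free (V : rep k Q) i (v : V i) :
  exists f : rep_hom (pres_rep (R i)) V, f i (idm (R i)) = v.
Proof.
have [n] := ubnP (fdim omega (R i)); elim: n i v => // n IH i v lt_i.
have exPsi (j : arr (parr i)) : exists f : rep_hom (pres_rep (R (arr_tgt j))) V,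
    f (arr_tgt j) (idm _) = rep_map V (existT _ i j : arrow Q) v.
  by apply: IH; apply: leq_trans (p_lt _) _; rewrite -ltnS.
have [Psi PsiE] := fin_all_exists exPsi.
pose D h : 'Hom(homV (R h) (K i), V h) :=
  (\sum_(j : arr (parr i)) (Psi j h \o postcomp (R h) (arr_out j)))%VF.
have DE h d : D h d = \sum_j Psi j h (arr_out j ∘ d).
  by rewrite sum_lfunE; apply: eq_bigr => j _; rewrite vcompE postcompE.
pose idcast h (e : i = h) := eq_rect i (fun h => hom (R h) (R i)) (idm (R i)) h e.
(* On maps through the radical, [F] is forced by the morphisms already obtained at the targets of
   the arrows; it remains to prescribe the identity, which exists only when [h] is [i], hence the
   cast. *)
have exF h : exists F : 'Hom(homV (R h) (R i), V h),
    (forall d : hom (R h) (K i), F (kap i ∘ d) = D h d) /\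
    (forall e : i = h, F (idcast h e) = eq_rect i (fun h => V h : Type) v h e).
  have /eqP kk : lker (postcomp (R h) (kap i)) == 0%VS.
    by apply/lker0P => d d'; rewrite !postcompE => /kap_mono.
  have [L LE] : exists L : 'Hom(homV (R h) (R i), V h),
      forall d, L (kap i ∘ d) = D h d.
    exists (D h \o (postcomp (R h) (kap i))^-1)%VF => d.
    rewrite vcompE -(postcompE omega_faithful); congr (D h _).
    by apply: lker0_lfunK; rewrite kk.
  have [e|ne] := classic (i = h); last by exists L; split=> // e; case: ne.
  subst h; have pi0 : (ppi i : homV (R i) (pS i)) != 0 by apply/eqP/ppi_neq0.
  have [mu mu1] := functional_ex pi0.
  pose w := v - L (idm (R i)).
  (* The correction vanishes on maps through the radical, which [ppi i] kills, and moves the value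
     at the identity from that of [L] to [v]. *)
  exists (L + (vec_line w \o (mu \o postcomp (R i) (ppi i))))%VF.
  split=> [d|e]; rewrite add_lfunE !vcompE postcompE.
    by rewrite cmpA ppi_kap cmp0l (linear0 mu) linear0 addr0 LE.
  rewrite /idcast (eq_axiomK e) /= cmp_idr mu1 vec_lineE scale1r.
  by rewrite addrC subrK.
have [F FE] := fin_all_exists exF.
have Fid : F i (idm (R i)) = v by case: (FE i) => _ /(_ erefl).
have [|f fE] := @rep_hom_make k Q (pres_rep (R i)) V F; last first.
  by exists f; rewrite fE.
have comm (a : arrow Q) (d : hom (R (src a)) (K i)) :
    rep_map V a (F (src a) (kap i ∘ d)) = F (tgt a) (kap i ∘ d ∘ arrow_mor a).
  rewrite (proj1 (FE _)) -cmpA (proj1 (FE _)) !DE linear_sum.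
  apply: eq_bigr => j _ /=.
  rewrite (@rep_homE k Q _ _ (Psi j) a (arr_out j ∘ d)) /= precompE.
  by rewrite cmpA.
move=> a c; rewrite [rep_map _ a c]precompE.
have [e|ne] := classic (src a = i); last first.
  by have [d ->] := p_off (c : hom (R (src a)) (R i)) ne; apply: comm.
case: a e c comm => h j /= e; subst h => c comm.
have [x [d ->]] := p_diag (c : hom (R i) (R i)).
rewrite cmpDl cmpZl cmp_idl (linearP (F i)) /=.
apply: etrans (linearP (rep_map V (existT _ i j : arrow Q)) x _ _) _.
apply: etrans _ (esym (linearP (F (arr_tgt j)) x _ _)).
congr (_ *: _ + _); last exact: (comm (existT _ i j) d).
(* At the identity, only the summand of the arrow [j] itself survives, and [Psi j] was chosen to
   give the image of [v] under that arrow. *)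
rewrite Fid /arrow_mor /= (proj1 (FE _)) DE (bigD1 j) //= big1 => [|l lj].
  have [io _ _] := arr_sum (parr i).
  by rewrite io PsiE addr0.
have [_ io _] := arr_sum (parr i).
by rewrite io // (linear0 (Psi l _)).
Qed.

(** Free representations on a basis of [V] give a surjection [q] from the image of a sum [Z0] of
    covers. Its kernel is generated by maps from covers to [Z0], and the cokernel X of their sum
    represents [V], since the kernel of [q] is stable under all morphisms between covers
    ([pres_kernel_stable]). *)
Lemma pres_ess_surj (V : rep_cat k Q) :
  exists X (f : hom (pres_functor X) V), is_iso f.
Proof.
pose L : finType := {h : ix p & 'I_(\dim {: (V : rep k Q) h})}.
pose t (l : L) : ix p := tag l.
pose b (l : L) : (V : rep k Q) (t l) := vbase (tagged l).
have [Psi PsiE] := fin_all_exists (fun l => pres_free (b l)).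
have [Z0 [i0 [p0 bZ0]]] := bigsum_ex (fun l => R (t l)) aC.
have [|q qE'] := @rep_hom_make k Q (pres_rep Z0) V
  (fun h => \sum_l (Psi l h \o postcomp (R h) (p0 l)))%VF.
  move=> a c; rewrite !sum_lfunE linear_sum; apply: eq_bigr => l _.
  rewrite !vcompE !postcompE /= precompE.
  rewrite (@rep_homE k Q _ _ (Psi l) a (p0 l ∘ c)) /= precompE.
  by rewrite cmpA.
have qE h (c : hom (R h) Z0) : q h c = \sum_l Psi l h (p0 l ∘ c).
  by rewrite qE' sum_lfunE; apply: eq_bigr => l _; rewrite vcompE postcompE.
have [p0i0 p0i0' _] := bZ0.
pose e h (i : 'I_(\dim {: (V : rep k Q) h})) : hom (R h) Z0 := i0 (existT _ h i).
have qi0 l : q (t l) (i0 l) = b l.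
  rewrite qE (bigD1 l) //= p0i0 PsiE big1 ?addr0 // => l' ll'.
  by rewrite p0i0' // (linear0 (Psi l' (t l))).
have qe h i : q h (e h i) = vbase i by apply: (qi0 (existT _ h i)).
have sq h (v : (V : rep k Q) h) : exists c : hom (R h) Z0, q h c = v.
  exists (\sum_i vcoord i v *: e h i).
  rewrite (linear_sum (q h)) [RHS]vbase_sum; apply: eq_bigr => i _.
  by rewrite /= (linearZ_LR (q h)) /= qe.
pose L' : finType := {h : ix p & 'I_(\dim (lker (q h)))}.
pose t' (l : L') : ix p := tag l.
pose b' (l : L') : hom (R (t' l)) Z0 := (vbasis (lker (q (tag l))))`_(tagged l).
have qb' l : q (t' l) (b' l) = 0.
  apply/eqP; rewrite -memv_ker; apply: vbasis_mem.
  by rewrite mem_nth // size_tuple.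
have [Z1 [i1 [p1 bZ1]]] := bigsum_ex (fun l => R (t' l)) aC.
pose F := \sum_l b' l ∘ p1 l.
have Fi1 l : F ∘ i1 l = b' l by apply: bigsum_in bZ1.
have [X [pr [prF spr kpr]]] := cokernel_ex aC omega_exact omega_faithful F.
have prq h (c : hom (R h) Z0) : pr ∘ c = 0 -> q h c = 0.
  move=> prc0; have [|c' <-] := proj_lift (@p_proj _ _ _ p h) _ prc0 (f := F).
    by apply/(exact_atP aC omega_exact omega_faithful).
  rewrite cmp_suml (linear_sum (q h)) big1 // => l _ /=.
  by rewrite -cmpA pres_kernel_stable.
have qpr h (c : hom (R h) Z0) : q h c = 0 -> pr ∘ c = 0.
  move/eqP; rewrite -memv_ker => /coord_vbasis ->.
  rewrite (linp_sum (cmp_linr pr)) big1 // => i _.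
  rewrite (linpZ (cmp_linr pr)) -[_`_i]/(b' (existT _ h i)) -Fi1 cmpA prF.
  by rewrite cmp0l scaler0.
have epr : is_epi pr by apply/(epiP aC omega_exact omega_faithful).
have spc h (g : hom (R h) X) : exists c, pr ∘ c = g.
  exact: (@p_proj _ _ _ p h).
have exT h : exists T : 'Hom(homV (R h) X, (V : rep k Q) h),
    forall c : hom (R h) Z0, T (pr ∘ c) = q h c.
  have [||T TE] := lfun_factor (p := postcomp (R h) pr) (q := q h).
  - by move=> g; have [c <-] := spc h g; exists c; rewrite postcompE.
  - by move=> c; rewrite postcompE; apply: prq.
  by exists T => c; rewrite -TE postcompE.
have [T TE] := fin_all_exists exT.
have [|f fE] := @rep_hom_make k Q (pres_rep X) V T.
  move=> a g; have [c <-] := spc _ g; rewrite TE.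
  rewrite (@rep_homE k Q _ _ q a c) /= !precompE -TE.
  by rewrite cmpA.
exists X, f; apply: rep_bij_iso => [h g|h v].
  have [c <-] := spc h g; rewrite fE TE; exact: qpr.
have [c <-] := sq h v; exists (pr ∘ c); by rewrite fE TE.
Qed.

End Quiver.

(** * Transport of monoidal structures *)

Section AdjointEquivalence.
Variables (k : fieldType) (C D : klin_cat k) (F : lin_functor C D).

Definition inverse (E : klin_cat k) (X Y : E) (f : hom X Y) (g : hom Y X) :=
  g ∘ f = idm X /\ f ∘ g = idm Y.

(** [uni] is the inverse of the usual unit, so the last two fields are the triangle identities. *)
Record adj_equivalence := AdjEquivalence {
  inv_fun : lin_functor D C;
  cou : forall V, hom (F (inv_fun V)) V;
  cou' : forall V, hom V (F (inv_fun V));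
  uni : forall X, hom (inv_fun (F X)) X;
  uni' : forall X, hom X (inv_fun (F X));
  couK : forall V, inverse (cou V) (cou' V);
  uniK : forall X, inverse (uni X) (uni' X);
  cou_nat : forall V W (f : hom V W), cou W ∘ fmap F (fmap inv_fun f) = f ∘ cou V;
  uni_nat : forall X Y (f : hom X Y), uni Y ∘ fmap inv_fun (fmap F f) = f ∘ uni X;
  uni_cou : forall X, fmap F (uni X) = cou (F X);
  cou_uni : forall V, fmap inv_fun (cou V) = uni (inv_fun V)
}.

Hypothesis F_full : forall X Y (g : hom (F X) (F Y)), exists f, fmap F f = g.
Hypothesis F_faithful : faithful F.
Hypothesis F_ess : forall V : D, exists X (f : hom (F X) V), is_iso f.

Lemma adj_equivalence_ex : exists a : adj_equivalence, True.
Proof.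
pose T V := {X : C & (hom (F X) V * hom V (F X))%type}.
have exG V : exists t : T V, inverse (projT2 t).1 (projT2 t).2.
  by have [X [f [g fg]]] := F_ess V; exists (existT _ X (f, g)).
pose t V := proj1_sig (constructive_indefinite_description _ (exG V)).
pose G V := projT1 (t V).
pose ep V : hom (F (G V)) V := (projT2 (t V)).1.
pose ep' V : hom V (F (G V)) := (projT2 (t V)).2.
have epK V : inverse (ep V) (ep' V).
  exact: (proj2_sig (constructive_indefinite_description _ (exG V))).
pose pre X Y g := proj1_sig (constructive_indefinite_description _ (@F_full X Y g)).
have preE X Y (g : hom (F X) (F Y)) : fmap F (pre X Y g) = g.
  by rewrite /pre; case: constructive_indefinite_description.
pose Gm V W (f : hom V W) := pre (G V) (G W) (ep' W ∘ f ∘ ep V).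
have GmE V W (f : hom V W) : fmap F (Gm V W f) = ep' W ∘ f ∘ ep V by apply: preE.
have Gl V W : linear (@Gm V W).
  move=> a f g; apply: F_faithful.
  by rewrite fmap_lin !GmE cmpDr cmpDl cmpZr cmpZl.
have G1 V : Gm V V (idm V) = idm (G V).
  by apply: F_faithful; rewrite GmE fmap_id cmp_idr; case: (epK V).
have Gc U V W (g : hom V W) (f : hom U V) : Gm U W (g ∘ f) = Gm V W g ∘ Gm U V f.
  apply: F_faithful; rewrite fmap_cmp !GmE.
  by rewrite !cmpA -(cmpA _ (ep V)) (proj2 (epK V)) cmp_idr.
pose GF : lin_functor D C := LinFunctor Gl G1 Gc.
(* Defining the unit from the counit by full faithfulness makes the triangle identities hold. *)
pose et X : hom (GF (F X)) X := pre (GF (F X)) X (ep (F X)).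
pose et' X : hom X (GF (F X)) := pre X (GF (F X)) (ep' (F X)).
have etE X : fmap F (et X) = ep (F X) by apply: preE.
have et'E X : fmap F (et' X) = ep' (F X) by apply: preE.
have ep_nat V W (f : hom V W) : ep W ∘ fmap F (fmap GF f) = f ∘ ep V.
  by rewrite /= GmE !cmpA (proj2 (epK W)) cmp_idl.
suff a : adj_equivalence by exists a.
apply: (@AdjEquivalence GF ep ep' et et') => //.
- move=> X; split; apply: F_faithful; rewrite fmap_cmp etE et'E fmap_id.
    by case: (epK (F X)).
  by case: (epK (F X)).
- by move=> X Y f; apply: F_faithful; rewrite !fmap_cmp !etE ep_nat.
move=> V; apply: F_faithful; rewrite etE /= GmE.
by have [e _] := epK V; rewrite e cmp_idl.
Qed.

Lemma adj_equivalence_is : adj_equivalence -> is_equivalence F.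
Proof.
move=> a; exists (inv_fun a); split.
  exists (@uni a); split=> [X|X Y f]; last exact: uni_nat.
  by exists (uni' a X); apply: uniK.
exists (@cou a); split=> [V|V W f]; last exact: cou_nat.
by exists (cou' a V); apply: couK.
Qed.

End AdjointEquivalence.

Section TensorAux.
Variables (k : fieldType) (C : klin_cat k) (M : monoidal C).
Implicit Types X Y Z T : C.
Notation "f ⊗ g" := (tmor M f g) (at level 30).

Lemma tmor_inter X X' Y Y' (f : hom X X') (g : hom Y Y') :
  (f ⊗ idm Y') ∘ (idm X ⊗ g) = f ⊗ g.
Proof. by rewrite -tmor_cmp cmp_idl cmp_idr. Qed.

Lemma tmor_inter' X X' Y Y' (f : hom X X') (g : hom Y Y') :
  (idm X' ⊗ g) ∘ (f ⊗ idm Y) = f ⊗ g.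
Proof. by rewrite -tmor_cmp cmp_idl cmp_idr. Qed.

Lemma tmor_inverse X X' Y Y' (f : hom X X') f' (g : hom Y Y') g' :
  inverse f f' -> inverse g g' -> inverse (f ⊗ g) (f' ⊗ g').
Proof.
by move=> [f1 f2] [g1 g2]; split; rewrite -tmor_cmp ?f1 ?g1 ?f2 ?g2 tmor_id.
Qed.

Lemma tmor_iso X X' Y Y' (f : hom X X') (g : hom Y Y') :
  is_iso f -> is_iso g -> is_iso (f ⊗ g).
Proof.
by move=> [f' fK] [g' gK]; exists (f' ⊗ g'); apply: tmor_inverse.
Qed.

End TensorAux.

Section Transport.
Variables (k : fieldType) (C D : klin_cat k) (F : lin_functor C D).
Variables (a : adj_equivalence F) (M : monoidal C).
Notation G := (inv_fun a).
Notation "f ⊗ g" := (tmor M f g) (at level 30).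
Implicit Types U V W T : D.

Let uniV X : uni a X ∘ uni' a X = idm X. Proof. by case: (uniK a X). Qed.
Let uni'V X : uni' a X ∘ uni a X = idm _. Proof. by case: (uniK a X). Qed.
Let couV V : cou a V ∘ cou' a V = idm V. Proof. by case: (couK a V). Qed.
Let cou'V V : cou' a V ∘ cou a V = idm _. Proof. by case: (couK a V). Qed.

Lemma inv_fmap X Y (f : hom X Y) : fmap G (fmap F f) = uni' a Y ∘ f ∘ uni a X.
Proof. by rewrite -cmpA -uni_nat cmpA uni'V cmp_idl. Qed.

Lemma uni_iso X : is_iso (uni a X).
Proof. by exists (uni' a X); apply: uniK. Qed.
Lemma uni'_iso X : is_iso (uni' a X).
Proof. by exists (uni a X); case: (uniK a X). Qed.
Lemma cou_iso V : is_iso (cou a V).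
Proof. by exists (cou' a V); apply: couK. Qed.

Definition trob V W : D := F (tob M (G V) (G W)).
Definition trmor V V' W W' (f : hom V V') (g : hom W W') :
  hom (trob V W) (trob V' W') := fmap F (fmap G f ⊗ fmap G g).
(** A tensor product in [D] is [F] of one in [C]; nesting inserts the composite of [F] and [G],
    which [uni] removes before the associator and [uni'] restores after it. *)
Definition trassoc U V W : hom (trob (trob U V) W) (trob U (trob V W)) :=
  fmap F ((idm (G U) ⊗ uni' a (tob M (G V) (G W))) ∘ assoc M (G U) (G V) (G W)
          ∘ (uni a (tob M (G U) (G V)) ⊗ idm (G W))).
Definition trlunit V : hom (trob (F (tunit M)) V) V :=
  cou a V ∘ fmap F (lunit M (G V) ∘ (uni a (tunit M) ⊗ idm (G V))).
Definition trrunit V : hom (trob V (F (tunit M))) V :=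
  cou a V ∘ fmap F (runit M (G V) ∘ (idm (G V) ⊗ uni a (tunit M))).

Fact trmor_linl V V' W W' (g : hom W W') :
  linear (fun f : hom V V' => trmor f g).
Proof. by move=> b f f'; rewrite /trmor fmap_lin tmor_linl fmap_lin. Qed.
Fact trmor_linr V V' W W' (f : hom V V') :
  linear (fun g : hom W W' => trmor f g).
Proof. by move=> b g g'; rewrite /trmor fmap_lin tmor_linr fmap_lin. Qed.
Fact trmor_id V W : trmor (idm V) (idm W) = idm (trob V W).
Proof. by rewrite /trmor !fmap_id tmor_id fmap_id. Qed.
Fact trmor_cmp V V' V'' W W' W'' (f' : hom V' V'') (f : hom V V')
    (g' : hom W' W'') (g : hom W W') :
  trmor (f' ∘ f) (g' ∘ g) = trmor f' g' ∘ trmor f g.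
Proof. by rewrite /trmor !fmap_cmp tmor_cmp fmap_cmp. Qed.

Fact trassoc_iso U V W : is_iso (trassoc U V W).
Proof.
apply: is_iso_fmap; apply: is_iso_cmp; first apply: is_iso_cmp.
- by apply: tmor_iso; [apply: is_iso_id | apply: uni'_iso].
- exact: assoc_iso.
by apply: tmor_iso; [apply: uni_iso | apply: is_iso_id].
Qed.
Fact trlunit_iso V : is_iso (trlunit V).
Proof.
apply: is_iso_cmp; first exact: cou_iso.
apply: is_iso_fmap; apply: is_iso_cmp; first exact: lunit_iso.
by apply: tmor_iso; [apply: uni_iso | apply: is_iso_id].
Qed.
Fact trrunit_iso V : is_iso (trrunit V).
Proof.
apply: is_iso_cmp; first exact: cou_iso.
apply: is_iso_fmap; apply: is_iso_cmp; first exact: runit_iso.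
by apply: tmor_iso; [apply: is_iso_id | apply: uni_iso].
Qed.

Fact trassoc_nat U U' V V' W W' (f : hom U U') (g : hom V V') (h : hom W W') :
  trassoc U' V' W' ∘ trmor (trmor f g) h = trmor f (trmor g h) ∘ trassoc U V W.
Proof.
rewrite /trassoc /trmor -!fmap_cmp; congr (fmap F _).
rewrite !inv_fmap -!cmpA -tmor_cmp cmp_idl !cmpA uniV cmp_idl.
rewrite -[fmap G h in LHS]cmp_idr tmor_cmp !cmpA -(cmpA _ (assoc _ _ _ _)).
rewrite assoc_nat -!tmor_cmp !cmpA -tmor_cmp cmp_idr cmp_idl -(cmpA _ (uni a _)).
by rewrite uniV cmp_idr.
Qed.

Fact trlunit_nat V V' (f : hom V V') :
  trlunit V' ∘ trmor (idm (F (tunit M))) f = f ∘ trlunit V.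
Proof.
rewrite /trlunit /trmor fmap_id !cmpA -cou_nat -!cmpA -!fmap_cmp.
congr (_ ∘ fmap F _); rewrite -cmpA -tmor_cmp cmp_idl cmp_idr.
by rewrite -tmor_inter' !cmpA lunit_nat.
Qed.

Fact trrunit_nat V V' (f : hom V V') :
  trrunit V' ∘ trmor f (idm (F (tunit M))) = f ∘ trrunit V.
Proof.
rewrite /trrunit /trmor fmap_id !cmpA -cou_nat -!cmpA -!fmap_cmp.
congr (_ ∘ fmap F _); rewrite -cmpA -tmor_cmp cmp_idl cmp_idr.
by rewrite -tmor_inter !cmpA runit_nat.
Qed.

Fact trtriangle V W :
  trmor (idm V) (trlunit W) ∘ trassoc V (F (tunit M)) W
  = trmor (trrunit V) (idm W).
Proof.
have -> : trmor (idm V) (trlunit W) = fmap F (idm (G V) ⊗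
    (lunit M (G W) ∘ (uni a (tunit M) ⊗ idm (G W)) ∘ uni a _)).
  by rewrite /trmor /trlunit fmap_id [fmap G (_ ∘ _)]fmap_cmp cou_uni uni_nat.
have -> : trmor (trrunit V) (idm W) = fmap F (
    (runit M (G V) ∘ (idm (G V) ⊗ uni a (tunit M)) ∘ uni a _) ⊗ idm (G W)).
  by rewrite /trmor /trrunit fmap_id [fmap G (_ ∘ _)]fmap_cmp cou_uni uni_nat.
rewrite -fmap_cmp; congr (fmap F _).
rewrite !cmpA -tmor_cmp cmp_idl -[_ ∘ uni' a _]cmpA uniV cmp_idr.
rewrite tmor_cmpr -(cmpA _ _ (assoc _ _ _ _)) -assoc_nat !cmpA triangle.
by rewrite !tmor_cmpl.
Qed.

Fact trpentagon U V W T :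
  trassoc U V (trob W T) ∘ trassoc (trob U V) W T
  = trmor (idm U) (trassoc V W T) ∘ trassoc U (trob V W) T
    ∘ trmor (trassoc U V W) (idm T).
Proof.
rewrite /trmor /trassoc -!fmap_cmp; congr (fmap F _).
rewrite !fmap_id !inv_fmap.
set u := uni a (tob M (G U) (G V)).
set v := uni' a (tob M (G W) (G T)).
transitivity ((idm (G U) ⊗ uni' a _) ∘ (idm (G U) ⊗ (idm (G V) ⊗ v))
  ∘ (assoc M (G U) (G V) (tob M (G W) (G T)) ∘ assoc M (tob M (G U) (G V)) (G W) (G T))
  ∘ ((u ⊗ idm (G W)) ⊗ idm (G T)) ∘ (uni a _ ⊗ idm (G T))).
  rewrite !cmpA; congr (_ ∘ _); rewrite -!(cmpA (_ ⊗ uni' a _)); congr (_ ∘ _).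
  rewrite -!assoc_nat tmor_id -!cmpA; congr (_ ∘ _).
  by rewrite assoc_nat tmor_id !cmpA tmor_inter tmor_inter'.
rewrite pentagon.
(* The middle associator of the pentagon appears in [D] conjugated by the unit at [V] tensor [W];
   naturality undoes it. *)
have mid : (idm (G U) ⊗ (uni a (tob M (G V) (G W)) ⊗ idm (G T)))
    ∘ assoc M (G U) (G (trob V W)) (G T)
    ∘ ((idm (G U) ⊗ uni' a (tob M (G V) (G W))) ⊗ idm (G T))
  = assoc M (G U) (tob M (G V) (G W)) (G T).
  by rewrite -assoc_nat -cmpA -tmor_cmpl -tmor_cmpr uniV !tmor_id cmp_idr.
have c1 : (idm (G U) ⊗ uni a (tob M (G (trob V W)) (G T)))
    ∘ (idm (G U) ⊗ uni' a (tob M (G (trob V W)) (G T))) = idm _.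
  by rewrite -tmor_cmpr uniV tmor_id.
have c2 : (uni a (tob M (G U) (G (trob V W))) ⊗ idm (G T))
    ∘ (uni' a (tob M (G U) (G (trob V W))) ⊗ idm (G T)) = idm _.
  by rewrite -tmor_cmpl uniV tmor_id.
rewrite -mid !(tmor_cmpr, tmor_cmpl) !cmpA.
rewrite -[_ ∘ (_ ⊗ uni' a (tob M (G (trob V W)) (G T)))]cmpA c1 cmp_idr.
by rewrite -[_ ∘ (uni' a (tob M (G U) (G (trob V W))) ⊗ _)]cmpA c2 cmp_idr.
Qed.

Definition transport_monoidal : monoidal D :=
  Monoidal trmor_linl trmor_linr trmor_id trmor_cmp trassoc_iso trlunit_iso
    trrunit_iso trassoc_nat trlunit_nat trrunit_nat trtriangle trpentagon.
Notation N := transport_monoidal.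

Definition trmon2 X Y : hom (tob N (F X) (F Y)) (F (tob M X Y)) :=
  fmap F (uni a X ⊗ uni a Y).

Fact trmon2_iso X Y : is_iso (trmon2 X Y).
Proof. by apply/is_iso_fmap/tmor_iso; apply: uni_iso. Qed.

Fact trmon2_nat X X' Y Y' (f : hom X X') (g : hom Y Y') :
  trmon2 X' Y' ∘ tmor N (fmap F f) (fmap F g) = fmap F (f ⊗ g) ∘ trmon2 X Y.
Proof.
by rewrite /trmon2 /= /trmor -!fmap_cmp -!tmor_cmp !uni_nat.
Qed.

Fact trmon_assoc X Y Z :
  fmap F (assoc M X Y Z) ∘ trmon2 (tob M X Y) Z ∘ tmor N (trmon2 X Y) (idm (F Z))
  = trmon2 X (tob M Y Z) ∘ tmor N (idm (F X)) (trmon2 Y Z)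
      ∘ assoc N (F X) (F Y) (F Z).
Proof.
rewrite /trmon2 /= /trmor /trassoc -!fmap_cmp; congr (fmap F _).
rewrite !fmap_id -!cmpA -tmor_cmp uni_nat cmp_idr.
rewrite !cmpA -!tmor_cmp cmp_idr uni_nat -[_ ∘ uni' a _]cmpA uniV !cmp_idr.
rewrite -assoc_nat -cmpA -tmor_cmp cmp_idr.
by [].
Qed.

Fact trmon_lunit X :
  fmap F (lunit M X) ∘ trmon2 (tunit M) X ∘ tmor N (idm (tunit N)) (idm (F X))
  = lunit N (F X).
Proof.
rewrite tmor_id cmp_idr /trmon2 /= /trlunit -uni_cou -!fmap_cmp.
by congr (fmap F _); rewrite -tmor_inter' cmpA lunit_nat cmpA.
Qed.

Fact trmon_runit X :
  fmap F (runit M X) ∘ trmon2 X (tunit M) ∘ tmor N (idm (F X)) (idm (tunit N))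
  = runit N (F X).
Proof.
rewrite tmor_id cmp_idr /trmon2 /= /trrunit -uni_cou -!fmap_cmp.
by congr (fmap F _); rewrite -tmor_inter cmpA runit_nat cmpA.
Qed.

Definition transport_strong : strong_monoidal M N F :=
  @StrongMonoidal k C D M N F trmon2 (idm (F (tunit M))) trmon2_iso
    (is_iso_id _) trmon2_nat trmon_assoc trmon_lunit trmon_runit.

Definition invmon2 V W : hom (tob M (G V) (G W)) (G (tob N V W)) :=
  uni' a (tob M (G V) (G W)).

Fact invmon2_nat V V' W W' (f : hom V V') (g : hom W W') :
  invmon2 V' W' ∘ (fmap G f ⊗ fmap G g) = fmap G (tmor N f g) ∘ invmon2 V W.
Proof. by rewrite /invmon2 /= /trmor inv_fmap -!cmpA uniV cmp_idr. Qed.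

Fact invmon_assoc U V W :
  fmap G (assoc N U V W) ∘ invmon2 (tob N U V) W ∘ (invmon2 U V ⊗ idm (G W))
  = invmon2 U (tob N V W) ∘ (idm (G U) ⊗ invmon2 V W) ∘ assoc M (G U) (G V) (G W).
Proof.
rewrite /invmon2 /= /trassoc inv_fmap -!cmpA; congr (_ ∘ _).
rewrite (cmpA (uni a _)) uniV cmp_idl -tmor_cmpl uniV tmor_id cmp_idr.
by [].
Qed.

Fact invmon_lunit V :
  fmap G (lunit N V) ∘ invmon2 (tunit N) V ∘ (uni' a (tunit M) ⊗ idm (G V))
  = lunit M (G V).
Proof.
rewrite /invmon2 /= /trlunit [fmap G (_ ∘ _)]fmap_cmp cou_uni uni_nat -!cmpA.
rewrite (cmpA (uni a _)) uniV cmp_idl -tmor_cmpl uniV tmor_id cmp_idr.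
by [].
Qed.

Fact invmon_runit V :
  fmap G (runit N V) ∘ invmon2 V (tunit N) ∘ (idm (G V) ⊗ uni' a (tunit M))
  = runit M (G V).
Proof.
rewrite /invmon2 /= /trrunit [fmap G (_ ∘ _)]fmap_cmp cou_uni uni_nat -!cmpA.
rewrite (cmpA (uni a _)) uniV cmp_idl -tmor_cmpr uniV tmor_id cmp_idr.
by [].
Qed.

Definition transport_inv : strong_monoidal N M G :=
  @StrongMonoidal k D C N M G invmon2 (uni' a (tunit M))
    (fun V W => uni'_iso _) (uni'_iso _) invmon2_nat invmon_assoc
    invmon_lunit invmon_runit.

End Transport.

Section TransportIso.
Variables (k : fieldType) (D E : klin_cat k) (N : monoidal D) (P : monoidal E).
Variables (F F0 : lin_functor D E) (H : strong_monoidal N P F0).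
Variables (s : forall V, hom (F V) (F0 V)) (s' : forall V, hom (F0 V) (F V)).
Hypothesis (sK : forall V, inverse (s V) (s' V)).
Hypothesis (s_nat : forall V W (f : hom V W), s W ∘ fmap F f = fmap F0 f ∘ s V).
Notation "f ⊗ g" := (tmor P f g) (at level 30).

Let sV V : s V ∘ s' V = idm _. Proof. by case: (sK V). Qed.
Let s'V V : s' V ∘ s V = idm _. Proof. by case: (sK V). Qed.
Let s'_nat V W (f : hom V W) : fmap F f ∘ s' V = s' W ∘ fmap F0 f.
Proof.
transitivity (s' W ∘ (s W ∘ fmap F f) ∘ s' V).
  by rewrite !cmpA s'V cmp_idl.
by rewrite s_nat -!cmpA sV cmp_idr.
Qed.

Definition isomon2 V W : hom (tob P (F V) (F W)) (F (tob N V W)) :=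
  s' (tob N V W) ∘ mon2 H V W ∘ (s V ⊗ s W).

Fact isomon2_iso V W : is_iso (isomon2 V W).
Proof.
apply: is_iso_cmp; last by apply: tmor_iso; exists (s' _); apply: sK.
apply: is_iso_cmp; last exact: mon2_iso.
by exists (s (tob N V W)); case: (sK (tob N V W)).
Qed.

Fact isomon0_iso : is_iso (s' (tunit N) ∘ mon0 H).
Proof.
apply: is_iso_cmp; last exact: mon0_iso.
by exists (s (tunit N)); case: (sK (tunit N)).
Qed.

Fact isomon2_nat V V' W W' (f : hom V V') (g : hom W W') :
  isomon2 V' W' ∘ (fmap F f ⊗ fmap F g) = fmap F (tmor N f g) ∘ isomon2 V W.
Proof.
rewrite /isomon2 -cmpA -tmor_cmp !s_nat tmor_cmp !cmpA -(cmpA (s' _)) mon2_nat.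
by rewrite !cmpA s'_nat.
Qed.

Fact isomon_assoc U V W :
  fmap F (assoc N U V W) ∘ isomon2 (tob N U V) W ∘ (isomon2 U V ⊗ idm (F W))
  = isomon2 U (tob N V W) ∘ (idm (F U) ⊗ isomon2 V W) ∘ assoc P (F U) (F V) (F W).
Proof.
rewrite /isomon2 !cmpA s'_nat -!cmpA; congr (_ ∘ _).
rewrite -tmor_cmp (cmpA (s _) (s' _)) sV cmp_idl cmp_idr.
rewrite (cmpA (s U ⊗ _)) -tmor_cmp (cmpA (s _) (s' _)) sV cmp_idl cmp_idr.
rewrite -[s W in LHS]cmp_idl -[s U in RHS]cmp_idl !tmor_cmp !cmpA mon_assoc.
by rewrite -!cmpA assoc_nat.
Qed.

Fact isomon_lunit V :
  fmap F (lunit N V) ∘ isomon2 (tunit N) V ∘ ((s' (tunit N) ∘ mon0 H) ⊗ idm (F V))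
  = lunit P (F V).
Proof.
rewrite /isomon2 !cmpA s'_nat -!cmpA -tmor_cmp (cmpA (s _)) sV cmp_idl cmp_idr.
rewrite -tmor_inter !cmpA -(cmpA (s' V)) -(cmpA (s' V)) mon_lunit -cmpA lunit_nat.
by rewrite cmpA s'V cmp_idl.
Qed.

Fact isomon_runit V :
  fmap F (runit N V) ∘ isomon2 V (tunit N) ∘ (idm (F V) ⊗ (s' (tunit N) ∘ mon0 H))
  = runit P (F V).
Proof.
rewrite /isomon2 !cmpA s'_nat -!cmpA -tmor_cmp (cmpA (s _)) sV cmp_idl cmp_idr.
rewrite -tmor_inter' !cmpA -(cmpA (s' V)) -(cmpA (s' V)) mon_runit -cmpA runit_nat.
by rewrite cmpA s'V cmp_idl.
Qed.

Definition iso_strong : strong_monoidal N P F :=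
  @StrongMonoidal k D E N P F isomon2 (s' (tunit N) ∘ mon0 H) isomon2_iso
    isomon0_iso isomon2_nat isomon_assoc isomon_lunit isomon_runit.

End TransportIso.

Section EquivalenceExact.
Variables (k : fieldType) (C D : klin_cat k) (F : lin_functor C D).
Variable a : adj_equivalence F.
Notation G := (inv_fun a).

Lemma cou'_nat V W (f : hom V W) : fmap F (fmap G f) ∘ cou' a V = cou' a W ∘ f.
Proof.
have [_ e] := couK a V; have [e' _] := couK a W.
rewrite -[RHS]cmp_idr -e !cmpA -(cmpA _ f) -cou_nat !cmpA e' cmp_idl.
by [].
Qed.

Lemma inv_cou' V : fmap G (cou' a V) = uni' a (G V).
Proof.
have [_ e] := couK a V; have [e' _] := uniK a (G V).
rewrite -[LHS]cmp_idl -e' -cmpA -cou_uni -fmap_cmp e fmap_id.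
exact: cmp_idr.
Qed.

(** The adjunction turns a universal problem for the images under [G] into one in [D], on either
    side. *)
Lemma inv_exact : exact_functor G.
Proof.
move=> X Y Z f g [[gf0 kf] [_ cg]]; split; split.
- by rewrite -fmap_cmp gf0 fmap0.
- move=> T h gh0; have [|l [fl lu]] := kf _ (cou a Y ∘ fmap F h).
    by rewrite cmpA -cou_nat -cmpA -fmap_cmp gh0 fmap0 cmp0r.
  have [_ e] := uniK a T; have [e' _] := uniK a T.
  exists (fmap G l ∘ uni' a T); split.
    rewrite cmpA -fmap_cmp fl fmap_cmp cou_uni uni_nat -cmpA e.
    exact: cmp_idr.
  move=> m fm; rewrite (lu (cou a X ∘ fmap F m)).
    by rewrite fmap_cmp cou_uni uni_nat -cmpA e cmp_idr.
  by rewrite cmpA -cou_nat -cmpA -fmap_cmp fm.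
- by rewrite -fmap_cmp gf0 fmap0.
move=> T h hf0; have [|r [rg ru]] := cg _ (fmap F h ∘ cou' a Y).
  by rewrite -cmpA -cou'_nat cmpA -fmap_cmp hf0 fmap0 cmp0l.
exists (uni a T ∘ fmap G r); split.
  rewrite -cmpA -fmap_cmp rg fmap_cmp inv_cou' cmpA uni_nat -cmpA.
  by have [_ e] := uniK a (G Y); rewrite e cmp_idr.
move=> m mg; rewrite (ru (fmap F m ∘ cou' a Z)).
  rewrite fmap_cmp inv_cou' cmpA uni_nat -cmpA.
  by have [_ e] := uniK a (G Z); rewrite e cmp_idr.
by rewrite -cmpA -cou'_nat cmpA -fmap_cmp mg.
Qed.

Lemma inv_faithful : faithful G.
Proof.
move=> V W f g e; apply: (iso_epi (cou_iso a V)).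
by rewrite -!cou_nat e.
Qed.

End EquivalenceExact.

Section NatIso.
Variables (k : fieldType) (D E : klin_cat k) (F F0 : lin_functor D E).
Variables (s : forall V, hom (F V) (F0 V)) (s' : forall V, hom (F0 V) (F V)).
Hypothesis (sK : forall V, inverse (s V) (s' V)).
Hypothesis (s_nat : forall V W (f : hom V W), s W ∘ fmap F f = fmap F0 f ∘ s V).

Let sV V : s V ∘ s' V = idm _. Proof. by case: (sK V). Qed.
Let s'V V : s' V ∘ s V = idm _. Proof. by case: (sK V). Qed.

Lemma iso_fmap V W (f : hom V W) : fmap F f = s' W ∘ fmap F0 f ∘ s V.
Proof. by rewrite -cmpA -s_nat cmpA s'V cmp_idl. Qed.

Lemma iso_faithful : faithful F0 -> faithful F.
Proof.
move=> fF0 V W f g e; apply: fF0; rewrite -[LHS]cmp_idr -[RHS]cmp_idr -sV !cmpA.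
by rewrite -!s_nat e.
Qed.

Lemma iso_exact : exact_functor F0 -> exact_functor F.
Proof.
move=> exF0 X Y Z f g fg; have [[gf0 _] _] := fg.
have [[_ kf] [_ cg]] := exF0 _ _ _ _ _ fg.
split; split; try by rewrite -fmap_cmp gf0 fmap0.
  move=> T h gh0; have [|l [fl lu]] := kf _ (s Y ∘ h).
    by rewrite cmpA -s_nat -cmpA gh0 cmp0r.
  exists (s' X ∘ l); split.
    by rewrite iso_fmap -!cmpA (cmpA (s X)) sV cmp_idl fl cmpA s'V cmp_idl.
  move=> m fm; rewrite (lu (s X ∘ m)); first by rewrite cmpA s'V cmp_idl.
  by rewrite cmpA -s_nat -cmpA fm.
move=> T h hf0; have [|r [rg ru]] := cg _ (h ∘ s' Y).
  rewrite -[RHS](cmp0l _ (s' X)) -hf0 iso_fmap -!cmpA sV cmp_idr.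
  by [].
exists (r ∘ s Z); split.
  by rewrite -cmpA s_nat cmpA rg -cmpA s'V cmp_idr.
move=> m mg; rewrite (ru (m ∘ s' Z)); first by rewrite -cmpA s'V cmp_idr.
by rewrite -mg iso_fmap -!cmpA sV cmp_idr.
Qed.

End NatIso.

Lemma comp_exact (k : fieldType) (C D E : klin_cat k) (G : lin_functor D E)
  (F : lin_functor C D) :
  exact_functor G -> exact_functor F -> exact_functor (comp_functor G F).
Proof. by move=> xG xF X Y Z f g /xF/xG. Qed.

(** * The monoidal structure of the forgetful functor *)

Section Assembly.
Variables (k : fieldType) (C D B : klin_cat k) (E : lin_functor C D).
Variables (a : adj_equivalence E) (M : monoidal C) (P : monoidal B).
Variables (omega : lin_functor C B) (J : strong_monoidal M P omega).
Variable F : lin_functor D B.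
Variables (th : forall X, hom (F (E X)) (omega X))
  (th' : forall X, hom (omega X) (F (E X))).
Hypothesis (thK : forall X, inverse (th X) (th' X)).
Hypothesis (th_nat : forall X Y (f : hom X Y),
  th Y ∘ fmap F (fmap E f) = fmap omega f ∘ th X).
Notation G := (inv_fun a).
Notation N := (transport_monoidal a M).

(** An isomorphism from [F] to [omega] after [G], along which the strong monoidal structure of that
    composite is pulled back to [F]. *)
Definition fib V : hom (F V) (omega (G V)) := th (G V) ∘ fmap F (cou' a V).
Definition fib' V : hom (omega (G V)) (F V) := fmap F (cou a V) ∘ th' (G V).

Lemma fibK V : inverse (fib V) (fib' V).
Proof.
have [t1 t2] := thK (G V); have [c1 c2] := couK a V; split; rewrite /fib /fib'.
  by rewrite cmpA -(cmpA _ (th' _)) t1 cmp_idr -fmap_cmp c2 fmap_id.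
by rewrite cmpA -(cmpA (th _)) -fmap_cmp c1 fmap_id cmp_idr t2.
Qed.

Lemma fib_nat V W (f : hom V W) :
  fib W ∘ fmap F f = fmap (comp_functor omega G) f ∘ fib V.
Proof.
by rewrite /fib -cmpA -fmap_cmp -cou'_nat fmap_cmp !cmpA th_nat.
Qed.

Definition fib_strong : strong_monoidal N P F :=
  iso_strong (comp_monoidal (transport_inv a M) J) fibK fib_nat.

Lemma uni_fib X : fmap omega (uni a X) ∘ fib (E X) = th X.
Proof.
rewrite /fib cmpA -th_nat -cmpA -fmap_cmp uni_cou.
by have [_ e] := couK a (E X); rewrite e fmap_id cmp_idr.
Qed.

Lemma th_fib' X T (h : hom (G (E X)) T) :
  th T ∘ fmap F (fmap E h) ∘ th' (G (E X)) = fmap omega h.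
Proof.
by rewrite th_nat -cmpA; have [_ e] := thK (G (E X)); rewrite e cmp_idr.
Qed.

(** By the triangle identity [fib] at [E X] is [th] up to the unit ([uni_fib]), so the units
    inserted by the transported structures cancel. *)
Lemma assembly : monoidal_iso (comp_monoidal (transport_strong a M) fib_strong) J.
Proof.
exists th; split.
- split=> [X|X Y f]; last exact: th_nat.
  by exists (th' X); apply: thK.
- move=> X Y; rewrite /= /comp_mon2 /= /trmon2 /isomon2 /comp_mon2 /= /invmon2.
  rewrite /fib' -uni_cou !cmpA -(cmpA (th _)) -fmap_cmp -fmap_cmp.
  rewrite (th_fib' (X := tob M (G (E X)) (G (E Y)))) -fmap_cmp.
  have [_ e] := uniK a (tob M (G (E X)) (G (E Y))).
  rewrite /= /invmon2 -(cmpA _ _ (uni' a _)) e cmp_idr -mon2_nat -cmpA -tmor_cmp.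
  by rewrite !uni_fib.
rewrite /= /comp_mon0 /= /comp_mon0 /= /fib' -uni_cou fmap_id cmp_idl !cmpA.
rewrite th_fib' -fmap_cmp; have [_ e] := uniK a (tunit M).
by rewrite e fmap_id cmp_idl.
Qed.

End Assembly.

Theorem proposition4p1 (k : closedFieldType) (C : klin_cat k)
    (M : monoidal C) (omega : lin_functor C (vec k))
    (J : strong_monoidal M (vec_monoidal k) omega) :
  abelian_cat C -> hereditary C -> finite_cat C -> pointed M ->
  is_fiber_functor J ->
  exists Q : quiver, acyclic Q /\ equivalent_to_rep J Q.
Proof.
move=> aC her finC ptd [xo fo].
have [P0 gen0] := finite_generator finC.
have [P [u Pu]] := represents_ex aC xo fo gen0.
have dim1 S : is_simple S -> fdim omega S = 1%N.
  by apply: (simple_dim1 aC xo fo Pu J).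
have [p _] := presentation_ex aC xo fo dim1 her Pu.
pose E := pres_functor fo p.
have [a _] : exists a : adj_equivalence E, True.
  apply: adj_equivalence_ex.
  - exact: pres_full.
  - exact: pres_faithful.
  exact: pres_ess_surj.
have [th_iso th_nat] := pres_eval_nat_iso fo p.
pose th X : hom (forget k _ (E X)) (omega X) := pres_eval fo p X.
pose th' X := proj1_sig (constructive_indefinite_description _ (th_iso X)).
have thK X : inverse (th X) (th' X).
  exact: (proj2_sig (constructive_indefinite_description _ (th_iso X))).
exists (pres_quiver p); split; first exact: pres_acyclic.
pose FG := comp_functor omega (inv_fun a).
have fK := fibK a thK; have f_nat := fib_nat a th_nat.
exists (transport_monoidal a M), (fib_strong a J thK th_nat); split.
  split.
    (* Exactness and faithfulness of the forgetful functor are inherited from [omega] after the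
       inverse equivalence, to which it is isomorphic. *)
    apply: (@iso_exact _ _ _ _ FG (fib a th) (fib' a th') fK f_nat).
    exact: (comp_exact xo (@inv_exact _ _ _ _ a)).
  apply: (@iso_faithful _ _ _ _ FG (fib a th) (fib' a th') fK f_nat).
  move=> V W f g e; apply: (@inv_faithful _ _ _ _ a).
  exact: (@fo _ _ _ _ e).
exists E, (transport_strong a M); split; first exact: adj_equivalence_is.
exact: assembly.
Qed.
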